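(* Let $n\ge 2$, $G=\mathrm{SL}_n(\mathbb{R})$ and $\Gamma=\mathrm{SL}_n(\mathbb{Z})$. Let $F=\{g_t:t\in\mathbb{R}\}$ be a one-parameter subgroup of $G$ which is diagonalizable and such that the eigenvalues $\lambda_1,\ldots,\lambda_n$ of $g_1$ (listed with multiplicity) satisfy $$\#\{i:|\lambda_i|<1\}=1\quad\text{and}\quad \#\{i:|\lambda_i|=\max_{1\le j\le n}|\lambda_j|\}\ge n-2 .$$ Let $F^+=\{g_t\in F:t\ge0\}$ and let $$H(F^+)=\Big\{h\in G:\lim_{t\to+\infty}g_t^{-1}hg_t=e\Big\}$$ be the expanding horospherical subgroup of $F^+$. Then for any $\Lambda\in G/\Gamma$, the set $$\{h\in H(F^+): h\Lambda\in E(F^+)\}$$ is hyperplane absolute winning (HAW) on the manifold $H(F^+)$, where $E(F^+)=\{\Lambda'\in G/\Gamma: F^+\Lambda'\text{ is bounded in }G/\Gamma\}$.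
   Context: $G$ acts on $G/\Gamma$ by left translations; a subset of $G/\Gamma$ is bounded if it has compact closure. $e$ is the identity of $G$. ''Diagonalizable'' means diagonalizable over $\mathbb{C}$ (the eigenvalues may be non-real). Hyperplane absolute game. For an affine hyperplane $L\subset\mathbb{R}^m$ and $\delta>0$ let $L^{(\delta)}=\{\mathbf{x}\in\mathbb{R}^m:\mathrm{dist}(\mathbf{x},L)<\delta\}$. Let $W\subset\mathbb{R}^m$ be open and $\beta\in(0,\frac13)$. In the $\beta$-hyperplane absolute game on $W$, Bob starts by choosing a closed ball $B_0\subset W$ of radius $\rho_0$. In the $i$-th turn, after Bob has chosen a closed ball $B_i$ of radius $\rho_i$, Alice chooses a hyperplane neighborhood $L_i^{(\delta_i)}$ with $\delta_i\le\beta\rho_i$; then Bob chooses a closed ball $B_{i+1}\subset B_i\setminus L_i^{(\delta_i)}$ of radius $\rho_{i+1}\ge\beta\rho_i$. A set $S\subset W$ is $\beta$-HAW on $W$ if, no matter how Bob plays, Alice can ensure that $\bigcap_{i\ge0}B_i\cap S\ne\emptyset$. $S$ is HAW on $W$ if it is $\beta$-HAW on $W$ for every $\beta\in(0,\frac13)$. HAW on manifolds. Let $M$ be a $C^1$ manifold with $C^1$ atlas $\{(U_\alpha,\phi_\alpha)\}$. A subset $S\subset M$ is HAW on $M$ if for each $\alpha$ the set $\phi_\alpha(S\cap U_\alpha)$ is HAW on the open set $\phi_\alpha(U_\alpha)$ (this does not depend on the choice of atlas). *)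

(* Defs.v *)
From HB Require Import structures.
From mathcomp Require Import all_boot all_order all_algebra.
From mathcomp Require Import generic_quotient complex.
From mathcomp Require Import all_classical all_reals all_analysis.

Set Implicit Arguments.
Unset Strict Implicit.
Unset Printing Implicit Defensive.

Import Order.TTheory GRing.Theory Num.Theory numFieldNormedType.Exports.

Local Open Scope classical_set_scope.
Local Open Scope ring_scope.
Local Open Scope quotient_scope.

(** * The hyperplane absolute game *)

(* The library norm on row vectors is the sup norm; the game is played with
   Euclidean balls and distances. *)
Definition enorm (R : realType) (m : nat) (x : 'rV[R]_m) : R :=
  Num.sqrt (\sum_(j < m) x ord0 j ^+ 2).

Definition eball (R : realType) (m : nat) : Type := ('rV[R]_m * R)%type.

Definition center (R : realType) (m : nat) (B : eball R m) : 'rV[R]_m := B.1.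

Definition radius (R : realType) (m : nat) (B : eball R m) : R := B.2.

Definition ball_set (R : realType) (m : nat) (B : eball R m) : set 'rV[R]_m :=
  [set x | enorm (x - center B) <= radius B].

Definition is_hyperplane (R : realType) (m : nat) (L : set 'rV[R]_m) : Prop :=
  exists (a : 'rV[R]_m) (c : R),
    a != 0 /\ L = [set x | \sum_(j < m) a ord0 j * x ord0 j = c].

Definition edist (R : realType) (m : nat) (x : 'rV[R]_m) (L : set 'rV[R]_m) : R :=
  inf [set enorm (x - y) | y in L].

Definition nbhd_set (R : realType) (m : nat) (L : set 'rV[R]_m) (delta : R) :
    set 'rV[R]_m :=
  [set x | edist x L < delta].

(* Alice's move [(L, delta)] stands for the removal of [nbhd_set L delta]. *)
Definition alice_move (R : realType) (m : nat) : Type := (set 'rV[R]_m * R)%type.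

Definition alice_legal (R : realType) (m : nat) (beta : R) (B : eball R m)
    (A : alice_move R m) : Prop :=
  [/\ is_hyperplane A.1, 0 < A.2 & A.2 <= beta * radius B].

Definition bob_start (R : realType) (m : nat) (W : set 'rV[R]_m) (B : eball R m) :
    Prop :=
  0 < radius B /\ ball_set B `<=` W.

Definition bob_legal (R : realType) (m : nat) (beta : R) (B : eball R m)
    (A : alice_move R m) (B' : eball R m) : Prop :=
  ball_set B' `<=` ball_set B `\` nbhd_set A.1 A.2 /\
  beta * radius B <= radius B'.

(* A strategy maps the finite sequence of balls chosen so far by Bob to Alice's
   answer.  It has to answer legally in every position reached by legal moves
   of Bob, so Alice cannot win by cutting the game short. *)
Definition beta_HAW (R : realType) (m : nat) (beta : R) (W S : set 'rV[R]_m) :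
    Prop :=
  S `<=` W /\
  exists sigma : seq (eball R m) -> alice_move R m,
    forall B : nat -> eball R m, bob_start W (B 0%N) ->
      let A := fun i => sigma (mkseq B i.+1) in
      (forall k, (forall i, (i < k)%N -> bob_legal beta (B i) (A i) (B i.+1)) ->
         alice_legal beta (B k) (A k)) /\
      ((forall i, bob_legal beta (B i) (A i) (B i.+1)) ->
         (\bigcap_i ball_set (B i)) `&` S !=set0).

Definition HAW (R : realType) (m : nat) (W S : set 'rV[R]_m) : Prop :=
  forall beta : R, 0 < beta -> beta < 3%:R^-1 -> beta_HAW beta W S.

(** * HAW subsets of embedded C^1 submanifolds *)

Definition C1_on (R : realType) (E F : normedModType R) (V : set E) (f : E -> F) :
    Prop :=
  forall x, V x ->
    differentiable f x /\ forall v : E, {for x, continuous (fun y => 'd f y v)}.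

(* [(U, phi)] belongs to the maximal C^1 atlas of the embedded submanifold [M]
   of [E]: [phi] is a C^1 diffeomorphism of the relatively open subset [U] of
   [M] onto an open subset of R^m.  As usual for subsets of [E], [phi] is C^1
   on [U] when it is the restriction of a C^1 map on an open subset of [E]. *)
Definition C1_chart (R : realType) (E : normedModType R) (M : set E) (m : nat)
    (U : set E) (phi : E -> 'rV[R]_m) : Prop :=
  [/\ exists O : set E, [/\ open O, U = M `&` O & C1_on O phi],
      open (phi @` U) &
      exists psi : 'rV[R]_m -> E,
        (forall y, U y -> psi (phi y) = y) /\ C1_on (phi @` U) psi].

Definition HAW_on_manifold (R : realType) (E : normedModType R) (M S : set E) :
    Prop :=
  forall (m : nat) (U : set E) (phi : E -> 'rV[R]_m),
    C1_chart M U phi -> HAW (phi @` U) (phi @` (S `&` U)).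

(** * SL_n(R) as a topological group *)

Section SpecialLinear.
Variables (R : realType) (n : nat).

Definition SL : Type := {A : 'M[R]_n | \det A == 1}.

HB.instance Definition _ := SubChoice.on SL.
HB.instance Definition _ := Topological.copy SL (initial_topology (val : SL -> 'M[R]_n)).

Definition SLmx (A : SL) : 'M[R]_n := val A.

Lemma SL_det (A : SL) : \det (SLmx A) = 1.
Proof. exact/eqP/(valP A). Qed.

Lemma SL_unit (A : SL) : SLmx A \in unitmx.
Proof. by rewrite unitmxE SL_det unitr1. Qed.

Fact SL_one_subproof : \det (1%:M : 'M[R]_n) == 1.
Proof. by rewrite det1. Qed.

Fact SL_mul_subproof (A B : SL) : \det (SLmx A *m SLmx B) == 1.
Proof. by rewrite det_mulmx !SL_det mulr1. Qed.

Fact SL_inv_subproof (A : SL) : \det (invmx (SLmx A)) == 1.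
Proof. by rewrite det_inv SL_det invr1. Qed.

Definition SL_one : SL := Sub 1%:M SL_one_subproof.
Definition SL_mul (A B : SL) : SL := Sub (SLmx A *m SLmx B) (SL_mul_subproof A B).
Definition SL_inv (A : SL) : SL := Sub (invmx (SLmx A)) (SL_inv_subproof A).

Fact SL_mulA : associative SL_mul.
Proof. by move=> A B C; apply/val_inj; exact: mulmxA. Qed.

Fact SL_mul1 : left_id SL_one SL_mul.
Proof. by move=> A; apply/val_inj; exact: mul1mx. Qed.

Fact SL_1mul : right_id SL_one SL_mul.
Proof. by move=> A; apply/val_inj; exact: mulmx1. Qed.

Fact SL_mulV : left_inverse SL_one SL_inv SL_mul.
Proof. by move=> A; apply/val_inj; exact: (mulVmx (SL_unit A)). Qed.

Fact SL_Vmul : right_inverse SL_one SL_inv SL_mul.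
Proof. by move=> A; apply/val_inj; exact: (mulmxV (SL_unit A)). Qed.

HB.instance Definition _ :=
  isGroup.Build SL SL_mulA SL_mul1 SL_1mul SL_mulV SL_Vmul.

Lemma SLmx1 : SLmx 1%g = 1%:M. Proof. by []. Qed.

Lemma SLmxM (A B : SL) : SLmx (A * B)%g = SLmx A *m SLmx B. Proof. by []. Qed.

Lemma SLmxV (A : SL) : SLmx A^-1%g = invmx (SLmx A). Proof. by []. Qed.

(** * The space of lattices SL_n(R) / SL_n(Z) *)

Definition SLZ : set SL :=
  [set A | exists Z : 'M[int]_n, \det Z = 1 /\ SLmx A = map_mx intr Z].

Lemma SLZ1 : SLZ 1%g.
Proof. by exists 1%:M; rewrite det1 map_mx1 SLmx1. Qed.

Lemma SLZM (A B : SL) : SLZ A -> SLZ B -> SLZ (A * B)%g.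
Proof.
move=> [Y [dY eY]] [Z [dZ eZ]]; exists (Y *m Z).
by rewrite det_mulmx dY dZ mulr1 map_mxM -eY -eZ SLmxM.
Qed.

Lemma SLZV (A : SL) : SLZ A -> SLZ A^-1%g.
Proof.
move=> [Z [dZ eZ]]; exists (\adj Z).
have ZadjZ : Z *m \adj Z = 1%:M by rewrite mul_mx_adj dZ.
split; first by have := congr1 determinant ZadjZ; rewrite det_mulmx dZ mul1r det1.
apply: (can_inj (mulKmx (SL_unit A))).
by rewrite SLmxV mulmxV ?SL_unit// eZ -map_mxM ZadjZ map_mx1.
Qed.

Definition coset_rel (A B : SL) : bool := `[< SLZ (A^-1 * B)%g >].

Fact coset_rel_refl : reflexive coset_rel.
Proof. by move=> A; apply/asboolP; rewrite mulVg; exact: SLZ1. Qed.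

Fact coset_rel_sym : symmetric coset_rel.
Proof.
by move=> A B; apply/asboolP/asboolP => /SLZV; rewrite invgM invgK.
Qed.

Fact coset_rel_trans : transitive coset_rel.
Proof.
move=> B A C /asboolP AB /asboolP BC; apply/asboolP.
by have := SLZM AB BC; rewrite mulgA mulgK.
Qed.

Canonical coset_equiv :=
  EquivRel coset_rel coset_rel_refl coset_rel_sym coset_rel_trans.

Definition lattices : Type := quotient_topology {eq_quot coset_equiv}.

HB.instance Definition _ := Topological.on lattices.
HB.instance Definition _ := Quotient.on lattices.

Definition translate (A : SL) (x : lattices) : lattices :=
  \pi_lattices (A * repr x)%g.

Lemma translate_pi (A B : SL) :
  translate A (\pi_lattices B) = \pi_lattices (A * B)%g.
Proof.
apply/eqmodP/asboolP; rewrite invgM -mulgA mulKg.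
by apply/asboolP; change (coset_equiv (repr (\pi_lattices B)) B); rewrite -eqmodE reprK.
Qed.

Definition bounded_lattices (X : set lattices) : Prop := compact (closure X).

(** * One-parameter subgroups *)

Definition one_parameter_subgroup (g : R -> SL) : Prop :=
  continuous g /\ forall s t : R, g (s + t) = (g s * g t)%g.

(* A real matrix, seen over the complex numbers. *)
Definition Cmx (A : SL) : 'M[R[i]]_n := map_mx (real_complex R) (SLmx A).

Definition diagonalizable_subgroup (g : R -> SL) : Prop :=
  exists2 P : 'M[R[i]]_n, P \in unitmx &
    forall t : R, diagonalizable_for P (Cmx (g t)).

(* The eigenvalues of [A], listed with multiplicity. *)
Definition eigenvalue_list (A : SL) (lambda : 'I_n -> R[i]) : Prop :=
  char_poly (Cmx A) = \prod_(i < n) ('X - (lambda i)%:P).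

Definition max_modulus (lambda : 'I_n -> R[i]) : R :=
  \big[Num.max/0]_(i < n) Normc.normc (lambda i).

Definition forward_ray (g : R -> SL) : set SL := [set g t | t in [set t | 0 <= t]].

Definition horospherical (g : R -> SL) : set SL :=
  [set h | (fun t : R => ((g t)^-1 * h * g t)%g) @ +oo --> (1%g : SL)].

Definition bounded_orbit_points (F : set SL) : set lattices :=
  [set x | bounded_lattices [set translate f x | f in F]].

End SpecialLinear.

(* Main.v *)
Require Import Defs.
From mathcomp Require Import all_boot all_order all_algebra complex.
From mathcomp Require Import all_classical all_reals all_analysis.
From mathcomp Require Import perm ring lra zify.

Import Order.TTheory GRing.Theory Num.Theory numFieldNormedType.Exports.

Local Open Scope classical_set_scope.
Local Open Scope ring_scope.

Set Implicit Arguments.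
Unset Strict Implicit.
Unset Printing Implicit Defensive.

(* Let Lambda = g0 Z^n. By Mahler's criterion, h Lambda has a bounded orbit as soon as no
   g_t h g0 u, with u a nonzero integer vector and t a multiple of a large step, is short.
   The hypothesis splits R^n into a line contracted by c^-1, at most one line expanded by b, and
   the space E on which the flow expands by a > b, with ab <= c.

   If h is in danger for the first time at time t, the dual lattice contains a short vector w,
   so that h lies near a hypersurface {w h^-1 e3 = 0}, which has a definite gradient on the
   horospherical subgroup. Put Q = ac and call generation the integer N for which Q^-N is the
   scale of that neighbourhood. For the pairs (N, t), with k = t - N, the obstructions met in a
   ball of radius Q^-i, i = N - J - k/lag, all reduce to a single hypersurface: for small k
   because the pairing of a dual vector with a dangerous vector is an integer of absolute value
   less than 1, and for large k because the minors of two dual vectors are small with respect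
   to a lattice without short vectors, hence vanish.

   When the radius of Bob's ball reaches Q^-i, Alice registers these boundedly many new
   hypersurfaces per generation N with weight theta^N. An affine function of definite gradient is
   not small at m + 1 points in general position, so the points near which most of the total
   weight hits lie close to a hyperplane; Alice removes it, and divides by a definite factor the
   weight that can still hit the ball. The weight near the surviving point stays below
   theta^i / 2, so that no hypersurface of generation at most i contains it. *)

(** The horospherical subgroup is expanded at the rates ac, bc and a/b, whereas Bob's balls are
    round; the scale Q^-i follows the largest rate only. The multiplicity hypothesis enters through
    the minors of two dual vectors seen at time i. Put j = N - i. Their coordinates along E and e3
    are small, but the one along e2 may be as large as b^(j+k). As there is only one such direction,
    the product of two large coordinates cancels by antisymmetry, and the mixed products are
    controlled by ab <= c, a consequence of determinant 1.

    The delay j must grow with k, since the number of values of k that occur at stage i grows with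
    i: the weights theta^(J + k/lag) have a bounded sum over k, which a large J makes small. It must
    grow slowly, since comparing minors at time i loses a factor a^(2j) against a gain of a^k.

    The order of the constants matters: C is fixed first, then the flow is replaced by a power, so
    that a exceeds C^60, and J comes last. Losses that depend on J are paid for by k >= lag * J. *)

Section MatrixNorm.
Variable R : realType.

Lemma ler_entry_norm (m n : nat) (A : 'M[R]_(m, n)) i j : `|A i j| <= `|A|.
Proof.
by rewrite [leRHS]/Num.norm /= mx_normrE; apply/bigmax_geP; right; exists (i, j).
Qed.

Lemma norm_mx_le (m n : nat) (A : 'M[R]_(m, n)) (x : R) :
  0 <= x -> (forall i j, `|A i j| <= x) -> `|A| <= x.
Proof.
move=> x0 Ax; rewrite [leLHS]/Num.norm /= mx_normrE.
by apply/bigmax_leP; split=> // -[i j] _; exact: Ax.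
Qed.

Lemma norm_mx_lt (m n : nat) (A : 'M[R]_(m, n)) (x : R) :
  0 < x -> (forall i j, `|A i j| < x) -> `|A| < x.
Proof.
move=> x0 Ax; rewrite [ltLHS]/Num.norm /= mx_normrE.
by apply/bigmax_ltP; split=> // -[i j] _; exact: Ax.
Qed.

Lemma norm_mulmx (m n p : nat) (A : 'M[R]_(m, n)) (B : 'M[R]_(n, p)) :
  `|A *m B| <= n%:R * (`|A| * `|B|).
Proof.
apply: norm_mx_le => [|i j]; first by rewrite !mulr_ge0.
rewrite mxE (le_trans (ler_norm_sum _ _ _))//.
rewrite -[X in _ <= X%:R * _]card_ord mulr_natl -sumr_const; apply: ler_sum => k _.
by rewrite normrM ler_pM// ler_entry_norm.
Qed.

Lemma norm_trmx (m n : nat) (A : 'M[R]_(m, n)) : `|A^T| = `|A|.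
Proof.
apply/eqP; rewrite eq_le; apply/andP; split; apply: norm_mx_le => // i j.
  by rewrite mxE ler_entry_norm.
by rewrite -[A]trmxK mxE trmxK ler_entry_norm.
Qed.

Lemma norm_int_mx_ge1 (m n : nat) (A : 'M[int]_(m, n)) :
  A != 0 -> 1 <= `|map_mx intr A : 'M[R]_(m, n)|.
Proof.
move=> A0; have [/existsP[i /existsP[j Aij]]|] := boolP [exists i, exists j, A i j != 0].
  apply: le_trans (ler_entry_norm _ i j); rewrite mxE -intr_norm ler1z.
  by move: Aij; rewrite -normr_gt0 => ?; lia.
move=> /existsPn nA; case/eqP: A0; apply/matrixP => i j; rewrite mxE.
by have /existsPn/(_ j) := nA i; rewrite negbK => /eqP.
Qed.

Lemma intr_eq0_lt1 (z : int) : `|z%:~R : R| < 1 -> z = 0.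
Proof. by rewrite -intr_norm ltrz1 => ?; lia. Qed.

End MatrixNorm.

(** * Reduction of positive definite forms *)

Section Reduction.
Variable R : realType.

Definition qform (n : nat) (S : 'M[R]_n) (x : 'rV[R]_n) : R := (x *m S *m x^T) 0 0.

Lemma qformZ (n : nat) (S : 'M[R]_n) (k : R) (x : 'rV[R]_n) :
  qform S (k *: x) = k ^+ 2 * qform S x.
Proof. by rewrite /qform linearZ -!scalemxAl -scalemxAr scalerA !mxE expr2. Qed.

Lemma qform_congr (n : nat) (S L : 'M[R]_n) (x : 'rV[R]_n) :
  qform (L *m S *m L^T) x = qform S (x *m L).
Proof. by rewrite /qform trmx_mul !mulmxA. Qed.

Lemma unitz_sq (d : int) : d \is a GRing.unit -> d * d = 1.
Proof. by rewrite qualifE /= => /orP[] /eqP ->. Qed.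

Lemma det_unit_intmx_sq (n : nat) (L : 'M[int]_n) :
  L \in unitmx -> \det (map_mx intr L : 'M[R]_n) ^+ 2 = 1.
Proof. by rewrite unitmxE => /unitz_sq dL; rewrite det_map_mx -rmorphXn expr2 dL. Qed.

(** In the Smith normal form of a one-row matrix only one diagonal entry is present, so [b] is a
    multiple of the first row of the right unimodular factor. *)
Lemma unimodular_completion (n : nat) (b : 'rV[int]_(1 + n)) :
  exists2 L : 'M[int]_(1 + n), L \in unitmx & exists d : int, b = d *: row 0 L.
Proof.
have [L0 _ [L uL [d _ ->]]] := int_Smith_normal_form b.
exists L => //; exists (L0 0 0 * d`_0).
apply/rowP => j; rewrite -mulmxA [LHS]mxE big_ord1 [RHS]mxE [row _ _ _ _]mxE -mulrA.
rewrite [X in _ * X = _]mxE (bigD1 0)//= big1 ?addr0 => [|k k0].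
  by rewrite mxE eqxx mulr1n.
by rewrite mxE /= eq_sym (negbTE (_ : (k : nat) != 0%N)) ?mulr0n ?mul0r.
Qed.

(** Completing the square in the first variable; the same block elimination factors the
    determinant. *)
Lemma schur_complement (n : nat) (S : 'M[R]_(1 + n)) (s := S 0 0) (t := ursubmx S)
    (S' := drsubmx S - s^-1 *: (t^T *m t)) :
  S^T = S -> s != 0 ->
  [/\ S'^T = S', \det S = s * \det S' &
      forall (a : R) (x : 'rV[R]_n),
        qform S (row_mx a%:M x) = s * (a + s^-1 * (t *m x^T) 0 0) ^+ 2 + qform S' x].
Proof.
move=> symS s0.
have Sul : ulsubmx S = s%:M.
  by apply/matrixP => i j; rewrite !ord1 !mxE eqxx mulr1n; congr (S _ _); apply/val_inj.
have Sdl : dlsubmx S = t^T by rewrite /t trmx_ursub symS.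
have Sdr : (drsubmx S)^T = drsubmx S by rewrite trmx_drsub symS.
have SE : S = block_mx s%:M t t^T (drsubmx S) by rewrite -Sul -Sdl submxK.
split.
- by rewrite /S' linearB linearZ /= trmx_mul trmxK Sdr.
- have -> : S = block_mx 1%:M 0 (s^-1 *: t^T) 1%:M *m block_mx s%:M t 0 S'.
    rewrite mulmx_block !mul1mx !mul0mx ?addr0 mul_mx_scalar scalerA divff//.
    by rewrite scale1r -scalemxAl /S' addrC subrK {1}SE.
  by rewrite det_mulmx det_lblock det_ublock !det1 !mul1r det_scalar1.
- move=> a x; have xt : (x *m t^T) 0 0 = (t *m x^T) 0 0.
    by rewrite -[in RHS](trmxK t) -trmx_mul [RHS]mxE.
  have eD (A B : 'M[R]_1) : (A + B) 0 0 = A 0 0 + B 0 0 by rewrite mxE.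
  have eN (A : 'M[R]_1) : (- A) 0 0 = - A 0 0 by rewrite mxE.
  have eZ k (A : 'M[R]_1) : (k *: A) 0 0 = k * A 0 0 by rewrite mxE.
  have ttE : (x *m (t^T *m t) *m x^T) 0 0 = (t *m x^T) 0 0 ^+ 2.
    by rewrite !mulmxA -mulmxA [LHS]mxE big_ord1 xt expr2.
  rewrite /qform {1}SE tr_row_mx mul_row_block mul_row_col tr_scalar_mx !mulmxDl.
  rewrite /S' mulmxBr -scalemxAr mulmxBl -scalemxAl -scalar_mxM !mul_mx_scalar.
  rewrite !mul_scalar_mx -scalemxAl !(eD, eN, eZ) ttE xt mxE eqxx mulr1n.
  by field.
Qed.

Lemma nearest_int (x : R) : exists k : int, (k%:~R + x) ^+ 2 <= 4^-1.
Proof.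
exists (- Num.floor (x + 2^-1)).
have /andP[h1 h2] := floor_itv (x + 2^-1).
rewrite rmorphN /=; set y := _%:~R in h1 *.
have {}h2 : x + 2^-1 < y + 1 by move: h2; rewrite intrD.
have -> : (- y + x) ^+ 2 = `|x - y| ^+ 2 by rewrite real_normK ?num_real// addrC.
rewrite (_ : 4^-1 = 2^-1 ^+ 2 :> R); last by field.
rewrite lerXn2r ?nnegrE//; last by rewrite ler_norml; apply/andP; split; lra.
Qed.

(** A vector within a factor 6/5 of the infimum replaces a minimal one, so the infimum need not be
    attained. Passing to the primitive vector [row 0 L] divides the form by d^2 >= 1 and keeps this
    property. *)
Lemma near_minimum (n : nat) (S : 'M[R]_(1 + n)) (e : R) : 0 < e ->
  (forall u : 'rV[int]_(1 + n), u != 0 -> e <= qform S (map_mx intr u)) ->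
  exists2 L : 'M[int]_(1 + n), L \in unitmx &
    forall u : 'rV[int]_(1 + n), u != 0 ->
      qform S (map_mx intr (row 0 L)) <= 6 / 5 * qform S (map_mx intr u).
Proof.
move=> e0 He; pose V := [set qform S (map_mx intr u) | u in [set u : 'rV[int]_(1 + n) | u != 0]].
have u1 : (delta_mx 0 0 : 'rV[int]_(1 + n)) != 0.
  by apply/eqP => /matrixP/(_ 0 0); rewrite !mxE !eqxx.
have Vlb : lbound V e by move=> _ [u /= u0 <-]; exact: He.
have Vinf : has_inf V by split; [exists (qform S (map_mx intr (delta_mx 0 0))); exists (delta_mx 0 0)|exists e].
have infe : e <= inf V by apply: lb_le_inf => //; case: Vinf.
have [|_ [u /= u0 <-] hu] := @inf_adherent _ V (inf V / 5) _ Vinf.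
  by rewrite divr_gt0// (lt_le_trans e0).
have [L uL [d ud]] := unimodular_completion u.
exists L => // v v0.
have vV : inf V <= qform S (map_mx intr v) by apply: ge_inf; [exists e|exists v].
have d0 : d != 0 by apply: contra u0 => /eqP d0; rewrite ud d0 scale0r.
have L0 : row 0 L != 0 by apply: contra u0 => /eqP d1; rewrite ud d1 scaler0.
have := He _ L0; set q := qform S _ => eq.
have uq : qform S (map_mx intr u) = d%:~R ^+ 2 * q.
  by rewrite ud map_mxZ qformZ.
have : q <= qform S (map_mx intr u).
  rewrite uq ler_peMl//; first by lra.
  by rewrite -rmorphXn /= ler1z; nia.
by lra.
Qed.

(** Hermite's induction: a nearly minimal vector comes first, the Schur complement is reduced, and
    each of its reduced vectors is lifted with the nearest integer as first coordinate, at a cost of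
    at most s/4. *)
Lemma sym_form_reduction (n : nat) : exists2 C : R, 1 <= C &
  forall (S : 'M[R]_n) (e : R), S^T = S -> (forall x, 0 <= qform S x) -> 0 < e ->
  (forall u : 'rV[int]_n, u != 0 -> e <= qform S (map_mx intr u)) ->
  exists2 L : 'M[int]_n, L \in unitmx &
    forall i, qform S (row i (map_mx intr L)) <= C * \det S / e ^+ n.-1.
Proof.
elim: n => [|n [C C1 IH]].
  by exists 1 => // S e _ _ _ _; exists 1%:M => [|[]//]; exact: unitmx1.
exists (2 ^+ n.+1 * C); first by rewrite -[leLHS]mulr1 ler_pM// exprn_ege1//; lra.
rewrite -[n.+1]/(1 + n)%N => S e symS posS e0 He.
have [L uL Lmin] := near_minimum e0 He.
pose LR : 'M[R]_(1 + n) := map_mx intr L; pose S1 := LR *m S *m LR^T.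
have symS1 : S1^T = S1 by rewrite /S1 !trmx_mul trmxK symS mulmxA.
have detS1 : \det S1 = \det S.
  by rewrite /S1 !det_mulmx det_tr mulrAC -expr2 det_unit_intmx_sq// mul1r.
have rowL (u : 'rV[int]_(1 + n)) :
    qform S1 (map_mx intr u) = qform S (map_mx intr (u *m L)).
  by rewrite /S1 qform_congr map_mxM.
have uL0 (u : 'rV[int]_(1 + n)) : u != 0 -> u *m L != 0.
  by apply: contra => /eqP uL0; rewrite -(mulmxK uL u) uL0 mul0mx.
pose s := S1 0 0.
have sE : s = qform S (map_mx intr (row 0 L)).
  rewrite [row 0 L]rowE -rowL /s /qform map_delta_mx trmx_delta.
  by rewrite -rowE -colE !mxE.
have u1 : (delta_mx 0 0 : 'rV[int]_(1 + n)) != 0.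
  by apply/eqP => /matrixP/(_ 0 0); rewrite !mxE !eqxx.
have es : e <= s by rewrite sE; apply: He; rewrite [row 0 L]rowE; exact: uL0.
have s0 : 0 < s by rewrite (lt_le_trans e0).
have smin (u : 'rV[int]_(1 + n)) : u != 0 -> s <= 6 / 5 * qform S1 (map_mx intr u).
  by move=> u0; rewrite sE rowL; apply: Lmin; exact: uL0.
have [] := schur_complement symS1 (lt0r_neq0 s0); rewrite -/s.
set t := ursubmx S1; set S' := drsubmx S1 - _ => symS' detS' qE.
have posS' x : 0 <= qform S' x.
  (* This first coordinate makes the square in [qE] vanish. *)
  have := posS (row_mx (- (s^-1 * (t *m x^T) 0 0))%:M x *m LR).
  by rewrite -qform_congr -/S1 qE addNr expr0n mulr0 add0r.
have lift (u : 'rV[int]_n) : exists k : int,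
    qform S1 (map_mx intr (row_mx k%:M u)) <= s / 4 + qform S' (map_mx intr u).
  have [k hk] := nearest_int (s^-1 * (t *m (map_mx intr u)^T) 0 0).
  exists k; rewrite map_row_mx map_scalar_mx qE lerD2r.
  by rewrite ler_pM2l.
(* Near minimality gives s <= 6/5 (s/4 + S'(u)), that is S'(u) >= 7s/12. Any factor below 4/3 in
   [near_minimum] would leave a positive proportion of s here. *)
have minS' (u : 'rV[int]_n) : u != 0 -> s / 2 <= qform S' (map_mx intr u).
  move=> u0; have [k hk] := lift u.
  have : s <= 6 / 5 * qform S1 (map_mx intr (row_mx k%:M u)).
    apply: smin; apply: contra u0 => /eqP/(congr1 rsubmx); rewrite row_mxKr => ->.
    by rewrite linear0.
  by lra.
have [M uM Mred] := IH S' (s / 2) symS' posS' (divr_gt0 s0 (ltr0Sn R 1)) minS'.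
have [ks hks] := choice (fun i => lift (row i M)).
pose N : 'M[int]_(1 + n) := block_mx 1%:M 0 (\col_i ks i) M.
exists (N *m L).
  by rewrite unitmx_mul uL andbT /N unitmxE det_lblock det1 mul1r -unitmxE.
have NE i : qform S (row i (map_mx intr (N *m L))) = qform S1 (map_mx intr (row i N)).
  by rewrite rowL -map_row; congr (qform S (map_mx _ _)); rewrite -row_mul.
pose Y := C * \det S' / (s / 2) ^+ n.-1.
pose X := 2 ^+ n.+1 * C * \det S / e ^+ n.
(* A reduced vector has S'-value between s/2 and Y, whence s <= 2Y. Then 2Y <= X, because det S = s
   det S', e <= s, and the power of 2 in X absorbs those of s/2. *)
have [sX YX] : s <= X /\ ((0 < n)%N -> s / 4 + Y <= X).
  rewrite /X -detS1 detS'.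
  have [n0|n0] := posnP n.
    have n0det p : p = 0%N -> forall T : 'M[R]_p, \det T = 1.
      by move=> -> T; rewrite det_mx00.
    split; last by move=> n1; move: n1; lia.
    have e1 : e ^+ n = 1 by rewrite n0 expr0.
    have e2 : 2 ^+ n.+1 = 2 :> R by rewrite n0 expr1.
    by rewrite (n0det _ n0) e1 e2; nra.
  have r0 : row (Ordinal n0) M != 0.
    apply/eqP => r0; have := congr1 (row (Ordinal n0)) (mulmxV uM).
    rewrite row_mul r0 mul0mx => /matrixP/(_ 0 (Ordinal n0)).
    by rewrite !mxE eqxx.
  have sY : s <= 2 * Y.
    have := Mred (Ordinal n0); have := minS' _ r0.
    by rewrite -map_row /Y; lra.
  have sn0 : 0 < (s / 2) ^+ n.-1 by rewrite exprn_gt0// divr_gt0.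
  have C0 : 0 < C by lra.
  have D0 : 0 < \det S'.
    have : 0 < Y by lra.
    by rewrite /Y pmulr_lgt0 ?invr_gt0// pmulr_rgt0.
  have YX : 2 * Y <= 2 ^+ n.+1 * C * (s * \det S') / e ^+ n.
    have -> : 2 * Y = 2 ^+ n * C * (s * \det S') / s ^+ n.
      have eqp (D : R) p : (0 < p)%N ->
          2 * (C * D / (s / 2) ^+ p.-1) = 2 ^+ p * C * (s * D) / s ^+ p.
        case: p => // p _; rewrite expr_div_n !exprS /=; field.
        by rewrite !expf_neq0 ?lt0r_neq0// ltr0Sn.
      exact: eqp.
    rewrite exprS; apply: ler_pM.
    - by rewrite !mulr_ge0 ?exprn_ge0 ?ltW.
    - by rewrite invr_ge0 exprn_ge0 ?ltW.
    - apply: ler_wpM2r; first by rewrite mulr_ge0 ?ltW.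
      apply: ler_wpM2r; first exact: ltW.
      by rewrite ler_peMl// ?exprn_ge0//; lra.
    - by rewrite lef_pV2 ?posrE ?exprn_gt0// lerXn2r// nnegrE ltW.
  by split; [|move=> _]; lra.
move=> i; rewrite NE.
have [j ->|j ->] := split_ordP i.
  suff -> : qform S1 (map_mx intr (row (lshift n j) N)) = s by [].
  rewrite /N /block_mx rowKu row_row_mx ord1 row1 row0 sE [row 0 L]rowE -rowL.
  congr (qform S1 (map_mx _ _)); apply/rowP => k; rewrite !mxE.
  by case: split_ordP => k' ->; rewrite !mxE ?ord1//= eq_lrshift.
have n0 : (0 < n)%N by case: (n) j => [[]|].
rewrite /N /block_mx rowKd row_row_mx.
have := hks j; have := Mred j; have := YX n0; rewrite -map_row -/Y -/X.
have -> : row j (\col_i ks i) = (ks j)%:M.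
  by apply/matrixP => i' j'; rewrite !ord1 !mxE eqxx mulr1n.
lra.
Qed.

End Reduction.

(** * Reduced bases, transference to the dual lattice, and minors *)

Section LatticeReduction.
Variable R : realType.

Lemma qform_gram (n : nat) (g : 'M[R]_n) (x : 'rV[R]_n) :
  qform (g^T *m g) x = \sum_i (g *m x^T) i 0 ^+ 2.
Proof.
rewrite /qform mulmxA -mulmxA -{1}[x]trmxK -trmx_mul mxE.
by apply: eq_bigr => i _; rewrite mxE expr2.
Qed.

(* The determinant of a reduced basis matrix is corrected by a sign change. *)
Lemma lattice_reduction (n : nat) : exists2 C : R, 1 <= C &
  forall (g : 'M[R]_n) (e : R), \det g = 1 -> 0 < e -> e <= 1 ->
  (forall u : 'cV[int]_n, u != 0 -> e <= `|g *m map_mx intr u|) ->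
  exists2 c : 'M[int]_n, \det c = 1 & `|g *m map_mx intr c| <= C / e ^+ n.
Proof.
have [C C1 HC] := sym_form_reduction R n; exists C => // g e dg e0 e1 He.
have entry_q x i : (g *m x^T) i 0 ^+ 2 <= qform (g^T *m g) x.
  rewrite qform_gram (bigD1 i)//= lerDl; apply: sumr_ge0 => j _; exact: sqr_ge0.
have posS x : 0 <= qform (g^T *m g) x.
  by rewrite qform_gram; apply: sumr_ge0 => i _; exact: sqr_ge0.
have [||u u0|L uL Lq] := HC (g^T *m g) (e ^+ 2) _ posS.
- by rewrite trmx_mul trmxK.
- by rewrite exprn_gt0.
- have uT0 : u^T != 0 by apply: contra u0 => /eqP u0; rewrite -[u]trmxK u0 trmx0.
  have := He _ uT0; rewrite -map_trmx.
  have [i gi] : exists i, `|g *m (map_mx intr u)^T| = `|(g *m (map_mx intr u)^T) i 0|.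
    have [|[i j] E] := @mx_norm_neq0 _ _ _ (g *m (map_mx intr u)^T : 'cV[R]_n).
      by apply: lt0r_neq0; apply: lt_le_trans e0 _; rewrite map_trmx; exact: He.
    by exists i; rewrite (ord1 j) in E.
  rewrite gi => h; apply: le_trans (entry_q _ i).
  by rewrite -[leRHS]real_normK ?num_real// lerXn2r// nnegrE ltW.
rewrite det_mulmx det_tr dg !mulr1 in Lq.
have [n0|n0] := posnP n.
  exists 1%:M; first by rewrite det1.
  rewrite norm_mx_le ?divr_ge0 ?exprn_ge0 ?(ltW e0)//; first by lra.
  by move=> i; have := ltn_ord i; lia.
pose i0 := Ordinal n0; pose d := \det L.
have dd : d * d = 1 by apply: unitz_sq; rewrite -unitmxE.
pose D : 'M[int]_n := diag_mx (\row_j (if j == i0 then d else 1)).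
exists (L^T *m D).
  rewrite det_mulmx det_tr det_diag (bigD1 i0)//= mxE eqxx big1 ?mulr1//.
  by move=> j /negbTE jn; rewrite mxE jn.
have Xge0 : 0 <= C / e ^+ n by rewrite divr_ge0 ?exprn_ge0 ?(ltW e0)//; lra.
apply: norm_mx_le => // j i.
have -> : `|(g *m map_mx intr (L^T *m D)) j i| = `|(g *m (row i (map_mx intr L))^T) j 0|.
  rewrite map_mxM mulmxA map_diag_mx mul_mx_diag [_ j i]mxE !mxE normrM.
  have -> : `|(if i == i0 then d else 1)%:~R : R| = 1.
    case: eqP => _; last by rewrite normr1.
    by apply/eqP; rewrite -sqr_norm_eq1 -rmorphXn expr2 dd.
  by rewrite mulr1; congr `|_|; apply: eq_bigr => k _; rewrite !mxE.
rewrite -ler_sqr ?nnegrE// real_normK ?num_real//.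
apply: le_trans (entry_q _ _) _; apply: le_trans (Lq i) _.
rewrite expr_div_n -!exprM; apply: ler_pM.
- by lra.
- by rewrite invr_ge0 exprn_ge0// ltW.
- by rewrite expr2 ler_peMl//; lra.
- rewrite lef_pV2 ?posrE ?exprn_gt0//; apply: ler_wiXn2l => //; first exact: ltW.
  by rewrite mulnC leq_mul2r leq_pred.
Qed.

(** Transference: if no dual vector were shorter than k, the dual lattice would have a reduced basis
    c of norm at most C / k^n. The integer vector c^T u would then have norm below 1, hence vanish,
    although u is nonzero. *)
Lemma short_dual_vector (n : nat) : exists2 C : R, 1 <= C &
  forall (g : 'M[R]_n) (k : R), \det g = 1 -> 0 < k -> k <= 1 ->
  (exists2 u : 'cV[int]_n, u != 0 & `|g *m map_mx intr u| < k ^+ n / C) ->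
  exists2 w : 'rV[int]_n, w != 0 & `|map_mx intr w *m invmx g| < k.
Proof.
have [C C1 HC] := lattice_reduction n.
exists (n.+1%:R * C) => [|g k dg k0 k1 [u u0 gu]].
  by rewrite -[leLHS]mulr1 ler_pM// ler1n.
have ug : g \in unitmx by rewrite unitmxE dg unitr1.
apply: contrapT => /forall2NP H.
have [|v v0|c dc cb] := HC (invmx g)^T k _ k0 k1.
- by rewrite det_tr det_inv dg invr1.
- rewrite -[X in _ *m X]trmxK -trmx_mul norm_trmx map_trmx.
  have [/negP|/negP] := H v^T; last by rewrite -leNgt.
  by rewrite negbK => /eqP v0'; rewrite -[v]trmxK v0' trmx0 eqxx in v0.
have uc : c \in unitmx by rewrite unitmxE dc unitr1.
have B1 : `|(map_mx intr c)^T *m invmx g| <= C / k ^+ n by rewrite -norm_trmx trmx_mul trmxK.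
have : 1 <= `|map_mx intr (c^T *m u) : 'cV[R]_n|.
  apply: norm_int_mx_ge1; apply: contra u0 => /eqP cu0.
  by rewrite -(mulKmx (_ : c^T \in unitmx) u) ?unitmx_tr// cu0 mulmx0.
rewrite map_mxM -map_trmx -[map_mx intr u](mulKmx ug) (mulmxA _ (invmx g)).
move=> /le_trans/(_ (norm_mulmx _ _)); apply/negP; rewrite -ltNge.
have [n0|n0] := posnP n.
  by rewrite (_ : n%:R = 0 :> R) ?mul0r// n0.

have kn : 0 < k ^+ n by rewrite exprn_gt0.
set x := `|_ *m invmx g| in B1 *; set y := `|_| in gu *.
apply: (@le_lt_trans _ _ (n%:R * (C / k ^+ n * (k ^+ n / (n.+1%:R * C))))).
  by rewrite ler_wpM2l// ler_pM ?normr_ge0// ltW.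
have -> : n%:R * (C / k ^+ n * (k ^+ n / (n.+1%:R * C))) = n%:R / n.+1%:R.
  have C0 : C != 0 by apply/eqP; lra.
  have n10 : n.+1%:R != 0 :> R by rewrite pnatr_eq0.
  by rewrite -natr1 in n10 *; field; rewrite n10 C0 lt0r_neq0.
by rewrite ltr_pdivrMr ?ltr0Sn// mul1r ltr_nat.
Qed.

(** The wedge product of [w1] and [w2], written as an antisymmetric matrix so that a change of basis
    acts by congruence. *)
Definition minors (n : nat) (A : pzRingType) (w1 w2 : 'rV[A]_n) : 'M[A]_n :=
  w1^T *m w2 - w2^T *m w1.

Lemma minors_mulmx (n : nat) (A : comPzRingType) (w1 w2 : 'rV[A]_n) (g : 'M[A]_n) :
  minors (w1 *m g) (w2 *m g) = g^T *m minors w1 w2 *m g.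
Proof. by rewrite /minors !trmx_mul mulmxBr mulmxBl !mulmxA. Qed.

(** In a reduced basis of the lattice the minors are integers, bounded by a multiple of the square
    of the basis norm times the given minors, hence of absolute value below 1. *)
Lemma small_minors (n : nat) : exists2 C : R, 1 <= C &
  forall (g : 'M[R]_n) (e : R), \det g = 1 -> 0 < e -> e <= 1 ->
  (forall u : 'cV[int]_n, u != 0 -> e <= `|g *m map_mx intr u|) ->
  forall w1 w2 : 'rV[int]_n,
  `|minors (map_mx intr w1 *m invmx g) (map_mx intr w2 *m invmx g)| < e ^+ (2 * n) / C ->
  minors w1 w2 = 0.
Proof.
have [C C1 HC] := lattice_reduction n.
exists (n.+1%:R ^+ 2 * C ^+ 2) => [|g e dg e0 e1 He w1 w2 hm].
  by rewrite -exprMn exprn_ege1// -[leLHS]mulr1 ler_pM// ler1n.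
have [c dc cb] := HC g e dg e0 e1 He.
have ug : g \in unitmx by rewrite unitmxE dg unitr1.
have uc : c \in unitmx by rewrite unitmxE dc unitr1.
pose W := minors (map_mx intr w1 *m invmx g) (map_mx intr w2 *m invmx g).
have mE : map_mx intr (minors (w1 *m c) (w2 *m c)) =
    (g *m map_mx intr c)^T *m W *m (g *m map_mx intr c).
  rewrite -minors_mulmx !mulmxA !mulmxKV// /minors.
  by rewrite map_mxB !map_mxM -!map_trmx !map_mxM.
suff m0 : minors (w1 *m c) (w2 *m c) = 0.
  rewrite -[w1](mulmxK uc) -[w2](mulmxK uc) minors_mulmx m0.
  by rewrite mulmx0 mul0mx.
apply/eqP/negP => /negP/(norm_int_mx_ge1 R); apply/negP; rewrite -ltNge mE.
set G := g *m _ in cb *.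
apply: le_lt_trans (norm_mulmx _ _) _.
have [n0|n0] := posnP n.
  by rewrite (_ : n%:R = 0 :> R) ?mul0r// n0.

have en : 0 < e ^+ n by rewrite exprn_gt0.
have C0 : 0 < C by lra.
have hT := norm_mulmx G^T W; rewrite norm_trmx in hT.
have n1 : 0 < n%:R :> R by rewrite ltr0n.
have nS : n%:R < n.+1%:R :> R by rewrite ltr_nat.
have WX : `|W| < (e ^+ n) ^+ 2 / (n.+1%:R ^+ 2 * C ^+ 2) by rewrite -exprM mulnC.
apply: (@le_lt_trans _ _ (n%:R * ((n%:R * (C / e ^+ n * `|W|)) * (C / e ^+ n)))).
  rewrite ler_wpM2l// ler_pM//; apply: le_trans hT _.
  by rewrite ler_wpM2l// ler_wpM2r.
have -> : n%:R * ((n%:R * (C / e ^+ n * `|W|)) * (C / e ^+ n)) =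
   `|W| / ((e ^+ n) ^+ 2 / (n%:R ^+ 2 * C ^+ 2)).
  by field; rewrite !lt0r_neq0.
rewrite ltr_pdivrMr; last by rewrite divr_gt0 ?mulr_gt0 ?exprn_gt0.
rewrite mul1r; apply: lt_le_trans WX _.
rewrite ler_wpM2l ?sqr_ge0// lef_pV2 ?posrE ?mulr_gt0 ?exprn_gt0 ?ltr0Sn//.
by rewrite ler_wpM2r ?sqr_ge0// lerXn2r ?nnegrE// ltW.
Qed.

End LatticeReduction.

(** * Mahler's criterion *)

Section MatrixTopology.
Variable R : realType.

Lemma lipschitz_continuous (V W : normedModType R) (f : V -> W) (C : R) :
  (forall x y, `|f x - f y| <= C * `|x - y|) -> continuous f.
Proof.
move=> fC x; apply/cvgrPdist_lt => e e0; near=> y.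
apply: le_lt_trans (fC x y) _.
apply: (@le_lt_trans _ _ ((`|C| + 1) * `|x - y|)).
  by rewrite ler_wpM2r// (le_trans (ler_norm _))// lerDl.
rewrite -ltr_pdivlMl ?ltr_pwDr// mulrC.
by near: y; apply/nbhs_normP; exists (e / (`|C| + 1)) => //=; rewrite divr_gt0// ltr_pwDr.
Unshelve. all: by end_near. Qed.

Lemma mulmxr_continuous (m n p : nat) (B : 'M[R]_(n, p)) :
  continuous (fun A : 'M[R]_(m, n) => A *m B).
Proof.
apply: (@lipschitz_continuous _ _ _ (n%:R * `|B|)) => x y.
by rewrite -mulmxBl -mulrA (mulrC `|B|) norm_mulmx.
Qed.

Lemma det_continuous (n : nat) : continuous (fun A : 'M[R]_n => \det A).
Proof.
move=> A; rewrite /determinant.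
have FA : Filter (nbhs A) by exact: nbhs_filter.
apply: (@cvg_big R _ +%R 0 xpredT _ _ (nbhs A)) => [|s _]; first exact: add_continuous.
apply: cvgM; first exact: cvg_cst.
apply: (@cvg_big R _ *%R 1 xpredT _ _ (nbhs A)) => [|i _]; first exact: mul_continuous.
exact: coord_continuous.
Qed.

Lemma ball_mx_compact (m n : nat) (C : R) : compact [set A : 'M[R]_(m, n) | `|A| <= C].
Proof.
have normvec (x : 'rV[R]_(m * n)) : `|vec_mx x : 'M[R]_(m, n)| = `|x|.
  apply/eqP; rewrite eq_le; apply/andP; split; apply: norm_mx_le => // i j.
    by rewrite mxE ler_entry_norm.
  rewrite (ord1 i); case/mxvec_indexP: j => k l.
  by rewrite -{1}[x]vec_mxK mxvecE ler_entry_norm.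
have -> : [set A : 'M[R]_(m, n) | `|A| <= C] =
    [set vec_mx x | x in [set x : 'rV[R]_(m * n) | `|x| <= C]].
  rewrite eqEsubset; split => [A /= AC|_ [x /= xC <-]]; last by rewrite normvec.
  by exists (mxvec A); rewrite ?mxvecK// -normvec mxvecK.
apply: continuous_compact.
  apply: continuous_subspaceT; apply: (@lipschitz_continuous _ _ _ 1) => x y.
  by rewrite -linearB normvec mul1r.
apply: bounded_closed_compact.
  by exists C; split; [exact: num_real|move=> M CM x /= xC; exact: le_trans xC (ltW CM)].
rewrite (_ : [set x | _] = (fun x : 'rV[R]_(m * n) => `|x|) @^-1` [set y | y <= C])//.
by apply: closed_comp => [x _|]; [exact: norm_continuous|exact: closed_le].
Qed.

End MatrixTopology.

Section Mahler.
Variables (R : realType) (n : nat).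
Local Open Scope quotient_scope.

Lemma SLmx_continuous : continuous (@SLmx R n).
Proof. exact: (@initial_continuous _ _ (@SLmx R n)). Qed.

(** A filter on the group, pushed to matrices, clusters at some p. If det p were not 1, the open set
    det != 1 would be a neighbourhood of p missing the whole image of the group. *)
Lemma SL_ball_compact (C : R) : compact [set A : SL R n | `|SLmx A| <= C].
Proof.
move=> F PF FK.
pose G := (@SLmx R n) @ F.
have PG : ProperFilter G by exact: fmap_proper_filter.
have [|p [pC pG]] := @ball_mx_compact R n n C G PG; first exact: FK.
have dp : \det p = 1.
  apply: contrapT => /eqP dp.
  have np : nbhs p [set A : 'M[R]_n | \det A != 1].
    apply: (@det_continuous R n p [set x | x != 1]).
    by apply: open_nbhs_nbhs; split => //; exact: open_neq.
  have GS : F (@SLmx R n @^-1` range (@SLmx R n)) by apply: filterS filterT => g _; exists g.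
  have [_ [[g _ <-] /=]] := pG _ _ GS np.
  by rewrite SL_det eqxx.
exists (Sub p (introT eqP dp) : SL R n); split; first by rewrite /= /SLmx SubK.
move=> A B FA; rewrite nbhsE => -[U [[V oV VU] Up] UB].
have GA : F (@SLmx R n @^-1` [set SLmx g | g in A]) by apply: filterS FA => g Ag; exists g.
have [|_ [[g Ag <-] Vg]] := pG _ V GA.
  by apply: open_nbhs_nbhs; split=> //; move: Up; rewrite -VU.
by exists g; split=> //; apply: UB; rewrite -VU.
Qed.

(** All representatives are quantified over, so that no basis is singled out and the complement
    pulls back to a union of open conditions on matrices. *)
Definition lattice_min_ge (e : R) : set (lattices R n) :=
  [set x | forall g : SL R n, x = \pi g ->
     forall u : 'cV[int]_n, u != 0 -> e <= `|SLmx g *m map_mx intr u|].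

Lemma lattice_min_ge_closed (e : R) : closed (lattice_min_ge e).
Proof.
rewrite -[lattice_min_ge e]setCK closedC; rewrite /open /= /quotient_open.
rewrite (_ : _ @^-1` _ = \bigcup_(u in [set u : 'cV[int]_n | u != 0])
    ((fun g : SL R n => `|SLmx g *m map_mx intr u|) @^-1` [set x | x < e])).
  apply: bigcup_open => u _; apply: open_comp => [g _|]; last exact: open_lt.
  apply: (cvg_comp (@SLmx R n) (fun A : 'M[R]_n => `|A *m map_mx intr u|)).
    exact: SLmx_continuous.
  apply: (cvg_comp (fun A : 'M[R]_n => A *m map_mx intr u) (fun x : 'cV[R]_n => `|x|)).
    exact: mulmxr_continuous.
  exact: norm_continuous.
rewrite eqEsubset; split => g /=.
  move=> ng; apply: contrapT => H; apply: ng => g' /eqmodP /asboolP [c [dc cE]] u u0.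
  rewrite leNgt; apply/negP => gu; apply: H.
  exists (c *m u) => /=.
    apply: contra u0 => /eqP cu0; have uc : c \in unitmx by rewrite unitmxE dc unitr1.
    by rewrite -[u](mulKmx uc) cu0 mulmx0.
  rewrite map_mxM mulmxA -cE SLmxM SLmxV mulmxA mulmxV ?mul1mx//; exact: SL_unit.
by move=> [u /= u0 gu] H; have := H g erefl u u0; rewrite leNgt gu.
Qed.

(** The half of Mahler's criterion that the theorem calls for: the closure of X keeps the lower
    bound, and reduction puts every lattice with this bound in the image of a compact ball of the
    group. *)
Lemma bounded_lattices_min_ge (e : R) (X : set (lattices R n)) :
  0 < e -> X `<=` lattice_min_ge e -> bounded_lattices X.
Proof.
move=> e0 XY; have [C C1 HC] := lattice_reduction R n.
pose e' := Num.min e 1.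
have e'0 : 0 < e' by rewrite lt_min e0 ltr01.
have e'1 : e' <= 1 by rewrite ge_min lexx orbT.
pose K := [set A : SL R n | `|SLmx A| <= C / e' ^+ n].
apply: (subclosed_compact (@closed_closure _ X)
  (@continuous_compact _ _ (\pi_(lattices R n)) K _ (@SL_ball_compact _))).
  by apply: continuous_subspaceT; exact: pi_continuous.
have clX : closure X `<=` lattice_min_ge e.
  have E := (closure_id _).1 (@lattice_min_ge_closed e).
  by rewrite [X in _ `<=` X]E; exact: closure_subset.
move=> x /clX Yx; have xE : x = \pi_(lattices R n) (repr x) by rewrite reprK.
have [|c dc cb] := HC (SLmx (repr x)) e' (SL_det _) e'0 e'1.
  by move=> u u0; apply: le_trans (Yx _ xE u u0); rewrite ge_min lexx.
have cdet : \det (map_mx intr c : 'M[R]_n) == 1 by rewrite det_map_mx dc rmorph1.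
pose g : SL R n := Sub (map_mx intr c) cdet.
exists (repr x * g)%g => //.
rewrite [RHS]xE; apply/eqmodP/asboolP; rewrite invgM -mulgA mulVg mulg1.
by apply: SLZV; exists c; split=> //; rewrite /SLmx SubK.
Qed.

End Mahler.

(** * Spectral decomposition *)

Section ProdXsubC.
Variable F : idomainType.

Lemma perm_eq_prod_XsubC (s t : seq F) :
  \prod_(x <- s) ('X - x%:P) = \prod_(x <- t) ('X - x%:P) -> perm_eq s t.
Proof.
elim: s t => [|x s IH] t.
  rewrite big_nil => /(congr1 (fun p : {poly F} => size p)).
  by rewrite size_poly1 size_prod_XsubC; case: t.
rewrite big_cons => E.
have xt : x \in t by rewrite -root_prod_XsubC -E rootM root_XsubC eqxx.
have pt := perm_to_rem xt.
rewrite (perm_big _ pt) big_cons /= in E.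
have {}E := mulfI (negbT (polyXsubC_eq0 x)) E.
by rewrite perm_sym (perm_trans pt)// perm_cons perm_sym IH.
Qed.

Lemma char_poly_conj (n : nat) (P A : 'M[F]_n) :
  P \in unitmx -> char_poly (P *m A *m invmx P) = char_poly A.
Proof.
move=> uP; rewrite /char_poly /char_poly_mx.
have PV : map_mx polyC P *m map_mx polyC (invmx P) = 1%:M.
  by rewrite -map_mxM mulmxV// map_mx1.
have -> : 'X%:M - map_mx polyC (P *m A *m invmx P) =
    map_mx polyC P *m ('X%:M - map_mx polyC A) *m map_mx polyC (invmx P).
  rewrite mulmxBr mulmxBl mul_mx_scalar -scalemxAl PV scalemx1.
  by rewrite !map_mxM.
rewrite !det_mulmx mulrAC -det_mulmx.
by rewrite PV det1 mul1r.
Qed.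

End ProdXsubC.

Section ComplexMatrices.
Variable R : realType.
Local Notation C := (R[i]).
Local Notation normc := (Normc.normc).
Local Notation toC := (map_mx (real_complex R)).
Local Notation conjmat := (map_mx (@conjc R)).

Lemma normc_ge0 (z : C) : 0 <= normc z.
Proof. by case: z => x y; exact: sqrtr_ge0. Qed.

Lemma normcX (z : C) k : normc (z ^+ k) = normc z ^+ k.
Proof. by elim: k => [|k IH]; rewrite ?expr0 ?Normc.normc1// !exprS Normc.normcM IH. Qed.

Lemma normc_conj (z : C) : normc (conjc z) = normc z.
Proof. by case: z => x y /=; rewrite sqrrN. Qed.

Lemma normc_real (x : R) : normc (real_complex R x) = `|x|.
Proof. by rewrite /= expr0n/= addr0 sqrtr_sqr. Qed.

Lemma normc_prod (I : finType) (F : I -> C) : normc (\prod_i F i) = \prod_i normc (F i).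
Proof. by elim/big_ind2 : _ => // [|x y z t <- <-]; rewrite ?Normc.normc1 ?Normc.normcM. Qed.

Lemma normc_sum_le (I : finType) (F : I -> C) : normc (\sum_i F i) <= \sum_i normc (F i).
Proof.
elim/big_ind2 : _ => // [|x y z t xy zt]; first by rewrite Normc.normc0.
by apply: (@le_trans _ _ (normc y + normc t)); [exact: (@le_normcD R y t)|exact: lerD].
Qed.

Lemma real_mx_conj (m n : nat) (A : 'M[C]_(m, n)) :
  conjmat A = A -> exists B : 'M[R]_(m, n), toC B = A.
Proof.
move=> cA; exists (map_mx (@complex.Re R) A); apply/matrixP => i j; rewrite !mxE.
have := congr1 (fun M : 'M[C]_(m, n) => M i j) cA; rewrite mxE.
by case: (A i j) => x y /= [] /eqP; rewrite eq_sym -subr_eq0 opprK -mulr2n mulrn_eq0 /= => /eqP ->.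
Qed.

Lemma conj_toC (m n : nat) (A : 'M[R]_(m, n)) : conjmat (toC A) = toC A.
Proof. by apply/matrixP => i j; rewrite !mxE /= oppr0. Qed.

Lemma toC_inj (m n : nat) : injective (@map_mx _ _ (real_complex R) m n).
Proof.
move=> A B AB; apply/matrixP => i j.
by have := congr1 (fun M : 'M[C]_(m, n) => M i j) AB; rewrite !mxE => -[].
Qed.

Section Diagonalized.
Variables (n : nat) (A : 'M[R]_n) (P : 'M[C]_n) (d : 'rV[C]_n).
Hypotheses (uP : P \in unitmx) (PA : P *m toC A = diag_mx d *m P).

(** The characteristic polynomial is real, so conjugation permutes its roots. *)
Lemma conj_eigenvalue (i : 'I_n) : exists j, d 0 j = conjc (d 0 i).
Proof.
have AE : toC A = invmx P *m diag_mx d *m P by rewrite -mulmxA -PA mulmxA mulVmx// mul1mx.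
have cpA : char_poly (toC A) = \prod_j ('X - (d 0 j)%:P).
  have {1}-> : toC A = invmx P *m diag_mx d *m invmx (invmx P) by rewrite invmxK.
  rewrite char_poly_conj ?unitmx_inv// char_poly_trig ?diag_mx_is_trig//.
  by apply: eq_bigr => j _; rewrite mxE eqxx mulr1n.
have : root (char_poly (toC A)) (conjc (d 0 i)).
  have cr : map_poly (@conjc R) (char_poly (toC A)) = char_poly (toC A).
    by rewrite map_char_poly conj_toC.
  rewrite -cr complex_root_conj conjcK cpA.
  by rewrite (bigD1 i)//= rootM root_XsubC eqxx.
rewrite cpA -(big_map (fun j => d 0 j) xpredT (fun x => 'X - x%:P)) root_prod_XsubC.
by move=> /mapP[j _ ->]; exists j.
Qed.

Lemma diag_row (i : 'I_n) : row i P *m toC A = d 0 i *: row i P.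
Proof. by rewrite -row_mul PA row_mul row_diag_mx -scalemxAl -rowE. Qed.

Lemma diag_col (i : 'I_n) : toC A *m col i (invmx P) = d 0 i *: col i (invmx P).
Proof.
have AP : toC A *m invmx P = invmx P *m diag_mx d.
  have AE : toC A = invmx P *m (diag_mx d *m P) by rewrite -PA mulmxA mulVmx// mul1mx.
  by rewrite AE -!mulmxA (mulmxV uP) mulmx1.
rewrite [in LHS]colE mulmxA AP -colE mul_mx_diag; apply/matrixP => k l.
by rewrite !mxE mulrC.
Qed.

(** The eigenspace of a simple real eigenvalue is a complex line stable under conjugation. Dividing
    [row i P] by a nonzero entry x makes it real; the dual column multiplied by x is then real as
    well, because its pairing with this real row is 1. *)
Lemma simple_real_eigenvectors (i : 'I_n) :
  conjc (d 0 i) = d 0 i -> (forall j, d 0 j = d 0 i -> j = i) ->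
  exists (e : 'cV[R]_n) (f : 'rV[R]_n) (x : C), [/\ x != 0,
    toC e = x *: col i (invmx P) & toC f = x^-1 *: row i P].
Proof.
move=> di simple.
have eigl (q : 'rV[C]_n) : q *m toC A = d 0 i *: q -> exists y, q = y *: row i P.
  move=> qA; exists ((q *m invmx P) 0 i).
  have qP : q *m invmx P *m diag_mx d = d 0 i *: (q *m invmx P).
    have DE : diag_mx d = P *m toC A *m invmx P by rewrite PA mulmxK.
    by rewrite DE !mulmxA mulmxKV// qA -scalemxAl.
  rewrite -[LHS](mulmxKV uP) [in LHS](row_sum_delta (q *m invmx P)).
  rewrite mulmx_suml (bigD1 i)//= big1 ?addr0.
    by rewrite -scalemxAl -rowE.
  move=> j ji; suff -> : (q *m invmx P) 0 j = 0 by rewrite scale0r mul0mx.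
  have := congr1 (fun M : 'rV[C]_n => M 0 j) qP; rewrite mul_mx_diag !mxE.
  set s := (\sum_k _) => /eqP; rewrite mulrC -subr_eq0 -mulrBl mulf_eq0 subr_eq0.
  by case/orP => [/eqP /simple E|/eqP //]; rewrite E eqxx in ji.
have eigr (q : 'cV[C]_n) : toC A *m q = d 0 i *: q -> exists y, q = y *: col i (invmx P).
  move=> qA; exists ((P *m q) i 0).
  have qP : diag_mx d *m (P *m q) = d 0 i *: (P *m q).
    by rewrite mulmxA -PA -mulmxA qA scalemxAr.
  have Dq j : j != i -> (P *m q) j 0 = 0.
    move=> ji; have := congr1 (fun M : 'cV[C]_n => M j 0) qP; rewrite mul_diag_mx !mxE.
    set s := (\sum_k _) => /eqP; rewrite -subr_eq0 -mulrBl mulf_eq0 subr_eq0.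
    by case/orP => [/eqP /simple E|/eqP //]; rewrite E eqxx in ji.
  rewrite -[LHS](mulKmx uP); apply/matrixP => k l; rewrite (ord1 l) [LHS]mxE.
  rewrite (bigD1 i)//= big1 ?addr0; first by rewrite !mxE mulrC.
  by move=> j ji; rewrite Dq// mulr0.
have rP : row i P *m col i (invmx P) = 1%:M.
  rewrite colE mulmxA -row_mul mulmxV// row1 mul_delta_mx.
  by apply/matrixP => k l; rewrite !ord1 !mxE eqxx.
have [j0 xj0] : exists j, P i j != 0.
  apply: contrapT => H; have p0 : row i P = 0.
    apply/rowP => j; rewrite !mxE; apply/eqP/negPn/negP => Pij; by apply: H; exists j.
  by have := congr1 (fun M : 'M[C]_1 => M 0 0) rP; rewrite p0 mul0mx !mxE eqxx => /eqP; rewrite eq_sym oner_eq0.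
pose x := P i j0.
have [y py] : exists y, conjmat (row i P) = y *: row i P.
  by apply: eigl; rewrite -{1}(conj_toC A) -map_mxM diag_row map_mxZ /= di.
have cx : conjc x = y * x.
  by have := congr1 (fun M : 'rV[C]_n => M 0 j0) py; rewrite !mxE.
have y0 : y != 0.
  by apply: contra xj0 => /eqP y0; rewrite -conjc_eq0 -/x cx y0 mul0r.
have [f fE] : exists f : 'rV[R]_n, toC f = x^-1 *: row i P.
  apply: real_mx_conj; rewrite map_mxZ /= conjc_inv cx py scalerA; congr (_ *: _).
  by rewrite invfM mulrAC mulVf// mul1r.
have [z qz] : exists z, conjmat (x *: col i (invmx P)) = z *: col i (invmx P).
  apply: eigr; rewrite -{1}(conj_toC A) -map_mxM -scalemxAr diag_col scalerA mulrC -scalerA.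
  by rewrite [in LHS]map_mxZ /= di.
have zx : z = x.
  have : conjmat (toC f *m (x *: col i (invmx P))) = 1%:M.
    rewrite fE -scalemxAl -scalemxAr rP scalerA mulVf// scale1r.
    by rewrite map_mx1.
  rewrite map_mxM conj_toC qz fE -scalemxAl -scalemxAr rP scalerA.
  move=> /(congr1 (fun M : 'M[C]_1 => M 0 0)); rewrite !mxE eqxx /= mulr1 => h; have {}h : x^-1 * z = 1 by [].
  by rewrite -[RHS]mulr1 -h mulrA divff// mul1r.
have [e eE] : exists e : 'cV[R]_n, toC e = x *: col i (invmx P).
  by apply: real_mx_conj; rewrite qz zx.
by exists e, f, x.
Qed.

(** Each entry of [T k *m E] is a combination, with coefficients depending only on P, of the k-th
    powers of the eigenvalues indexed by S. Diagonalizability is what excludes polynomial factors in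
    k. *)
Lemma diag_spectral_bound (T : nat -> 'M[R]_n) (S : {set 'I_n}) (E : 'M[R]_n) :
  (forall k, P *m toC (T k) = diag_mx (\row_j d 0 j ^+ k) *m P) ->
  toC E = invmx P *m diag_mx (\row_j (j \in S)%:R) *m P ->
  exists2 K : R, 1 <= K & forall a : R, 0 <= a -> (forall j, j \in S -> normc (d 0 j) = a) ->
    forall k, `|T k *m E| <= K * a ^+ k.
Proof.
move=> PT EE.
pose c i l := \sum_(j < n) normc (invmx P i j) * normc (P j l).
have c_ge0 i l : 0 <= c i l by apply: sumr_ge0 => j _; rewrite mulr_ge0 ?normc_ge0.
pose K := 1 + \sum_(p : 'I_n * 'I_n) c p.1 p.2.
have K0 : 0 <= \sum_(p : 'I_n * 'I_n) c p.1 p.2 by apply: sumr_ge0 => p _.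
have cK i l : c i l <= K.
  have -> : K = 1 + (c i l + \sum_(p | p != (i, l)) c p.1 p.2) by rewrite /K (bigD1 (i, l)).
  by rewrite addrCA lerDl addr_ge0//; apply: sumr_ge0 => p _.
exists K; first by rewrite lerDl.
move=> a a0 da k; apply: norm_mx_le; first by rewrite mulr_ge0 ?addr_ge0 ?exprn_ge0.
move=> i l; rewrite -normc_real.
have -> : real_complex R ((T k *m E) i l) = toC (T k *m E) i l by rewrite [RHS]mxE.
have -> : toC (T k *m E) = invmx P *m (diag_mx (\row_j (d 0 j ^+ k * (j \in S)%:R)) *m P).
  have TkE : toC (T k) = invmx P *m (diag_mx (\row_j d 0 j ^+ k) *m P).
    by rewrite -PT mulmxA mulVmx// mul1mx.
  rewrite map_mxM EE TkE -!mulmxA (mulmxA P (invmx P)) (mulmxV uP) mul1mx.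
  rewrite (mulmxA (diag_mx _) (diag_mx _) P) mulmx_diag; congr (_ *m (diag_mx _ *m _)).
  by apply/rowP => j; rewrite !mxE.
rewrite mul_diag_mx mxE; apply: le_trans (normc_sum_le _) _.
apply: (@le_trans _ _ (a ^+ k * \sum_(j < n) normc (invmx P i j) * normc (P j l))).
  rewrite mulr_sumr; apply: ler_sum => j _; rewrite !mxE 2!Normc.normcM mulrCA.
  apply: ler_wpM2r; first by rewrite mulr_ge0 ?normc_ge0.
  rewrite Normc.normcM normcX; have [jS|jS] := boolP (j \in S).
    by rewrite (da _ jS) Normc.normc1 mulr1.
  by rewrite Normc.normc0 mulr0 exprn_ge0.
by rewrite mulrC ler_wpM2r ?exprn_ge0//; exact: cK.
Qed.

End Diagonalized.
End ComplexMatrices.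

(** * One contracted line, at most one intermediate line, and the space of maximal expansion *)

Section Splitting.
Variables (R : realType) (n : nat).
Local Notation C := (R[i]).
Local Notation normc := (Normc.normc).
Local Notation toC := (map_mx (real_complex R)).

(* [T k] is the [k]-th power of a matrix and [U k] its inverse; [e3] spans the contracted line,
   [e2] the line of the possible intermediate eigenvalue ([e2 = 0] and [f2 = 0] when there is none),
   and [spl_E] projects onto the sum of the eigenspaces of maximal modulus [a]. *)
Definition spl_E (e2 e3 : 'cV[R]_n) (f2 f3 : 'rV[R]_n) : 'M[R]_n :=
  1%:M - e2 *m f2 - e3 *m f3.

(** The relations [spl_e2f2e2] and [spl_f2e2f2] hold both when [f2 *m e2] is 1 and when [e2] and
    [f2] vanish, which treats the two cases at once. The bound [spl_abc] makes minors of dual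
    vectors small; [spl_ca] lets powers of ac be compared with powers of a. *)
Record splitting (T U : nat -> 'M[R]_n) (e2 e3 : 'cV[R]_n) (f2 f3 : 'rV[R]_n)
    (l2 l3 a b c K : R) : Prop := Splitting {
  spl_TU : forall k, T k *m U k = 1%:M;
  spl_f3e3 : f3 *m e3 = 1%:M;
  spl_f3e2 : f3 *m e2 = 0;
  spl_f2e3 : f2 *m e3 = 0;
  spl_e2f2e2 : e2 *m (f2 *m e2) = e2;
  spl_f2e2f2 : (f2 *m e2) *m f2 = f2;
  spl_Te3 : forall k, T k *m e3 = l3 ^+ k *: e3;
  spl_f3T : forall k, f3 *m T k = l3 ^+ k *: f3;
  spl_Te2 : forall k, T k *m e2 = l2 ^+ k *: e2;
  spl_f2T : forall k, f2 *m T k = l2 ^+ k *: f2;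
  spl_l3 : `|l3| = c^-1;
  spl_l2 : `|l2| = b;
  spl_b : 1 <= b;
  spl_ba : b < a;
  spl_abc : a * b <= c;
  spl_ca : c <= a ^+ n;
  spl_K : 1 <= K;
  spl_TE : forall k, `|T k *m spl_E e2 e3 f2 f3| <= K * a ^+ k;
  spl_UE : forall k, `|U k *m spl_E e2 e3 f2 f3| <= K / a ^+ k }.

Lemma card_image_perm (I : finType) (l d : I -> C) (p : pred C) :
  perm_eq [seq l i | i <- index_enum I] [seq d i | i <- index_enum I] ->
  #|[set i | p (l i)]%SET| = #|[set i | p (d i)]%SET|.
Proof.
move=> pe; rewrite -!sum1_card.
under eq_bigl do rewrite inE; under [RHS]eq_bigl do rewrite inE.
by rewrite -(big_map l p (fun=> 1%N)) (perm_big _ pe) big_map.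
Qed.

Lemma max_modulus_attained (l : 'I_n -> C) :
  0 < max_modulus l -> exists i, max_modulus l = normc (l i).
Proof.
suff [->|//] : max_modulus l = 0 \/ exists i, max_modulus l = normc (l i) by rewrite ltxx.
rewrite /max_modulus; elim/big_ind : _ => [|x y hx hy|i _]; [by left| |by right; exists i].
by rewrite /Num.max; case: ifP.
Qed.

Lemma le_max_modulus (l : 'I_n -> C) i : normc (l i) <= max_modulus l.
Proof. exact: le_bigmax. Qed.

Variables (T U : nat -> 'M[R]_n) (P : 'M[C]_n) (d : 'rV[C]_n).
Hypotheses (T0 : T 0 = 1%:M) (TS : forall k, T k.+1 = T k *m T 1).
Hypothesis (TU : forall k, T k *m U k = 1%:M).
Hypotheses (uP : P \in unitmx) (PT1 : P *m toC (T 1) = diag_mx d *m P).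

Lemma diag_pow k : P *m toC (T k) = diag_mx (\row_j d 0 j ^+ k) *m P.
Proof.
elim: k => [|k IH].
  rewrite T0 map_mx1 mulmx1 (_ : (\row_j _) = const_mx 1) ?diag_const_mx ?mul1mx//.
  by apply/rowP => j; rewrite !mxE expr0.
rewrite TS map_mxM mulmxA IH -mulmxA PT1 mulmxA mulmx_diag; congr (diag_mx _ *m _).
by apply/rowP => j; rewrite !mxE exprSr.
Qed.

Lemma diag_pow_inv k : (forall j, d 0 j != 0) ->
  P *m toC (U k) = diag_mx (\row_j (map_mx (@GRing.inv C) d) 0 j ^+ k) *m P.
Proof.
move=> d0; set Di := diag_mx _; set D := diag_mx (\row_j d 0 j ^+ k).
have DiD : Di *m D = 1%:M.
  rewrite mulmx_diag (_ : (\row_j _) = const_mx 1) ?diag_const_mx//.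
  by apply/rowP => j; rewrite !mxE -exprMn mulVf ?expr1n.
have TUC : toC (T k) *m toC (U k) = 1%:M by rewrite -map_mxM TU map_mx1.
rewrite -[P in RHS]mulmx1 -TUC (mulmxA P) diag_pow -/D.
by rewrite !mulmxA DiD mul1mx.
Qed.

Lemma real_of_conj (z : C) : conjc z = z -> exists l : R, real_complex R l = z.
Proof.
case: z => x y /= [] /eqP; rewrite eq_sym -subr_eq0 opprK -mulr2n mulrn_eq0 /= => /eqP ->.
by exists x.
Qed.

Lemma row_col_inv (i j : 'I_n) : row i P *m col j (invmx P) = ((i == j)%:R)%:M.
Proof.
rewrite colE mulmxA -row_mul mulmxV// row1 mul_delta_mx_cond.
by apply/matrixP => k l; rewrite !ord1 !mxE; case: (i == j); rewrite ?mulr1n ?mulr0n !mxE.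
Qed.

Lemma row_col_inv0 (i j : 'I_n) : i != j -> row i P *m col j (invmx P) = 0.
Proof.
by move=> /negbTE ij; rewrite row_col_inv ij; apply/matrixP => k l; rewrite !mxE mul0rn.
Qed.

Lemma real_eigenpair (i : 'I_n) : conjc (d 0 i) = d 0 i -> (forall j, d 0 j = d 0 i -> j = i) ->
  exists (e : 'cV[R]_n) (f : 'rV[R]_n) (l : R) (x : C),
  [/\ x != 0, toC e = x *: col i (invmx P) & toC f = x^-1 *: row i P] /\
  [/\ `|l| = normc (d 0 i), f *m e = 1%:M, forall k, T k *m e = l ^+ k *: e
    & forall k, f *m T k = l ^+ k *: f].
Proof.
move=> dr ds; have [e [f [x [x0 eE fE]]]] := simple_real_eigenvectors uP PT1 dr ds.
have [l lE] := real_of_conj dr.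
exists e, f, l, x; split=> //; split.
- by rewrite -normc_real lE.
- apply: (@toC_inj R); rewrite map_mxM eE fE -scalemxAl -scalemxAr scalerA mulVf// scale1r.
  by rewrite row_col_inv eqxx map_mx1.
- move=> k; apply: (@toC_inj R); rewrite map_mxM eE -scalemxAr (diag_col uP (diag_pow k)) mxE.
  by rewrite map_mxZ /= rmorphXn /= lE eE !scalerA mulrC.
- move=> k; apply: (@toC_inj R); rewrite map_mxM fE -scalemxAl (diag_row (diag_pow k)) mxE.
  by rewrite map_mxZ /= rmorphXn /= lE fE !scalerA mulrC.
Qed.

Lemma toC_outer (i : 'I_n) (x : C) (e : 'cV[R]_n) (f : 'rV[R]_n) : x != 0 ->
  toC e = x *: col i (invmx P) -> toC f = x^-1 *: row i P ->
  toC (e *m f) = invmx P *m diag_mx (\row_j (j == i)%:R) *m P.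
Proof.
move=> x0 eE fE; rewrite map_mxM eE fE -scalemxAl -scalemxAr scalerA divff// scale1r.
have dd : (delta_mx i 0 : 'cV[C]_n) *m (delta_mx 0 i *m P) = delta_mx i i *m P.
  by rewrite mulmxA mul_delta_mx.
rewrite colE rowE -[LHS]mulmxA dd -[RHS]mulmxA; congr (_ *m (_ *m _)); apply/matrixP => j k; rewrite !mxE.
case: (eqVneq j k) => [<-|jk]; first by rewrite andbb mulr1n.
rewrite mulr0n; case: (eqVneq j i) jk => [->|]//=.
by rewrite eq_sym => /negbTE ->.
Qed.

(** The conjugate eigenvalue has the same modulus, hence the same index. *)
Lemma conj_eq_unique (i : 'I_n) :
  (forall j, normc (d 0 j) = normc (d 0 i) -> j = i) ->
  conjc (d 0 i) = d 0 i /\ (forall j, d 0 j = d 0 i -> j = i).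
Proof.
move=> H; split; last by move=> j E; apply: H; rewrite E.
by have [j E] := conj_eigenvalue uP PT1 i; rewrite -E (H j)// E normc_conj.
Qed.

Variable l : 'I_n -> C.
Hypotheses (n2 : (2 <= n)%N) (detT : \det (T 1) = 1).
Hypothesis charT : char_poly (toC (T 1)) = \prod_(i < n) ('X - (l i)%:P).
Hypothesis card_lt1 : #|[set i : 'I_n | normc (l i) < 1]%SET| = 1%N.
Hypothesis card_max :
  (n - 2 <= #|[set i : 'I_n | normc (l i) == max_modulus l]%SET|)%N.

Lemma diag_char : char_poly (toC (T 1)) = \prod_(i < n) ('X - (d 0 i)%:P).
Proof.
have AE : toC (T 1) = invmx P *m diag_mx d *m invmx (invmx P).
  by rewrite invmxK -mulmxA -PT1 mulmxA mulVmx// mul1mx.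
rewrite AE char_poly_conj ?unitmx_inv// char_poly_trig ?diag_mx_is_trig//.
by apply: eq_bigr => j _; rewrite mxE eqxx mulr1n.
Qed.

Lemma eigenvalues_perm :
  perm_eq [seq l i | i <- index_enum 'I_n] [seq d 0 i | i <- index_enum 'I_n].
Proof. by apply: perm_eq_prod_XsubC; rewrite !big_map -charT diag_char. Qed.

Lemma prod_normc1 : \prod_i normc (d 0 i) = 1.
Proof.
have := congr1 determinant PT1; rewrite !det_mulmx det_diag det_map_mx detT rmorph1 mulr1.
have dP : \det P != 0 by move: uP; rewrite unitmxE unitfE.
move=> /esym/eqP; rewrite -subr_eq0 -{2}[\det P]mul1r -mulrBl mulf_eq0 (negbTE dP) orbF subr_eq0.
by move=> /eqP E; rewrite -normc_prod E Normc.normc1.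
Qed.

(** Otherwise all moduli are at most 1 and one is smaller, while their product is 1. *)
Lemma max_modulus_gt1 : 1 < max_modulus l.
Proof.
have := card_lt1; rewrite (card_image_perm (fun z => normc z < 1) eigenvalues_perm) => /eqP/cards1P[i si].
have i1 : normc (d 0 i) < 1 by have := set11 i; rewrite -si inE.
rewrite ltNge; apply/negP => M1.
have le1 j : normc (d 0 j) <= 1.
  have : d 0 j \in [seq l i | i <- index_enum 'I_n].
    by rewrite (perm_mem eigenvalues_perm); apply: map_f; rewrite mem_index_enum.
  by move=> /mapP[k _ ->]; apply: le_trans (le_max_modulus l k) M1.
have := prod_normc1; rewrite (bigD1 i)//= => E.
have : \prod_(j | j != i) normc (d 0 j) <= 1 by apply: prodr_ile1 => j _; rewrite normc_ge0 le1.
have := normc_ge0 (d 0 i).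
move: E i1; set x := normc _; set y := \prod_(_ | _) _ => E i1 x0 y1.
by have : x * y <= x by [rewrite ler_piMr]; rewrite E leNgt i1.
Qed.

(** Outside the contracted index and the set X of indices of maximal modulus at most one index
    remains. Since the product of the moduli is 1, either none remains and c = a^(n-1), with b = 1,
    or one remains and c = b a^(n-2), where n >= 3 because X is nonempty. Both give ab <= c <=
    a^n. *)
Lemma exists_splitting : exists e2 e3 f2 f3 l2 l3 a b c K,
  splitting T U e2 e3 f2 f3 l2 l3 a b c K.
Proof.
have M1 := max_modulus_gt1; set a := max_modulus l in M1 *.
have a0 : 0 < a by lra.
have := card_lt1; rewrite (card_image_perm (fun z => normc z < 1) eigenvalues_perm) => /eqP/cards1P[i3 si3].
have i31 : normc (d 0 i3) < 1 by have := set11 i3; rewrite -si3 inE.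
have ge1 j : j != i3 -> 1 <= normc (d 0 j).
  move=> ji; rewrite leNgt; apply: contra ji => j1.
  by have /setP/(_ j) := si3; rewrite !inE j1 => /esym.
have lea j : normc (d 0 j) <= a.
  have : d 0 j \in [seq l i | i <- index_enum 'I_n].
    by rewrite (perm_mem eigenvalues_perm); apply: map_f; rewrite mem_index_enum.
  by move=> /mapP[k _ ->]; exact: le_max_modulus.
have := card_max; rewrite (card_image_perm (fun z => normc z == max_modulus l) eigenvalues_perm) -/a.
set X := [set i | _]%SET => cX.
have inX j : (j \in X) = (normc (d 0 j) == a) by rewrite inE.
have i3X : i3 \notin X by rewrite inX lt_eqF// (lt_trans i31).
have d_neq0 j : d 0 j != 0.
  apply/eqP => dj; have := prod_normc1; rewrite (bigD1 j)//= dj Normc.normc0 mul0r.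
  by move=> /eqP; rewrite eq_sym oner_eq0.
have p3 : 0 < normc (d 0 i3).
  by rewrite lt_def normc_ge0 andbT; apply: contra (d_neq0 i3) => /eqP/Normc.eq0_normc ->.
have X0 : (0 < #|X|)%N.
  have [i iE] := max_modulus_attained (l := l) a0.
  have := @card_image_perm _ l (fun i => d 0 i) (fun z => normc z == max_modulus l) eigenvalues_perm.
  rewrite -/a -/X => <-; apply/card_gt0P; exists i; by rewrite inE -iE.
have u3 j : normc (d 0 j) = normc (d 0 i3) -> j = i3.
  by move=> E; have /setP/(_ j) := si3; rewrite !inE E i31 => /esym/eqP.
have [c3 s3] := conj_eq_unique u3.
have [e3 [f3 [l3 [x3 [[x30 e3E f3E] [l3E f3e3 Te3 f3T]]]]]] := real_eigenpair c3 s3.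
have o3 := toC_outer x30 e3E f3E.
have key (e2 : 'cV[R]_n) (f2 : 'rV[R]_n) :
    toC (spl_E e2 e3 f2 f3) = invmx P *m diag_mx (\row_j (j \in X)%:R) *m P ->
    exists2 K, 1 <= K & (forall k, `|T k *m spl_E e2 e3 f2 f3| <= K * a ^+ k) /\
      (forall k, `|U k *m spl_E e2 e3 f2 f3| <= K / a ^+ k).
  move=> EE; have [K1 K11 h1] := diag_spectral_bound uP diag_pow EE.
  have [K2 K21 h2] := diag_spectral_bound uP (fun k => diag_pow_inv k d_neq0) EE.
  have {}h1 := h1 a (ltW a0); have {}h2 := h2 a^-1 _.
  exists (K1 + K2); first by lra.
  split=> k.
    apply: le_trans (h1 _ k) _; last by rewrite ler_wpM2r ?exprn_ge0 ?ltW//; lra.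
    by move=> j; rewrite inX => /eqP.
  rewrite -exprVn; apply: le_trans (h2 _ _ k) _; last by rewrite ler_wpM2r ?exprn_ge0 ?invr_ge0 ?ltW//; lra.
    by rewrite invr_ge0 ltW.
  by move=> j; rewrite inX mxE Normc.normcV => /eqP ->.
pose Y := (~: (i3 |: X))%SET.
have cY : #|Y| = (n - (1 + #|X|))%N by rewrite cardsCs finset.setCK cardsU1 i3X card_ord.
have cXn : (1 + #|X| <= n)%N.
  by have := max_card (mem (i3 |: X)%SET); rewrite cardsU1 i3X card_ord.
have inY j : (j \in Y) = (j != i3) && (normc (d 0 j) != a).
  by rewrite !inE negb_or.
have prodX : \prod_(j in X) normc (d 0 j) = a ^+ #|X|.
  by rewrite -prodr_const; apply: eq_bigr => j; rewrite inX => /eqP.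
have prodE : normc (d 0 i3) * (\prod_(j in Y) normc (d 0 j) * a ^+ #|X|) = 1.
  rewrite -[RHS]prod_normc1 [RHS](bigD1 i3)//=; congr (_ * _).
  rewrite [RHS](bigID (mem X))/= [LHS]mulrC -prodX; congr (_ * _); apply: eq_bigl => j.
    by case: (eqVneq j i3) => [->|]//=; rewrite (negbTE i3X).
  by rewrite inY inX.
have [Y0|Y0] := posnP #|Y|.
  have c0Y : Y = finset.set0 by exact: cards0_eq.
  have XE : #|X| = n.-1 by clear -cY cX cXn Y0; lia.
  have EE : toC (spl_E 0 e3 0 f3) = invmx P *m diag_mx (\row_j (j \in X)%:R) *m P.
    rewrite /spl_E mul0mx subr0 map_mxB map_mx1 o3.
    have -> : \row_j (j \in X)%:R = const_mx 1 - \row_j (j == i3)%:R :> 'rV[C]_n.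
      apply/rowP => j; rewrite !mxE.
      have : j \notin Y by rewrite c0Y inE.
      rewrite inY negb_and !negbK -inX; case: eqVneq => [-> _|_ /= ->]; last by rewrite subr0.
      by rewrite (negbTE i3X) subrr.
    by rewrite linearB /= diag_const_mx mulmxBr mulmxBl mulmx1 mulVmx.
  have [K K1 [hT hU]] := key _ _ EE.
  move: prodE; rewrite c0Y big_set0 mul1r XE => prodE.
  exists 0, e3, 0, f3, 1, l3, a, 1, (normc (d 0 i3))^-1, K.
  have cE : (normc (d 0 i3))^-1 = a ^+ n.-1.
    by apply: (mulfI (lt0r_neq0 p3)); rewrite prodE divff// lt0r_neq0.
  split=> //; rewrite ?mul0mx ?mulmx0 ?invrK ?normr1//.
  - by move=> k; rewrite mulmx0 scaler0.
  - by move=> k; rewrite mul0mx scaler0.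
  - by rewrite mulr1 cE -[leLHS]expr1 ler_weXn2l ?(ltW M1)//; clear -n2; lia.
  - by rewrite cE ler_weXn2l ?(ltW M1)//; clear -n2; lia.
have Y1 : #|Y| = 1%N by clear -cY cX cXn Y0; lia.
have XE : #|X| = (n - 2)%N by clear -cY cX cXn Y1; lia.
have [i2 Y2] : exists i2, Y = [set i2]%SET by apply/cards1P; rewrite Y1.
have : i2 \in Y by rewrite Y2 set11.
rewrite inY => /andP[i23 i2a].
have u2 j : normc (d 0 j) = normc (d 0 i2) -> j = i2.
  move=> E; have /setP/(_ j) := Y2; rewrite inY E i2a andbT inE.
  case: (eqVneq j i3) => [ji _|_ /esym/eqP //].
  by have := ge1 _ i23; rewrite -E ji leNgt i31.
have [c2 s2] := conj_eq_unique u2.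
have [e2 [f2 [l2 [x2 [[x20 e2E f2E] [l2E f2e2 Te2 f2T]]]]]] := real_eigenpair c2 s2.
have o2 := toC_outer x20 e2E f2E.
have EE : toC (spl_E e2 e3 f2 f3) = invmx P *m diag_mx (\row_j (j \in X)%:R) *m P.
  rewrite /spl_E !map_mxB map_mx1 o3 o2.
  have -> : \row_j (j \in X)%:R = const_mx 1 - \row_j (j == i2)%:R - \row_j (j == i3)%:R :> 'rV[C]_n.
    apply/rowP => j; rewrite !mxE.
    have : (j \in Y) = (j == i2) by rewrite Y2 !inE.
    rewrite inY -inX; case: (eqVneq j i3) => [-> /= <-|_ /= <-]; first by rewrite (negbTE i3X) subr0 subrr.
    by case: (j \in X); rewrite /= ?subr0 ?subrr.
  have dB (x y : 'rV[C]_n) : diag_mx (x - y) = diag_mx x - diag_mx y by rewrite linearB.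
  by rewrite !dB diag_const_mx !mulmxBr !mulmxBl mulmx1 mulVmx.
have [K K1 [hT hU]] := key _ _ EE.
move: prodE; rewrite Y2 big_set1 XE => prodE.
have n3 : (3 <= n)%N by clear -X0 XE; lia.
have b1 := ge1 _ i23.
have ba : normc (d 0 i2) < a by rewrite lt_neqAle i2a lea.
have cE : (normc (d 0 i3))^-1 = normc (d 0 i2) * a ^+ (n - 2).
  by apply: (mulfI (lt0r_neq0 p3)); rewrite prodE divff// lt0r_neq0.
exists e2, e3, f2, f3, l2, l3, a, (normc (d 0 i2)), (normc (d 0 i3))^-1, K.
split=> //; rewrite ?f2e2 ?mulmx1 ?mul1mx ?invrK//.
- apply: (@toC_inj R); rewrite map_mxM f3E e2E -scalemxAl -scalemxAr row_col_inv0 1?eq_sym//.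
  by rewrite !scaler0 map_mx0.
- apply: (@toC_inj R); rewrite map_mxM f2E e3E -scalemxAl -scalemxAr row_col_inv0//.
  by rewrite !scaler0 map_mx0.
- by rewrite cE mulrC ler_wpM2l ?normc_ge0// -[leLHS]expr1 ler_weXn2l ?(ltW M1)//; clear -n3; lia.
- rewrite cE; apply: (@le_trans _ _ (a * a ^+ (n - 2))).
    by rewrite ler_wpM2r ?exprn_ge0 ?(ltW a0)// ltW.
  by rewrite -exprS ler_weXn2l ?(ltW M1)//; clear -n3; lia.
Qed.

End Splitting.

(** * The expanding horospherical subgroup *)

Section SplittingTheory.
Variables (R : realType) (n : nat) (T U : nat -> 'M[R]_n).
Variables (e2 e3 : 'cV[R]_n) (f2 f3 : 'rV[R]_n) (l2 l3 a b c K : R).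
Hypothesis spl : splitting T U e2 e3 f2 f3 l2 l3 a b c K.
Local Notation E := (spl_E e2 e3 f2 f3).

Lemma spl_a1 : 1 < a. Proof. exact: le_lt_trans (spl_b spl) (spl_ba spl). Qed.
Lemma spl_a0 : 0 < a. Proof. exact: lt_trans ltr01 spl_a1. Qed.
Lemma spl_b0 : 0 < b. Proof. exact: lt_le_trans ltr01 (spl_b spl). Qed.
Lemma spl_ac : a <= c.
Proof. by apply: le_trans (spl_abc spl); rewrite ler_peMr ?(spl_b spl)// ltW// spl_a0. Qed.
Lemma spl_c1 : 1 < c. Proof. exact: lt_le_trans spl_a1 spl_ac. Qed.
Lemma spl_c0 : 0 < c. Proof. exact: lt_trans ltr01 spl_c1. Qed.
Lemma spl_K0 : 0 < K. Proof. exact: lt_le_trans ltr01 (spl_K spl). Qed.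
Lemma spl_l3_neq0 : l3 != 0.
Proof. by rewrite -normr_gt0 (spl_l3 spl) invr_gt0 spl_c0. Qed.
Lemma spl_l2_neq0 : l2 != 0.
Proof. by rewrite -normr_gt0 (spl_l2 spl) spl_b0. Qed.

Lemma spl_Ee2 : E *m e2 = 0.
Proof.
by rewrite !mulmxBl mul1mx -!mulmxA (spl_e2f2e2 spl) (spl_f3e2 spl) mulmx0 subr0 subrr.
Qed.
Lemma spl_Ee3 : E *m e3 = 0.
Proof.
by rewrite !mulmxBl mul1mx -!mulmxA (spl_f2e3 spl) (spl_f3e3 spl) mulmx0 mulmx1 subr0 subrr.
Qed.
Lemma spl_f2E : f2 *m E = 0.
Proof.
by rewrite !mulmxBr mulmx1 !mulmxA (spl_f2e2f2 spl) (spl_f2e3 spl) mul0mx subr0 subrr.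
Qed.
Lemma spl_f3E : f3 *m E = 0.
Proof.
by rewrite !mulmxBr mulmx1 !mulmxA (spl_f3e2 spl) (spl_f3e3 spl) mul0mx mul1mx subr0 subrr.
Qed.
Lemma spl_EE : E *m E = E.
Proof. by rewrite {2}/spl_E !mulmxBr mulmx1 !mulmxA spl_Ee2 spl_Ee3 !mul0mx !subr0. Qed.
Lemma spl_1 : 1%:M = E + e2 *m f2 + e3 *m f3.
Proof. by rewrite /spl_E addrAC !subrK. Qed.
Lemma spl_TEC k : T k *m E = E *m T k.
Proof.
rewrite /spl_E !mulmxBr !mulmxBl mulmx1 mul1mx !mulmxA (spl_Te2 spl) (spl_Te3 spl).
by rewrite -!mulmxA (spl_f2T spl) (spl_f3T spl) -!scalemxAl -!scalemxAr.
Qed.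

Lemma spl_left p (Y : 'M[R]_(n, p)) : Y = E *m Y + e2 *m (f2 *m Y) + e3 *m (f3 *m Y).
Proof. by rewrite !mulmxA -2!mulmxDl -spl_1 mul1mx. Qed.
Lemma spl_right p (Y : 'M[R]_(p, n)) : Y = Y *m E + Y *m e2 *m f2 + Y *m e3 *m f3.
Proof. by rewrite -!mulmxA -2!mulmxDr -spl_1 mulmx1. Qed.
Lemma spl_UT k : U k *m T k = 1%:M. Proof. exact: mulmx1C (spl_TU spl k). Qed.
Lemma spl_Ue3 k : U k *m e3 = (l3 ^+ k)^-1 *: e3.
Proof.
rewrite -[in LHS](scalerK (_ : l3 ^+ k != 0) e3) ?expf_neq0 ?spl_l3_neq0//.
by rewrite -(spl_Te3 spl) -scalemxAr mulmxA spl_UT mul1mx.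
Qed.
Lemma spl_Ue2 k : U k *m e2 = (l2 ^+ k)^-1 *: e2.
Proof.
rewrite -[in LHS](scalerK (_ : l2 ^+ k != 0) e2) ?expf_neq0 ?spl_l2_neq0//.
by rewrite -(spl_Te2 spl) -scalemxAr mulmxA spl_UT mul1mx.
Qed.
Lemma spl_norm_l3 k : `|l3 ^+ k| = (c ^+ k)^-1.
Proof. by rewrite normrX (spl_l3 spl) exprVn. Qed.
Lemma spl_norm_l2 k : `|l2 ^+ k| = b ^+ k.
Proof. by rewrite normrX (spl_l2 spl). Qed.

(* The Lie algebra of the expanding horospherical subgroup. *)
Definition nilp (X : 'M[R]_n) : Prop := [/\ X *m E = 0, f3 *m X = 0 & f2 *m X *m e2 = 0].

Lemma nilpD X Y : nilp X -> nilp Y -> nilp (X + Y).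
Proof.
move=> [x1 x2 x3] [y1 y2 y3]; split.
- by rewrite mulmxDl x1 y1 addr0.
- by rewrite mulmxDr x2 y2 addr0.
- by rewrite mulmxDr mulmxDl x3 y3 addr0.
Qed.

Lemma nilpZ k X : nilp X -> nilp (k *: X).
Proof.
by move=> [x1 x2 x3]; split; rewrite -?scalemxAr -?scalemxAl ?x1 ?x2 ?x3 ?scaler0.
Qed.

Lemma nilpN X : nilp X -> nilp (- X).
Proof. by rewrite -scaleN1r; exact: nilpZ. Qed.

Lemma nilpB X Y : nilp X -> nilp Y -> nilp (X - Y).
Proof. by move=> x /nilpN; exact: nilpD. Qed.

Lemma nilp_e2 X : nilp X -> X *m e2 = E *m X *m e2.
Proof.
move=> [x1 x2 x3]; rewrite [LHS]spl_left.
by rewrite (mulmxA f2) (mulmxA f3) x2 x3 mul0mx !mulmx0 !addr0 mulmxA.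
Qed.

Lemma nilp_e3 X : nilp X -> X *m e3 = E *m X *m e3 + e2 *m (f2 *m X *m e3).
Proof.
move=> [x1 x2 x3]; rewrite [LHS]spl_left.
by rewrite (mulmxA f2) (mulmxA f3) x2 mul0mx mulmx0 addr0 (mulmxA E).
Qed.

Lemma nilp_f3 X : nilp X -> f3 *m X = 0. Proof. by case. Qed.

(** The three blocks go from the line of e2 to E, from the line of e3 to E, and from e3 to e2; the
    flow expands them at the rates a/b, ac and bc. *)
Lemma nilp_decomp X : nilp X ->
  X = E *m X *m e2 *m f2 + E *m X *m e3 *m f3 + e2 *m (f2 *m X *m e3) *m f3.
Proof.
move=> nX; have [x1 x2 x3] := nX.
rewrite [LHS]spl_right x1 add0r (nilp_e2 nX) (nilp_e3 nX).
by rewrite mulmxDl addrA.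
Qed.

Lemma nilpM X Y : nilp X -> nilp Y -> nilp (X *m Y).
Proof.
move=> nX nY; have [x1 x2 x3] := nX; have [y1 y2 y3] := nY; split.
- by rewrite -mulmxA y1 mulmx0.
- by rewrite mulmxA x2 mul0mx.
- by rewrite -!mulmxA (nilp_e2 nY) -mulmxA (mulmxA X) x1 mul0mx mulmx0.
Qed.

Definition unip (h : 'M[R]_n) : Prop := nilp (h - 1%:M).

Lemma unipE h : unip h -> h *m E = E.
Proof. by case=> /eqP; rewrite mulmxBl mul1mx subr_eq0 => /eqP. Qed.
Lemma unip_f3 h : unip h -> f3 *m h = f3.
Proof. by case=> _ /eqP; rewrite mulmxBr mulmx1 subr_eq0 => /eqP. Qed.

Lemma unipV h : h \in unitmx -> unip h -> unip (invmx h).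
Proof.
move=> uh hh; have [x1 x2 x3] := hh.
have hE := unipE hh; have f3h := unip_f3 hh.
split.
- by rewrite mulmxBl mul1mx -{1}hE mulKmx// subrr.
- by rewrite mulmxBr mulmx1 -{1}f3h mulmxK// subrr.
have he2 : h *m e2 = e2 + E *m ((h - 1%:M) *m e2).
  by rewrite mulmxA -(nilp_e2 hh) mulmxBl mul1mx addrC subrK.
have hV : invmx h *m e2 = e2 - E *m ((h - 1%:M) *m e2).
  rewrite -[RHS](mulKmx uh) mulmxBr he2 [h *m (E *m _)]mulmxA hE.
  by rewrite addrK.
rewrite -mulmxA mulmxBl mul1mx hV addrAC subrr sub0r mulmxN mulmxA.
by rewrite spl_f2E mul0mx oppr0.
Qed.

End SplittingTheory.

Section Horospherical.
Variables (R : realType) (n : nat) (g : R -> SL R n).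
Hypothesis gP : one_parameter_subgroup g.
Local Notation T := (fun k : nat => SLmx (g k%:R)).
Local Notation U := (fun k : nat => SLmx (g (- k%:R))).
Variables (e2 e3 : 'cV[R]_n) (f2 f3 : 'rV[R]_n) (l2 l3 a b c K : R).
Hypothesis spl : splitting T U e2 e3 f2 f3 l2 l3 a b c K.
Local Notation E := (spl_E e2 e3 f2 f3).
Local Notation nilp := (nilp e2 e3 f2 f3).

Lemma ops0 : g 0 = 1%g.
Proof.
case: gP => _ gD; have := gD 0 0; rewrite addr0 => /(congr1 (fun x => ((g 0)^-1 * x)%g)).
by rewrite mulVg mulKg.
Qed.

Lemma ops_opp t : g (- t) = (g t)^-1%g.
Proof.
case: gP => _ gD; have := gD t (- t); rewrite subrr ops0.
by move=> /(congr1 (fun x => ((g t)^-1 * x)%g)); rewrite mulKg mulg1.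
Qed.

Lemma ops_bounded (r : R) : exists2 M : R, 1 <= M &
  forall s, `|s| <= r -> `|SLmx (g s)| <= M.
Proof.
have [r0|r0] := ltP r 0.
  by exists 1 => // s sr; have := normr_ge0 s; rewrite leNgt (le_lt_trans sr r0).
have cf : continuous (fun s : R => `|SLmx (g s)|).
  move=> s; apply: (cvg_comp g (fun h : SL R n => `|SLmx h|)); first by case: gP => + _; apply.
  apply: (cvg_comp (@SLmx R n) (fun h : 'M[R]_n => `|h|)); first exact: SLmx_continuous.
  exact: norm_continuous.
have [||s0 _ Hs] := @EVT_max R (fun s : R => `|SLmx (g s)|) (- r) r.
- lra.
- by apply: continuous_subspaceT.
exists (1 + `|SLmx (g s0)|); first by rewrite lerDl.
move=> s sr; apply: (@le_trans _ _ `|SLmx (g s0)|); last by rewrite lerDr.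
by apply: Hs; rewrite in_itv /=; move: sr; rewrite ler_norml.
Qed.

Lemma vanishing_of_cvg0 (p q : nat) (Z : 'M[R]_(p, q)) (Y : nat -> 'M[R]_n) (B : R) :
  Y @ \oo --> (0 : 'M[R]_n) -> (forall k, `|Z| <= B * `|Y k|) -> Z = 0.
Proof.
move=> Y0 ZY; apply/eqP; rewrite -normr_le0; apply/ler_addgt0Pr => e e0; rewrite add0r.
have B0 : 0 < `|B| + 1 by rewrite ltr_pwDr.
move/cvgrPdist_lt: Y0 => /(_ (e / (`|B| + 1)) (divr_gt0 e0 B0)) [N _ HN].
have := HN N (leqnn N); rewrite /= sub0r normrN ltr_pdivlMr// => h.
apply: le_trans (ZY N) _; apply: ltW; apply: le_lt_trans h; rewrite mulrC ler_wpM2l//.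
by rewrite (le_trans (ler_norm B))// lerDl.
Qed.

(** The growth of the outer factors cancels because r <= s, so the norm of Z is at most a constant
    times that of [Y k], which tends to 0. *)
Lemma vanishing_of_rates (p q : nat) (Z : 'M[R]_(p, q)) (Y : nat -> 'M[R]_n)
    (L : nat -> 'M[R]_(p, n)) (Q : nat -> 'M[R]_(n, q)) (B1 B2 r s : R) :
  Y @ \oo --> (0 : 'M[R]_n) -> 0 <= r -> r <= s -> 0 < s -> 0 <= B1 ->
  (forall k, Z = L k *m Y k *m Q k) ->
  (forall k, `|L k| <= B1 * r ^+ k) -> (forall k, `|Q k| <= B2 / s ^+ k) -> Z = 0.
Proof.
move=> Y0 r0 rs s0 B10 ZE Lk Qk.
apply: (@vanishing_of_cvg0 _ _ _ _ (n%:R * (n%:R * B1 * B2)) Y0) => k.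
rewrite {1}(ZE k); apply: le_trans (norm_mulmx _ _) _; rewrite -[leRHS]mulrA ler_wpM2l//.
have sk : 0 < s ^+ k by rewrite exprn_gt0.
have rk : 0 <= r ^+ k by rewrite exprn_ge0.
have rsk : r ^+ k <= s ^+ k by rewrite lerXn2r// nnegrE ltW.
have := norm_mulmx (L k) (Y k).
have -> : n%:R * B1 * B2 * `|Y k| = n%:R * (B1 * s ^+ k * `|Y k|) * (B2 / s ^+ k).
  by field; rewrite lt0r_neq0.
move=> h; apply: ler_pM => //; apply: le_trans h _; rewrite ler_wpM2l// ler_wpM2r//.
by apply: le_trans (Lk k) _; rewrite ler_wpM2l.
Qed.

(** Integer times suffice: a block of h - 1 that the flow does not expand equals T^k times a null
    sequence times T^-k, with rates that compensate, and therefore vanishes. *)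
Lemma horospherical_nilp h : horospherical g h -> nilp (SLmx h - 1%:M).
Proof.
move=> hg; set X := SLmx h - 1%:M; pose Y k := U k *m X *m T k.
have YE k : Y k = SLmx ((g k%:R)^-1 * h * g k%:R)%g - 1%:M.
  by rewrite /Y /X mulmxBr mulmxBl mulmx1 (spl_UT spl) ops_opp !SLmxM.
have Y0 : Y @ \oo --> (0 : 'M[R]_n).
  have : (fun k : nat => ((g k%:R)^-1 * h * g k%:R)%g) @ \oo --> (1%g : SL R n).
    by apply: (cvg_comp (fun k : nat => k%:R : R) _ (@cvgr_idn R)) hg.
  move=> /(cvg_comp _ (@SLmx R n))/(_ (@SLmx_continuous R n 1%g)) H.
  have -> : Y = (fun k => SLmx ((g k%:R)^-1 * h * g k%:R)%g - 1%:M) by apply/funext.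
  rewrite -[X in _ --> X](subrr (1%:M : 'M[R]_n)); apply: cvgB; last exact: cvg_cst.
  exact: H.
have XE k : X = T k *m Y k *m U k.
  by rewrite /Y !mulmxA (spl_TU spl) mul1mx -mulmxA (spl_TU spl) mulmx1.
have a0 := spl_a0 spl; have b0 := spl_b0 spl; have c0 := spl_c0 spl.
have c1 : c^-1 <= 1 by rewrite invf_le1// ltW// (spl_c1 spl).
have ci0 : 0 < c^-1 by rewrite invr_gt0.
have ba : b <= a by rewrite ltW// (spl_ba spl).
have b1 := spl_b spl; have K0 := ltW (spl_K0 spl).
have L3 k : `|f3 *m T k| <= `|f3| * c^-1 ^+ k.
  by rewrite (spl_f3T spl) mx_normZ (spl_norm_l3 spl) exprVn mulrC.
have L2 k : `|f2 *m T k| <= `|f2| * b ^+ k.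
  by rewrite (spl_f2T spl) mx_normZ (spl_norm_l2 spl) mulrC.
have LE k : `|E *m T k| <= K * a ^+ k by rewrite -(spl_TEC spl) (spl_TE spl).
have R3 k : `|U k *m e3| <= `|e3| / c^-1 ^+ k.
  by rewrite (spl_Ue3 spl) mx_normZ normrV ?unitfE ?expf_neq0 ?(spl_l3_neq0 spl)// (spl_norm_l3 spl) exprVn mulrC.
have R2 k : `|U k *m e2| <= `|e2| / b ^+ k.
  by rewrite (spl_Ue2 spl) mx_normZ normrV ?unitfE ?expf_neq0 ?(spl_l2_neq0 spl)// (spl_norm_l2 spl) mulrC.
have RE := spl_UE spl.
have van p q (L : 'M[R]_(p, n)) (Q : 'M[R]_(n, q)) B1 B2 r s : 0 <= r -> r <= s -> 0 < s ->
    0 <= B1 -> (forall k, `|L *m T k| <= B1 * r ^+ k) -> (forall k, `|U k *m Q| <= B2 / s ^+ k) ->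
    L *m X *m Q = 0.
  move=> r0 rs s0 B10 hL hQ.
  apply: (@vanishing_of_rates _ _ _ Y (fun k => L *m T k) (fun k => U k *m Q) B1 B2 r s) => // k.
  by rewrite {1}(XE k) !mulmxA.
have z3E : f3 *m X *m E = 0.
  by apply: van L3 RE => //; [exact: ltW|lra].
have z33 : f3 *m X *m e3 = 0 by apply: van L3 R3 => //; exact: ltW.
have z32 : f3 *m X *m e2 = 0.
  by apply: van L3 R2 => //; [exact: ltW|lra].
have z2E : f2 *m X *m E = 0.
  by apply: van L2 RE => //; exact: ltW.
have z22 : f2 *m X *m e2 = 0 by apply: van L2 R2 => //; exact: ltW.
have zEE : E *m X *m E = 0.
  by apply: van LE RE => //; exact: ltW.
split=> //.
  rewrite [LHS](spl_left e2 e3 f2 f3) !mulmxA zEE.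
  by rewrite -(mulmxA e2) -(mulmxA e2) z2E -(mulmxA e3) -(mulmxA e3) z3E !mulmx0 !addr0.
by rewrite [LHS](spl_right e2 e3 f2 f3) z3E z32 z33 !mul0mx !addr0.
Qed.

(** The blocks of [nilp_decomp] are contracted at the rates b/a, 1/(ac) and 1/(bc); the first is the
    slowest. *)
Lemma nilp_contracted X : nilp X -> exists B q : R, [/\ 0 <= B, 0 <= q, q < 1 &
  forall k, `|U k *m X *m T k| <= B * q ^+ k].
Proof.
move=> nX.
have a0 := spl_a0 spl; have b0 := spl_b0 spl; have c0 := spl_c0 spl.
have b1 := spl_b spl; have ba := spl_ba spl; have abc := spl_abc spl; have a1 := spl_a1 spl.
have K0 := spl_K0 spl.
have l20 := spl_l2_neq0 spl; have l30 := spl_l3_neq0 spl.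
pose M1 := X *m e2 *m f2; pose M2 := X *m e3 *m f3.
pose M3 := e2 *m (f2 *m X *m e3) *m f3.
exists (n%:R * K * `|M1| + n%:R * K * `|M2| + `|M3|), (b / a); split.
- by rewrite !addr_ge0 ?mulr_ge0// ltW.
- by rewrite divr_ge0// ltW.
- by rewrite ltr_pdivrMr// mul1r.
move=> k; have -> : U k *m X *m T k = l2 ^+ k *: (U k *m E *m M1) +
    l3 ^+ k *: (U k *m E *m M2) + ((l2 ^+ k)^-1 * l3 ^+ k) *: M3.
  rewrite {1}(nilp_decomp nX) 2!mulmxDr 2!mulmxDl; congr (_ + _ + _).
  - by rewrite -!mulmxA (spl_f2T spl) -!scalemxAr /M1 !mulmxA.
  - by rewrite -!mulmxA (spl_f3T spl) -!scalemxAr /M2 !mulmxA.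
  - by rewrite !mulmxA (spl_Ue2 spl) -!mulmxA (spl_f3T spl) -!scalemxAr -!scalemxAl scalerA mulrC /M3 !mulmxA.
have ak : 0 < a ^+ k by rewrite exprn_gt0.
have bk : 0 < b ^+ k by rewrite exprn_gt0.
have ck : 0 < c ^+ k by rewrite exprn_gt0.
have UE M : `|U k *m E *m M| <= n%:R * K * `|M| / a ^+ k.
  apply: le_trans (norm_mulmx _ _) _.
  have -> : n%:R * K * `|M| / a ^+ k = n%:R * (K / a ^+ k * `|M|) by field; exact: lt0r_neq0.
  by rewrite ler_wpM2l// ler_wpM2r// (spl_UE spl).
have abck : a ^+ k * b ^+ k <= c ^+ k by rewrite -exprMn lerXn2r// nnegrE ltW// mulr_gt0.
have b1k : 1 <= b ^+ k by rewrite exprn_ege1.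
have a1k : 1 <= a ^+ k by rewrite exprn_ege1// ltW.
have bi1 : (b ^+ k)^-1 <= b ^+ k.
  by apply: (le_trans _ b1k); rewrite invf_le1.
have cia : (c ^+ k)^-1 <= (a ^+ k)^-1.
  by rewrite lef_pV2 ?posrE//; apply: (le_trans _ abck); rewrite ler_peMr// ltW.
have ci1 : (c ^+ k)^-1 <= b ^+ k.
  by apply: le_trans cia _; apply: (le_trans _ b1k); rewrite invf_le1//.
rewrite expr_div_n 2!mulrDl; apply: le_trans (ler_normD _ _) _; apply: lerD; last first.
  rewrite mx_normZ normrM normrV ?unitfE ?expf_neq0// (spl_norm_l2 spl) (spl_norm_l3 spl).
  by rewrite mulrC ler_wpM2l// ler_pM// invr_ge0 ltW.
apply: le_trans (ler_normD _ _) _; apply: lerD; rewrite mx_normZ.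
  rewrite (spl_norm_l2 spl) [leRHS]mulrCA ler_wpM2l//; exact: ltW.
rewrite (spl_norm_l3 spl) [leRHS]mulrCA ler_pM// invr_ge0 ltW//.
Qed.

(** Conjugation by the flow preserves the determinant and moves 1 + X to 1. *)
Lemma nilp_det X : nilp X -> \det (1%:M + X) = 1.
Proof.
move=> nX; have [B [q [B0 q0 q1 Bq]]] := nilp_contracted nX.
have detk k : \det (1%:M + U k *m X *m T k) = \det (1%:M + X).
  have -> : 1%:M + U k *m X *m T k = U k *m (1%:M + X) *m T k.
    by rewrite mulmxDr mulmxDl mulmx1 (spl_UT spl).
  by rewrite !det_mulmx !SL_det mul1r mulr1.
have cv : (fun k => 1%:M + U k *m X *m T k) @ \oo --> (1%:M : 'M[R]_n).
  rewrite -[X in _ --> X]addr0; apply: cvgD; first exact: cvg_cst.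
  apply/cvgrPdist_lt => e e0; have B10 : 0 < B + 1 by lra.
  have : (fun k => q ^+ k) @ \oo --> (0 : R) by apply: cvg_expr; rewrite ger0_norm.
  move=> /cvgrPdist_lt/(_ _ (divr_gt0 e0 B10)) qe.
  near=> k; rewrite sub0r normrN.
  apply: le_lt_trans (Bq k) _.
  have : q ^+ k < e / (B + 1).
    have : `|0 - q ^+ k| < e / (B + 1) by near: k; exact: qe.
    by rewrite sub0r normrN ger0_norm ?exprn_ge0.
  rewrite ltr_pdivlMr// mulrC; apply: le_lt_trans; rewrite ler_wpM2r ?exprn_ge0//; lra.
have := cvg_comp _ _ cv (@det_continuous R n 1%:M).
have -> : (fun A : 'M[R]_n => \det A) \o (fun k => 1%:M + U k *m X *m T k) = fun=> \det (1%:M + X).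
  by apply/funext => k /=; exact: detk.
rewrite det1 => H1; apply: (@cvg_unique _ (@Rhausdorff R) ((fun _ : nat => \det (1%:M + X)) @ \oo)) => //.
exact: cvg_cst.
Unshelve. all: by end_near. Qed.

(** Contraction along integer times extends to real times, as g is bounded on [-1, 1]. *)
Lemma nilp_horospherical h : nilp (SLmx h - 1%:M) -> horospherical g h.
Proof.
set X := SLmx h - 1%:M => nX.
have [B [q [B0 q0 q1 Bq]]] := nilp_contracted nX.
have [M M1 Mb] := ops_bounded 1.
have conjE t : SLmx ((g t)^-1 * h * g t)%g = 1%:M + SLmx (g (- t)) *m X *m SLmx (g t).
  rewrite /X mulmxBr mulmxBl mulmx1 ops_opp -!SLmxM mulVg SLmx1.
  by rewrite addrC subrK.
have M0 : 0 < M by lra.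
pose D := n%:R * n%:R * M * M * B + 1.
have D0 : 0 < D.
  by rewrite ltr_wpDl ?mulr_ge0// ltW.
have bound t : 0 <= t -> `|SLmx (g (- t)) *m X *m SLmx (g t)| <= D * q ^+ (Num.truncn t).
  move=> t0; set k := Num.truncn t; set s := t - k%:R.
  have s1 : `|s| <= 1.
    have /andP[h1 h2] := truncn_itv t0.
    rewrite ger0_norm /s ?subr_ge0//; rewrite -natr1 in h2; lra.
  have gt : g t = (g k%:R * g s)%g by case: gP => _ gD; rewrite -gD /s addrC subrK.
  have gt' : g (- t) = (g (- s) * g (- k%:R))%g.
    by case: gP => _ gD; rewrite -gD /s; congr g; ring.
  rewrite gt gt' !SLmxM.
  have -> : SLmx (g (- s)) *m SLmx (g (- k%:R)) *m X *m (SLmx (g k%:R) *m SLmx (g s)) =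
    SLmx (g (- s)) *m (SLmx (g (- k%:R)) *m X *m SLmx (g k%:R)) *m SLmx (g s).
    by rewrite !mulmxA.
  have h1 := Mb s s1; have h2 : `|SLmx (g (- s))| <= M by apply: Mb; rewrite normrN.
  have h3 := Bq k; set Z := _ *m X *m _ in h3 *.
  have qk : 0 <= q ^+ k by rewrite exprn_ge0.
  apply: le_trans (norm_mulmx _ _) _.
  apply: (@le_trans _ _ (n%:R * (n%:R * (M * (B * q ^+ k)) * M))).
    rewrite ler_wpM2l// ler_pM//; apply: le_trans (norm_mulmx _ _) _.
    by rewrite ler_wpM2l// ler_pM.
  have -> : n%:R * (n%:R * (M * (B * q ^+ k)) * M) = n%:R * n%:R * M * M * B * q ^+ k by ring.
  by rewrite ler_wpM2r// /D lerDl.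
have cvm : (fun t => SLmx ((g t)^-1 * h * g t)%g) @ +oo --> (1%:M : 'M[R]_n).
  apply/cvgrPdist_lt => e e0.
  have : (fun k => q ^+ k) @ \oo --> (0 : R) by apply: cvg_expr; rewrite ger0_norm.
  move=> /cvgrPdist_lt/(_ _ (divr_gt0 e0 D0)) [N _ HN].
  exists N%:R; split; first exact: num_real.
  move=> t /= Nt; rewrite conjE opprD addrA subrr sub0r normrN.
  have t0 : 0 <= t by rewrite (le_trans _ (ltW Nt)).
  apply: le_lt_trans (bound t t0) _; rewrite mulrC -ltr_pdivlMr//.
  have := HN (Num.truncn t); rewrite /= sub0r normrN ger0_norm ?exprn_ge0//; apply.
  by rewrite /= truncn_ge_nat// ltW.
move=> A; rewrite nbhsE => -[V [[W oW WV] V1] VA].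
have nW : nbhs (1%:M : 'M[R]_n) W.
  by apply: open_nbhs_nbhs; split=> //; move: V1; rewrite -WV.
have := cvm W nW; rewrite /= !nbhs_simpl /=; apply: filterS => t Wt.
by apply: VA; rewrite -WV.
Qed.

Lemma horospherical_set : [set SLmx h | h in horospherical g] = [set A | nilp (A - 1%:M)].
Proof.
rewrite eqEsubset; split => [_ [h hg <-]|A /= nA]; first exact: horospherical_nilp.
have dA : \det A == 1 by rewrite -[A](subrK 1%:M) addrC nilp_det.
have AE : SLmx (Sub A dA : SL R n) = A by rewrite /SLmx SubK.
by exists (Sub A dA : SL R n) => //; apply: nilp_horospherical; rewrite AE.
Qed.

End Horospherical.

(** * Hyperplanes blocking many affine functions *)

Section SpanningPoints.
Variable R : realType.

Lemma row_free_col_mx (r N : nat) (A : 'M[R]_(r, N)) (x : 'rV[R]_N) (v : 'cV[R]_N) :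
  row_free A -> A *m v = 0 -> x *m v != 0 -> row_free (col_mx x A).
Proof.
move=> fA Av xv; rewrite -kermx_eq0; apply/rowV0P => w /sub_kermxP.
rewrite -[w]hsubmxK mul_row_col => E.
have : lsubmx w *m (x *m v) = 0.
  have := congr1 (fun M => M *m v) E.
  by rewrite mulmxDl -!mulmxA Av mulmx0 addr0 mul0mx.
have -> : x *m v = ((x *m v) 0 0)%:M by rewrite -mx11_scalar.
rewrite mul_mx_scalar => /eqP; rewrite scaler_eq0 => /orP[/eqP h|/eqP w0].
  by case/eqP: xv; apply/matrixP => i j; rewrite !ord1 h mxE.
move: E; rewrite w0 mul0mx add0r => /eqP; rewrite mulmx_free_eq0// => /eqP ->.
exact: row_mx0.
Qed.

(** Greedy choice: fewer than N independent points of H are killed by a nonzero v; unless v kills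
    all of H, a further point of H extends the family. *)
Lemma span_or_annihilator (N : nat) (H : set 'rV[R]_N) :
  (exists2 t : 'I_N -> 'rV[R]_N, forall i, H (t i) & \det (\matrix_i t i) != 0) \/
  (exists2 v : 'cV[R]_N, v != 0 & forall x, H x -> x *m v = 0).
Proof.
have [|nv] := EM (exists2 v : 'cV[R]_N, v != 0 & forall x, H x -> x *m v = 0); [by right|left].
have step r : (r <= N)%N -> exists2 A : 'M[R]_(r, N), forall i, H (row i A) & row_free A.
  elim: r => [_|r IH rN].
    exists 0 => [[]//|]; rewrite /row_free mxrank0 //.
  have [A HA fA] := IH (ltnW rN).
  have [v v0 Av] : exists2 v : 'cV[R]_N, v != 0 & A *m v = 0.
    have : cokermx A != 0.
      by rewrite -mxrank_eq0 mxrank_coker (eqP fA) -lt0n subn_gt0.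
    have [/existsP[j cj] _|] := boolP [exists j, col j (cokermx A) != 0].
      exists (col j (cokermx A)) => //.
      by rewrite colE mulmxA mulmx_coker mul0mx.
    move=> /existsPn nc /eqP; case; apply/matrixP => i j; rewrite mxE.
    have := nc j; rewrite negbK => /eqP/matrixP/(_ i 0); rewrite !mxE //.
  have [x Hx xv] : exists2 x, H x & x *m v != 0.
    apply: contrapT => nx; apply: nv; exists v => // x Hx.
    by apply/eqP/negPn/negP => xv; apply: nx; exists x.
  exists (col_mx x A); last exact: row_free_col_mx Av xv.
  move=> i; have [j ->|j ->] := @split_ordP 1 r i.
    by have -> : row (lshift r j) (col_mx x A) = x by rewrite [LHS]rowKu ord1 row_id.
  by have -> : row (rshift 1 j) (col_mx x A) = row j A by exact: rowKd.
have [A HA fA] := step N (leqnn N).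
exists (fun i => row i A) => //.
have -> : \matrix_i row i A = A by apply/matrixP => i j; rewrite !mxE.
by rewrite row_free_unit unitmxE unitfE in fA.
Qed.

Lemma norm_det_le (N : nat) (A : 'M[R]_N) (D : R) :
  (forall i j, `|A i j| <= D) -> `|\det A| <= (#|'S_N|)%:R * D ^+ N.
Proof.
move=> AD; rewrite /determinant; apply: le_trans (ler_norm_sum _ _ _) _.
rewrite -sum1_card natr_sum mulr_suml; apply: ler_sum => s _.
rewrite mul1r normrM normrX normrN1 expr1n mul1r normr_prod.
rewrite -[X in _ <= D ^+ X]card_ord -prodr_const.
by apply: ler_prod => i _; rewrite normr_ge0 AD.
Qed.

Lemma cramer_coef (N : nat) (M : 'M[R]_N) (x : 'rV[R]_N) (i : 'I_N) : \det M != 0 ->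
  (x *m invmx M) 0 i = (\det M)^-1 * \det (\matrix_j (if j == i then x else row j M)).
Proof.
move=> dM; set M' := (\matrix_j _).
have uM : M \in unitmx by rewrite unitmxE unitfE.
rewrite /invmx uM -scalemxAr mxE; congr (_ * _).
rewrite (expand_det_row M' i) mxE; apply: eq_bigr => j _.
rewrite mxE; congr (_ * _).
  by rewrite /M' !mxE eqxx.
rewrite /cofactor; congr (_ * \det _); apply/matrixP => k l.
by rewrite !mxE eq_sym (negbTE (neq_lift _ _)) !mxE.
Qed.

(** Take N points of H whose determinant exceeds half of the supremum. Replacing one of them by x at
    most doubles the determinant, and by Cramer's rule this ratio is the coefficient of x. *)
Lemma quasi_basis (N : nat) (H : set 'rV[R]_N) (D : R) :
  (forall x, H x -> `|x| <= D) ->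
  (exists2 t : 'I_N -> 'rV[R]_N, forall i, H (t i) &
     forall x, H x -> exists2 c : 'I_N -> R, forall i, `|c i| <= 2 & x = \sum_i c i *: t i) \/
  (exists2 v : 'cV[R]_N, v != 0 & forall x, H x -> x *m v = 0).
Proof.
move=> HD; have [[t0 Ht0 dt0]|] := span_or_annihilator H; [left|by right].
pose V := [set `|\det (\matrix_i t i)| | t in [set t : 'I_N -> 'rV[R]_N | forall i, H (t i)]].
have Vub : ubound V (#|'S_N|%:R * D ^+ N).
  move=> _ [t /= Ht <-]; apply: norm_det_le => i j; rewrite !mxE.
  by apply: le_trans (ler_entry_norm _ _ _) _; exact: HD.
have V0 : V `|\det (\matrix_i t0 i)| by exists t0.
have supV : has_sup V by split; [exists (`|\det (\matrix_i t0 i)|) | exists (#|'S_N|%:R * D ^+ N)].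
have S0 : 0 < sup V.
  by apply: lt_le_trans (ub_le_sup supV.2 V0); rewrite normr_gt0.
have [_ [t /= Ht <-] tS] := @sup_adherent _ V (sup V / 2) (divr_gt0 S0 (ltr0Sn _ 1)) supV.
have {}tS : sup V / 2 < `|\det (\matrix_i t i)| by lra.
exists t => // x Hx; set M := \matrix_i t i in tS.
have dM : \det M != 0 by rewrite -normr_gt0; apply: le_lt_trans tS; rewrite divr_ge0// ltW.
exists (fun i => (x *m invmx M) 0 i) => [i|].
  rewrite cramer_coef// normrM normrV ?unitfE//.
  rewrite ler_pdivrMl ?normr_gt0//; apply: (@le_trans _ _ (sup V)); last by lra.
  apply: ub_le_sup; first exact: supV.2.
  exists (fun j => if j == i then x else t j) => /=.
    by move=> j; case: ifP.
  congr `|\det _|; apply/matrixP => j k; rewrite !mxE.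
  by case: ifP => // _; rewrite !mxE.
have uM : M \in unitmx by rewrite unitmxE unitfE.
rewrite -[LHS](mulmxKV uM) [LHS]mulmx_sum_row; apply: eq_bigr => i _.
by congr (_ *: _); apply/rowP => j; rewrite !mxE.
Qed.

End SpanningPoints.

(** * The points where most of the weight hits lie near one hyperplane *)

Section BlockingHyperplane.
Variable R : realType.

Definition dotp (m : nat) (a x : 'rV[R]_m) : R := \sum_(j < m) a ord0 j * x ord0 j.

Lemma dotpDr m (a x y : 'rV[R]_m) : dotp a (x + y) = dotp a x + dotp a y.
Proof. by rewrite -big_split; apply: eq_bigr => j _; rewrite mxE mulrDr. Qed.

Lemma dotpZr m (a x : 'rV[R]_m) k : dotp a (k *: x) = k * dotp a x.
Proof. by rewrite mulr_sumr; apply: eq_bigr => j _; rewrite mxE mulrCA. Qed.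

Lemma dotp_enorm m (a : 'rV[R]_m) : dotp a a = enorm a ^+ 2.
Proof.
rewrite sqr_sqrtr; first by apply: eq_bigr => j _; rewrite expr2.
by apply: sumr_ge0 => j _; exact: sqr_ge0.
Qed.

Lemma enorm_ge0 m (x : 'rV[R]_m) : 0 <= enorm x. Proof. exact: sqrtr_ge0. Qed.

Lemma enormZ m k (x : 'rV[R]_m) : enorm (k *: x) = `|k| * enorm x.
Proof.
rewrite /enorm -sqrtr_sqr -sqrtrM ?sqr_ge0//; congr Num.sqrt; rewrite mulr_sumr.
by apply: eq_bigr => j _; rewrite mxE exprMn.
Qed.

Lemma enormN m (x : 'rV[R]_m) : enorm (- x) = enorm x.
Proof. by rewrite -scaleN1r enormZ normrN1 mul1r. Qed.

Lemma norm_le_enorm m (x : 'rV[R]_m) : `|x| <= enorm x.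
Proof.
apply: norm_mx_le => [|i j]; first exact: enorm_ge0.
rewrite (ord1 i) -sqrtr_sqr ler_wsqrtr// (bigD1 j)//= lerDl.
by apply: sumr_ge0 => k _; exact: sqr_ge0.
Qed.

Lemma enorm_le_norm m (x : 'rV[R]_m) : enorm x <= m%:R * `|x|.
Proof.
have x0 := normr_ge0 x.
rewrite -[leRHS]ger0_norm ?mulr_ge0// -sqrtr_sqr ler_wsqrtr//.
apply: (@le_trans _ _ (m%:R * `|x| ^+ 2)).
  rewrite -[X in X%:R * _]card_ord -sum1_card natr_sum mulr_suml; apply: ler_sum => j _.
  by rewrite mul1r -[leLHS]real_normK ?num_real// lerXn2r ?nnegrE ?ler_entry_norm.
rewrite exprMn ler_wpM2r ?sqr_ge0// -natrX ler_nat.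
by case: (m) => // p; rewrite expnS expn1 leq_pmulr.
Qed.

Lemma enorm_eq0 m (x : 'rV[R]_m) : enorm x = 0 -> x = 0.
Proof. by move=> x0; apply/eqP; rewrite -normr_le0 -x0 norm_le_enorm. Qed.

Lemma enorm_gt0 m (x : 'rV[R]_m) : x != 0 -> 0 < enorm x.
Proof. by move=> x0; rewrite lt_def enorm_ge0 andbT; apply: contra x0 => /eqP/enorm_eq0 ->. Qed.

Lemma edist_le m (x y : 'rV[R]_m) (L : set 'rV[R]_m) : L y -> Defs.edist x L <= enorm (x - y).
Proof.
move=> Ly; apply: ge_inf; last by exists y.
by exists 0 => _ [z _ <-]; exact: enorm_ge0.
Qed.

Lemma edist_hyperplane m (a : 'rV[R]_m) (k : R) (y : 'rV[R]_m) : a != 0 ->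
  Defs.edist y [set x | dotp a x = k] <= `|dotp a y - k| / enorm a.
Proof.
move=> a0; have ea := enorm_gt0 a0.
pose s := (dotp a y - k) / enorm a ^+ 2.
apply: (le_trans (@edist_le _ y (y - s *: a) _ _)).
  rewrite /= -scaleNr dotpDr dotpZr dotp_enorm mulNr /s divfK ?expf_neq0 ?lt0r_neq0//.
  by rewrite subKr.
rewrite subKr enormZ normrM normrV ?unitfE ?expf_neq0 ?lt0r_neq0//.
by rewrite (ger0_norm (sqr_ge0 _)) expr2 invfM -!mulrA mulVf ?lt0r_neq0// mulr1.
Qed.

(** Union bound: each point is missed by at most 1/(p+1) of the weight, so p points are missed by at
    most p/(p+1) of it. *)
Lemma common_hit (Z : eqType) (ls : seq Z) (wt : Z -> R) (p : nat) (hit : Z -> 'I_p -> bool) :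
  (0 < p)%N -> (forall z, 0 <= wt z) ->
  (forall i, (1 - p.+1%:R^-1) * \sum_(z <- ls) wt z < \sum_(z <- ls | hit z i) wt z) ->
  exists2 z, z \in ls & forall i, hit z i.
Proof.
move=> p0 w0 H; apply: contrapT => nz; set W := \sum_(z <- ls) wt z in H.
have W0 : 0 <= W by apply: sumr_ge0.
have miss i : \sum_(z <- ls | ~~ hit z i) wt z <= p.+1%:R^-1 * W.
  have split_le (q V A B : R) : V = A + B -> (1 - q) * V < A -> B <= q * V.
    by move=> ->; rewrite mulrBl mul1r; lra.
  by apply: split_le (H i); rewrite /W (bigID (fun z => hit z i)).
have i0 : 'I_p := Ordinal p0.
have h1 : W <= \sum_(i < p) \sum_(z <- ls | ~~ hit z i) wt z.
  under eq_bigr do rewrite big_mkcond.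
  rewrite exchange_big /= /W [leLHS]big_seq [leRHS]big_seq; apply: ler_sum => z zl.
  have [i zi] : exists i, ~~ hit z i.
    apply: contrapT => H1; apply: nz; exists z => // i; apply/negPn/negP => zi.
    by apply: H1; exists i.
  by rewrite (bigD1 i)//= zi lerDl; apply: sumr_ge0 => j _; case: ifP.
have h2 : \sum_(i < p) \sum_(z <- ls | ~~ hit z i) wt z <= \sum_(i < p) p.+1%:R^-1 * W.
  by apply: ler_sum => i _; exact: miss.
have h3 : \sum_(i < p) p.+1%:R^-1 * W = p%:R / p.+1%:R * W.
  by rewrite sumr_const card_ord -[LHS]mulr_natl mulrA.
(* If no element hits all points, the total weight vanishes; the strict inequality in H then fails
   at any single point. *)
have W00 : W = 0.
  apply/eqP; rewrite eq_le W0 andbT leNgt; apply/negP => Wp.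
  have : p%:R / p.+1%:R * W < W.
    by rewrite gtr_pMl// ltr_pdivrMr ?ltr0Sn// mul1r ltr_nat.
  by rewrite -h3 ltNge (le_trans h1 h2).
have := H i0; rewrite W00 mulr0 => /lt_geF/negP; apply.
have := W00; rewrite /W (bigID (fun z => hit z i0))/= => E.
have : 0 <= \sum_(z <- ls | ~~ hit z i0) wt z by apply: sumr_ge0.
by move: E; set A := \sum_(_ <- _ | _) _; set B := \sum_(_ <- _ | _) _; lra.
Qed.

(* If the points hit by a large proportion of the affine functions contain a quasi-basis, one of
   the functions is small at all points of this quasi-basis, hence at all of them. *)
Lemma blocking_hyperplane (m : nat) (Z : eqType) (ls : seq Z) (wt : Z -> R)
    (u : Z -> 'rV[R]_m) (k : Z -> R) (hit : Z -> 'rV[R]_m -> bool) (Y : set 'rV[R]_m)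
    (D c1 delta : R) :
  (0 < m)%N -> (forall z, 0 <= wt z) -> 0 < c1 -> 0 <= delta ->
  (forall y, Y y -> `|y| <= D) ->
  (forall z, z \in ls -> c1 <= enorm (u z)) ->
  (forall z y, z \in ls -> Y y -> hit z y -> `|dotp (u z) y + k z| <= delta) ->
  exists2 L, is_hyperplane L & forall y, Y y ->
    (1 - m.+2%:R^-1) * \sum_(z <- ls) wt z < \sum_(z <- ls | hit z y) wt z ->
    Defs.edist y L <= 2 * m.+1%:R * delta / c1.
Proof.
move=> m0 w0 c0 d0 YD uc hY.
pose bad := [set y | Y y /\
  (1 - m.+2%:R^-1) * \sum_(z <- ls) wt z < \sum_(z <- ls | hit z y) wt z].
(* Affine functions of y are linear functions of [hat y]. *)
pose hat (y : 'rV[R]_m) : 'rV[R]_(1 + m) := row_mx 1%:M y.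
have hatD x : [set hat y | y in bad] x -> `|x| <= 1 + `|D|.
  move=> [y [Yy _] <-]; apply: norm_mx_le => [|i j]; first by rewrite addr_ge0.
  rewrite mxE; case: splitP => j' _.
    by rewrite !mxE !ord1 eqxx normr1 lerDl.
  apply: le_trans (ler_entry_norm _ _ _) _; apply: le_trans (YD y Yy) _.
  by rewrite (le_trans (ler_norm D))// lerDr.
have hatE (y a : 'rV[R]_m) s : (hat y *m col_mx s%:M a^T) 0 0 = dotp a y + s.
  rewrite mul_row_col mul1mx mxE [s%:M _ _]mxE eqxx mulr1n addrC; congr (_ + _).
  by rewrite mxE; apply: eq_bigr => j _; rewrite mxE mulrC.
have [[t tbad tspan]|[v v0 vbad]] := quasi_basis hatD.
  have tE i : exists x, bad x /\ hat x = t i by have [x xb xt] := tbad i; exists x.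
  have [y yE] := choice tE.
  have [||z zl zhit] := @common_hit Z ls wt m.+1 (fun z i => hit z (y i)) _ w0.
  - by [].
  - by move=> i; have [[]] := yE i.
  exists [set x | dotp (u z) x = - k z].
    exists (u z), (- k z); split=> //; apply/eqP => u0.
    by have := uc z zl; rewrite u0 -[0]/(0 : 'rV[R]_m) -(scale0r 0) enormZ normr0 mul0r leNgt c0.
  move=> x Yx xbad; have ez := uc z zl.
  have u0 : u z != 0.
    by apply/eqP => u0; move: ez; rewrite u0 -(scale0r 0) enormZ normr0 mul0r leNgt c0.
  apply: le_trans (edist_hyperplane _ _ u0) _; rewrite opprK.
  have [|cf cf2 xE] := tspan (hat x); first by exists x.
  have val : dotp (u z) x + k z = \sum_i cf i * (dotp (u z) (y i) + k z).
    rewrite -hatE xE mulmx_suml summxE; apply: eq_bigr => i _.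
    by have [_ <-] := yE i; rewrite -scalemxAl mxE hatE.
  have vle : `|dotp (u z) x + k z| <= 2 * m.+1%:R * delta.
    rewrite val; apply: le_trans (ler_norm_sum _ _ _) _.
    have -> : 2 * m.+1%:R * delta = \sum_(i < m.+1) 2 * delta.
      by rewrite sumr_const card_ord -[RHS]mulr_natl; ring.
    apply: ler_sum => i _; rewrite normrM ler_pM//.
    by have [[Yy _] _] := yE i; apply: hY.
  by rewrite ler_pM// ?invr_ge0 ?enorm_ge0// lef_pV2 ?posrE ?enorm_gt0.
have dist0 (L : set 'rV[R]_m) y : L y -> Defs.edist y L <= 2 * m.+1%:R * delta / c1.
  move=> Ly; apply: le_trans (edist_le _ Ly) _; rewrite subrr -(scale0r 0) enormZ normr0 mul0r.
  by rewrite divr_ge0 ?mulr_ge0// ltW.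
have [[y0 y0b]|nb] := EM (exists y, bad y); last first.
  exists [set x | dotp (delta_mx 0 (Ordinal m0)) x = 0].
    exists (delta_mx 0 (Ordinal m0)), 0; split=> //.
    by apply/eqP => /matrixP/(_ 0 (Ordinal m0)); rewrite !mxE !eqxx => /eqP; rewrite oner_eq0.
  by move=> y Yy yb; case: nb; exists y.
pose a := (dsubmx v)^T; pose s := (usubmx v) 0 0.
have vE : v = col_mx s%:M a^T by rewrite trmxK -mx11_scalar vsubmxK.
have bad0 y : bad y -> dotp a y = - s.
  move=> yb; have := vbad (hat y) (ex_intro2 _ _ y yb erefl).
  by move=> /(congr1 (fun M : 'M[R]_1 => M 0 0)); rewrite vE hatE mxE => /eqP; rewrite addr_eq0 => /eqP.
exists [set x | dotp a x = - s]; last by move=> y Yy yb; apply: dist0; apply: bad0.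
(* If a = 0, the annihilator v reduces to the constant s, which vanishes because a bad point [y0]
   exists; then v = 0. *)
exists a, (- s); split=> //; apply: contra v0 => /eqP a0.
have := bad0 y0 y0b; rewrite a0 /dotp big1 => [/esym/eqP|j _]; last by rewrite mxE mul0r.
by rewrite oppr_eq0 => /eqP s0; rewrite vE s0 a0 trmx0; apply/eqP/matrixP => i j; rewrite !mxE; case: splitP => j' _; rewrite !mxE ?mul0rn.
Qed.

End BlockingHyperplane.

(** * Strategies played in stages *)

Section Game.
Variables (R : realType) (m : nat).
Hypothesis m0 : (0 < m)%N.
Local Notation ball := (eball R m).

(** The strip is centred at the middle of the ball, which forces Bob to halve the radius: idle turns
    cannot go on for ever. *)
Definition idle_move (beta : R) (B : ball) : alice_move R m :=
  ([set x | dotp (delta_mx 0 (Ordinal m0)) x = dotp (delta_mx 0 (Ordinal m0)) (Defs.center B)],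
   beta * Defs.radius B).

Lemma idle_legal (beta : R) (B : ball) : 0 < beta -> 0 < Defs.radius B ->
  alice_legal beta B (idle_move beta B).
Proof.
move=> b0 r0; split=> //=; last by rewrite mulr_gt0.
exists (delta_mx 0 (Ordinal m0)), (dotp (delta_mx 0 (Ordinal m0)) (Defs.center B)); split=> //.
by apply/eqP => /matrixP/(_ 0 (Ordinal m0)); rewrite !mxE !eqxx => /eqP; rewrite oner_eq0.
Qed.

Lemma dotp_delta (x : 'rV[R]_m) : dotp (delta_mx 0 (Ordinal m0)) x = x 0 (Ordinal m0).
Proof.
rewrite /dotp (bigD1 (Ordinal m0))//= big1 ?addr0 => [|j jn]; first by rewrite mxE !eqxx mul1r.
by rewrite mxE (negbTE jn) andbF mul0r.
Qed.

Lemma enorm_delta : enorm (delta_mx 0 (Ordinal m0) : 'rV[R]_m) = 1.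
Proof.
have : enorm (delta_mx 0 (Ordinal m0) : 'rV[R]_m) ^+ 2 = 1.
  by rewrite -dotp_enorm dotp_delta mxE !eqxx.
by move=> /eqP; rewrite sqrf_eq1 => /orP[/eqP //|/eqP h]; have := enorm_ge0 (delta_mx 0 (Ordinal m0) : 'rV[R]_m); lra.
Qed.

Lemma dotpC (a x : 'rV[R]_m) : dotp a x = dotp x a.
Proof. by apply: eq_bigr => j _; rewrite mulrC. Qed.

Lemma dotp_le (a x : 'rV[R]_m) : dotp a x <= enorm a * enorm x.
Proof.
have := dotp_enorm (enorm x *: a - enorm a *: x).
rewrite dotpDr -scaleNr !dotpZr !(dotpC _ a) !(dotpC _ x) !dotpDr !dotpZr (dotpC x a) !dotp_enorm.
set p := enorm a; set q := enorm x; set r := dotp a x => E.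
have : 0 <= enorm (q *: a + (- p) *: x) ^+ 2 by exact: sqr_ge0.
rewrite -E => {E} h; have p0 : 0 <= p := enorm_ge0 a; have q0 : 0 <= q := enorm_ge0 x.
have [p00|pp] := eqVneq p 0.
  by rewrite /r (enorm_eq0 p00) p00 mul0r /dotp big1// => j _; rewrite mxE mul0r.
have [q00|qq] := eqVneq q 0.
  by rewrite /r (enorm_eq0 q00) q00 mulr0 /dotp big1// => j _; rewrite mxE mulr0.
have pq : 0 < 2 * (p * q) by rewrite !mulr_gt0// lt_def ?pp ?qq.
rewrite -subr_ge0 -(pmulr_rge0 _ pq).
apply: le_trans h _; rewrite le_eqVlt; apply/orP; left; apply/eqP; ring.
Qed.

Lemma enormD (u v : 'rV[R]_m) : enorm (u + v) <= enorm u + enorm v.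
Proof.
rewrite -ler_sqr ?nnegrE ?addr_ge0 ?enorm_ge0// -dotp_enorm dotpDr !(dotpC (u + v)) !dotpDr.
rewrite !dotp_enorm (dotpC v u); have := dotp_le u v.
by rewrite sqrrD mulr2n; lra.
Qed.

(* A ball avoiding a hyperplane through the centre lies on one side of it. *)
Lemma idle_halves (beta : R) (B B' : ball) : 0 < beta -> 0 < Defs.radius B ->
  bob_legal beta B (idle_move beta B) B' -> Defs.radius B' <= Defs.radius B / 2.
Proof.
move=> b0 r0 [sub br]; pose e : 'rV[R]_m := delta_mx 0 (Ordinal m0).
have r'0 : 0 < Defs.radius B' by apply: lt_le_trans br; rewrite mulr_gt0.
pose t := (Defs.center B' - Defs.center B) 0 (Ordinal m0).
have inB' (s : R) : `|s| <= Defs.radius B' -> ball_set B' (Defs.center B' + s *: e).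
  by move=> sr; rewrite /ball_set /= addrAC subrr add0r enormZ enorm_delta mulr1.
have bd (s : R) : `|s| <= Defs.radius B' -> `|t + s| <= Defs.radius B.
  move=> sr; have [/= h _] := sub _ (inB' s sr).
  apply: le_trans h; apply: le_trans (norm_le_enorm _).
  apply: le_trans (ler_entry_norm _ 0 (Ordinal m0)).
  by rewrite /t !mxE !eqxx mulr1 addrAC.
have tr : Defs.radius B' < `|t|.
  rewrite ltNge; apply/negP => tr.
  have tr' : `|- t| <= Defs.radius B' by rewrite normrN.
  have [/= _] := sub _ (inB' (- t) tr'); apply.
  apply: (@le_lt_trans _ _ 0); last by rewrite mulr_gt0.
  have Lp : (idle_move beta B).1 (Defs.center B' + (- t) *: e).
    by rewrite /= !dotp_delta !mxE !eqxx mulr1 /t !mxE; ring.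
  apply: le_trans (edist_le _ Lp) _.
  by rewrite subrr -(scale0r 0) enormZ normr0 mul0r.
have h1 := bd (Defs.radius B'); have h2 := bd (- Defs.radius B').
rewrite normrN (ger0_norm (ltW r'0)) lexx in h1 h2.
have {}h1 := h1 isT; have {}h2 := h2 isT.
have [t0|t0] := leP 0 t.
  by rewrite ger0_norm// in tr; rewrite ger0_norm in h1; lra.
by rewrite ltr0_norm// in tr; rewrite ltr0_norm in h2; lra.
Qed.

Lemma ball_set_closed (B : ball) : closed (ball_set B).
Proof.
have -> : ball_set B = (fun x : 'rV[R]_m => enorm (x - Defs.center B)) @^-1` [set y | y <= Defs.radius B] by [].
apply: closed_comp => [x _|]; last exact: closed_le.
apply: (@lipschitz_continuous _ _ _ _ m%:R) => {}x y.
have tri (u v : 'rV[R]_m) : enorm u <= enorm v + m%:R * `|u - v|.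
  rewrite -{1}[u](subrK v) addrC; apply: le_trans (enormD _ _) _.
  by rewrite lerD2l enorm_le_norm.
rewrite ler_norml; apply/andP; split.
  by have := tri (y - Defs.center B) (x - Defs.center B); rewrite opprB addrA subrK distrC; lra.
by have := tri (x - Defs.center B) (y - Defs.center B); rewrite opprB addrA subrK; lra.
Qed.

Lemma ball_set_compact (B : ball) : compact (ball_set B).
Proof.
apply: bounded_closed_compact; last exact: ball_set_closed.
exists (`|Defs.center B| + Defs.radius B); split; first exact: num_real.
move=> M BM x /= xB; apply: (le_trans _ (ltW BM)).
rewrite -[x](subrK (Defs.center B)) addrC; apply: le_trans (ler_normD _ _) _.
by rewrite lerD2l; exact: le_trans (norm_le_enorm _) xB.
Qed.

(* In state [i] and at the ball [B] Alice plays [mv i B] as soon as the radius of [B] is at most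
   [r i], and she moves to the state [i.+1]; otherwise she plays an idle move. *)
Section Strategy.
Variables (beta : R) (W S : set 'rV[R]_m).
Variables (Inv : nat -> ball -> Prop) (i0 : nat) (r : nat -> R) (mv : nat -> ball -> alice_move R m).
Hypothesis b0 : 0 < beta.

Definition next_stage (i : nat) (B : ball) : nat := if Defs.radius B <= r i then i.+1 else i.

(** A strategy sees only the history, so the current state is recomputed from all balls but the
    last; [(0, 0)] is a dummy for the empty history. *)
Definition stage_strategy (h : seq ball) : alice_move R m :=
  let B := last (0, 0) h in
  let i := foldl next_stage i0 (take (size h).-1 h) in
  if Defs.radius B <= r i then mv i B else idle_move beta B.

Fixpoint stage (B : nat -> ball) (k : nat) : nat :=
  if k is k'.+1 then next_stage (stage B k') (B k') else i0.

Lemma stage_strategyE (B : nat -> ball) k : stage_strategy (mkseq B k.+1) =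
  if Defs.radius (B k) <= r (stage B k) then mv (stage B k) (B k) else idle_move beta (B k).
Proof.
rewrite /stage_strategy mkseqS size_rcons last_rcons /= -cats1 take_size_cat ?size_mkseq//.
suff -> : foldl next_stage i0 (mkseq B k) = stage B k by [].
by elim: k => [//|k IH]; rewrite mkseqS foldl_rcons IH.
Qed.

(** Compactness of the nested balls provides the outcome x, and every state is reached because idle
    turns halve the radius. Membership in S thus only has to be deduced from one ball per state. *)
Lemma stage_strategy_wins (B0 : ball) : (forall i, 0 < r i) -> bob_start W B0 -> Inv i0 B0 ->
  (forall i B, Inv i B -> 0 < Defs.radius B -> Defs.radius B <= r i ->
     alice_legal beta B (mv i B) /\
     forall B', bob_legal beta B (mv i B) B' -> Inv i.+1 B') ->
  (forall i B B', Inv i B -> r i < Defs.radius B -> ball_set B' `<=` ball_set B ->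
     beta * Defs.radius B <= Defs.radius B' -> Inv i B') ->
  (forall x, W x -> (forall i, (i0 <= i)%N -> exists2 B, Inv i B & ball_set B x) -> S x) ->
  forall B : nat -> ball, B 0%N = B0 ->
    let A := fun i => stage_strategy (mkseq B i.+1) in
    (forall k, (forall i, (i < k)%N -> bob_legal beta (B i) (A i) (B i.+1)) ->
       alice_legal beta (B k) (A k)) /\
    ((forall i, bob_legal beta (B i) (A i) (B i.+1)) ->
       (\bigcap_i ball_set (B i)) `&` S !=set0).
Proof.
move=> rpos [rB0 subW] Inv0 active idle conclusion B BB0 A.
have AE i : A i = if Defs.radius (B i) <= r (stage B i) then mv (stage B i) (B i)
    else idle_move beta (B i) by exact: stage_strategyE.
have inv k : (forall i, (i < k)%N -> bob_legal beta (B i) (A i) (B i.+1)) ->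
    Inv (stage B k) (B k) /\ 0 < Defs.radius (B k).
  elim: k => [_|k IH leg]; first by rewrite BB0.
  have [Ik rk] := IH (fun i ik => leg i (ltnW ik)).
  have lk := leg k (ltnSn k); have [sub br] := lk.
  split; last by apply: lt_le_trans br; rewrite mulr_gt0.
  rewrite /= /next_stage; rewrite AE in lk.
  case: leP lk => [le lk|lt lk]; first by have [_] := active _ _ Ik rk le; apply.
  by apply: idle lt _ br => // x /sub [].
split=> [k leg|leg].
  have [Ik rk] := inv k leg; rewrite AE; case: leP => [le|lt]; last exact: idle_legal.
  by have [] := active _ _ Ik rk le.
have {}inv k : Inv (stage B k) (B k) /\ 0 < Defs.radius (B k) by apply: inv => i _; exact: leg.
have sub i j : (i <= j)%N -> ball_set (B j) `<=` ball_set (B i).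
  move=> /subnK <-; elim: (j - i)%N => [|d IH]; first by rewrite add0n.
  by rewrite addSn; move=> x xB; apply: IH; have [s _] := leg (d + i)%N; have [] := s _ xB.
(* If the state never changed, all later turns would be idle and the radius would fall below the
   threshold. *)
have progress i : (i0 <= i)%N -> exists k, stage B k = i.
  move=> /subnK <-; elim: (i - i0)%N => [|d [k kE]]; first by exists 0%N.
  have [[p [kp rp]]|np] := EM (exists p, stage B (k + p) = (d + i0)%N /\ Defs.radius (B (k + p)%N) <= r (d + i0)%N).
    by exists (k + p).+1; rewrite /= /next_stage kp rp.
  have stay p : stage B (k + p) = (d + i0)%N /\ Defs.radius (B (k + p)%N) <= Defs.radius (B k) / 2 ^+ p.
    elim: p => [|p [sp rp]]; first by rewrite addn0 kE expr0 divr1.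
    have big : r (d + i0)%N < Defs.radius (B (k + p)%N).
      by rewrite ltNge; apply/negP => h; apply: np; exists p.
    rewrite addnS /= /next_stage sp leNgt big /=; split=> //.
    have lk := leg (k + p)%N; rewrite AE sp leNgt big /= in lk.
    have [_ rkp] := inv (k + p)%N.
    apply: le_trans (idle_halves b0 rkp lk) _.
    by rewrite exprSr invfM mulrA ler_pM2r.
  have [_ rk] := inv k.
  have [p hp] : exists p, Defs.radius (B k) / 2 ^+ p <= r (d + i0)%N.
    have : (fun p => Defs.radius (B k) * 2^-1 ^+ p) @ \oo --> (Defs.radius (B k) * 0 : R).
      by apply: cvgM; [exact: cvg_cst|apply: cvg_expr; rewrite ger0_norm//; lra].
    rewrite mulr0 => /cvgrPdist_lt/(_ _ (rpos (d + i0)%N)) [p _ hp].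
    exists p; have := hp p (leqnn p); rewrite /= sub0r normrN exprVn => /ltW.
    by apply: le_trans; rewrite ler_norm.
  have [sp rp] := stay p; exfalso; apply: np; exists p; split=> //; exact: le_trans rp hp.
have [x xB] : (\bigcap_i ball_set (B i)) !=set0.
  pose F := (fun k => Defs.center (B k)) @ \oo.
  have PF : ProperFilter F by exact: fmap_proper_filter.
  have cB k : ball_set (B k) (Defs.center (B k)).
    have [_ rk] := inv k; rewrite /ball_set /= subrr -(scale0r 0) enormZ normr0 mul0r; exact: ltW.
  have FB k : F (ball_set (B k)).
    by exists k => // j /= kj; apply: (sub k j kj); exact: cB.
  have [x [xB0 xF]] := @ball_set_compact (B 0%N) F PF (FB 0%N).
  exists x => k _; apply: (@ball_set_closed (B k)).
  by move=> V nV; apply: xF.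
exists x; split=> //; apply: conclusion; first by apply: subW; rewrite -BB0; apply: xB.
move=> i ii0; have [k kE] := progress i ii0; exists (B k); last exact: xB.
by have [] := inv k; rewrite kE.
Qed.

End Strategy.

(** Invariant, first state and thresholds may depend on Bob's opening ball; the strategy reads it
    off as the head of the history. *)
Lemma beta_HAW_of_stages (beta : R) (W S : set 'rV[R]_m) : 0 < beta -> S `<=` W ->
  (forall B0, bob_start W B0 -> exists (Inv : nat -> ball -> Prop) (i0 : nat) (r : nat -> R),
    [/\ forall i, 0 < r i, Inv i0 B0,
     forall i B, Inv i B -> 0 < Defs.radius B -> Defs.radius B <= r i ->
       exists A, alice_legal beta B A /\ forall B', bob_legal beta B A B' -> Inv i.+1 B',
     forall i B B', Inv i B -> r i < Defs.radius B -> ball_set B' `<=` ball_set B ->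
       beta * Defs.radius B <= Defs.radius B' -> Inv i B' &
     forall x, W x -> (forall i, (i0 <= i)%N -> exists2 B, Inv i B & ball_set B x) -> S x]) ->
  beta_HAW beta W S.
Proof.
move=> b0 SW H; split=> //.
pose wins (B0 : ball) (sigma : seq ball -> alice_move R m) := forall B : nat -> ball, B 0%N = B0 ->
    let A := fun i => sigma (mkseq B i.+1) in
    (forall k, (forall i, (i < k)%N -> bob_legal beta (B i) (A i) (B i.+1)) ->
       alice_legal beta (B k) (A k)) /\
    ((forall i, bob_legal beta (B i) (A i) (B i.+1)) ->
       (\bigcap_i ball_set (B i)) `&` S !=set0).
have each B0 : exists sigma, bob_start W B0 -> wins B0 sigma.
  have [sB0|nB0] := EM (bob_start W B0); last by exists (fun _ => idle_move beta B0).
  have [Inv [i0 [r [rpos Inv0 active idle conc]]]] := H B0 sB0.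
  have mvE (p : nat * ball) : exists A, Inv p.1 p.2 -> 0 < Defs.radius p.2 -> Defs.radius p.2 <= r p.1 ->
      alice_legal beta p.2 A /\ forall B', bob_legal beta p.2 A B' -> Inv p.1.+1 B'.
    have [[h1 [h2 h3]]|h] := EM (Inv p.1 p.2 /\ 0 < Defs.radius p.2 /\ Defs.radius p.2 <= r p.1).
      by have [A hA] := active _ _ h1 h2 h3; exists A.
    by exists (idle_move beta B0) => h1 h2 h3; case: h.
  have [mv mvP] := choice mvE.
  exists (stage_strategy beta i0 r (fun i B => mv (i, B))) => _.
  apply: (@stage_strategy_wins beta W S Inv i0 r) => // i B; exact: (mvP (i, B)).
have [sig sigP] := choice each.
exists (fun h => sig (head (0, 0) h) h) => B sB A.
have := sigP (B 0%N) sB B erefl.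
have -> // : (fun i => sig (B 0%N) (mkseq B i.+1)) = A by apply/funext => i.
Qed.

End Game.

(** * C^1 charts *)

Section CompactUniformity.
Variables (R : realType) (V W : normedModType R).

Lemma compact_norm_bound (K : set V) (f : V -> W) : compact K ->
  (forall x, K x -> {for x, continuous f}) -> exists2 C : R, 1 <= C & forall x, K x -> `|f x| <= C.
Proof.
move=> cK fc.
have : compact (f @` K).
  apply: continuous_compact => //; apply: continuous_in_subspaceT => x.
  by rewrite inE; exact: fc.
move=> /compact_bounded [M [_ HM]].
exists (`|M| + 1) => [|x Kx]; first by rewrite lerDr.
apply: HM; last by exists x.
by rewrite (le_lt_trans (ler_norm M))// ltrDl.
Qed.

Lemma compact_unif_continuous (K : set V) (f : V -> W) (e : R) : compact K -> 0 < e ->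
  (forall x, K x -> {for x, continuous f}) ->
  exists2 d : R, 0 < d & forall x y, K x -> K y -> `|x - y| < d -> `|f x - f y| < e.
Proof.
move=> /compact_near_coveringP cK e0 fc.
pose P (d : R) (x : V) := forall y, K y -> `|x - y| < d -> `|f x - f y| < e.
have : \forall d \near 0^'+, K `<=` P d.
  apply: cK => x Kx.
  have := fc x Kx; move=> /cvgrPdist_lt/(_ (e / 2) (divr_gt0 e0 (ltr0Sn _ 1))).
  rewrite nearE => /nbhs_normP[r /= r0 fr].
  have r20 : 0 < r / 2 by rewrite divr_gt0.
  exists (ball x (r / 2), [set d | d < r / 2]) => /=.
    split; first exact: nbhsx_ballx.
    by apply: nbhs_right_lt.
  move=> [z d] /= [xz dr] y Ky zy; rewrite -ball_normE /= in xz.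
  have fz : `|f x - f z| < e / 2 by apply: fr => /=; lra.
  have fy : `|f x - f y| < e / 2.
    apply: fr => /=; rewrite -[x - y](subrKA z); apply: le_lt_trans (ler_normD _ _) _; lra.
  rewrite -(subrKA (f x)); apply: le_lt_trans (ler_normD _ _) _; rewrite distrC; lra.
move=> h; have /filter_ex[d [d0 hd]] : \forall d \near (0 : R)^'+, 0 < d /\ K `<=` P d.
  by near=> d; split; near: d; [exact: nbhs_right_gt|exact: h].
by exists d => // x y Kx Ky; apply: hd.
Unshelve. all: by end_near. Qed.

End CompactUniformity.

Section ChartEstimates.
Variables (R : realType) (m n : nat) (W : set 'rV[R]_m) (psi : 'rV[R]_m -> 'M[R]_n).
Hypothesis psiC1 : C1_on W psi.
Variable K : set 'rV[R]_m.
Hypotheses (KW : K `<=` W) (cK : compact K).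
Hypothesis convK : forall x y (s : R), K x -> K y -> 0 <= s -> s <= 1 -> K (x + s *: (y - x)).

Lemma diff_row_sum (x v : 'rV[R]_m) : W x ->
  'd psi x v = \sum_j v 0 j *: 'd psi x (delta_mx 0 j).
Proof.
move=> Wx; rewrite {1}[v]row_sum_delta linear_sum; apply: eq_bigr => j _.
by rewrite linearZ.
Qed.

(** The mean value theorem is applied to one entry at a time; the intermediate point depends on the
    entry. *)
Lemma entry_mean_value (x y : 'rV[R]_m) k l : K x -> K y ->
  exists2 s : R, 0 <= s <= 1 &
    (psi y - psi x) k l = ('d psi (x + s *: (y - x)) (y - x)) k l.
Proof.
move=> Kx Ky; set v := y - x; pose G (s : R) := psi (x + s *: v) k l.
have dG (s : R) : 0 <= s -> s <= 1 -> is_derive s 1 G (('d psi (x + s *: v) v) k l).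
  move=> s0 s1; set z := x + s *: v.
  have [dz _] := psiC1 (KW (convK Kx Ky s0 s1)); rewrite -/v -/z in dz.
  have := @diff_derivable _ _ _ psi z v dz; rewrite /derivable => /cvg_ex[D HD].
  have DE : D = 'd psi z v.
    by rewrite -deriveE// /derive; apply/esym/cvg_lim.
  have HG : (fun h => h^-1 *: ((G \o shift s) (h *: 1) - G s)) @ 0^' --> (D k l : R).
    have := cvg_comp _ _ HD (@coord_continuous R _ _ k l D).
    apply: cvg_trans; apply: near_eq_cvg; near=> h => /=.
    have E : x + (h *: 1 + s) *: v = h *: v + z by rewrite /z scalerDl [h *: 1]mulr1 addrCA.
    by rewrite !mxE /G /shift /= E.
  apply: DeriveDef; first by rewrite /derivable; apply/cvg_ex; exists (D k l).
  by rewrite /derive -DE; apply/cvg_lim.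
have [||s sI E] := @MVT R G (fun s => ('d psi (x + s *: v) v) k l) 0 1 ltr01.
- by move=> s; rewrite in_itv /= => /andP[s0 s1]; apply: dG; exact: ltW.
- apply: continuous_in_subspaceT => s; rewrite inE /= in_itv /= => /andP[s0 s1].
  by have [dGs _] := dG s s0 s1; apply: differentiable_continuous; exact/derivable1_diffP.
exists s; first by move: sI; rewrite in_itv /= => /andP[/ltW -> /ltW ->].
move: E; rewrite subr0 mulr1 => <-.
by rewrite /G scale1r scale0r addr0 /v [x + (y - x)]addrC subrK !mxE.
Unshelve. all: by end_near. Qed.

Lemma chart_lipschitz : exists2 C : R, 1 <= C &
  forall x y, K x -> K y -> `|psi y - psi x| <= C * `|y - x|.
Proof.
have Hj (j : 'I_m) : exists C : R, forall x, K x -> `|'d psi x (delta_mx 0 j)| <= C.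
  have [|C _ HC] := @compact_norm_bound R _ _ K (fun x => 'd psi x (delta_mx 0 j)) cK.
    by move=> x Kx; have [_] := psiC1 (KW Kx); apply.
  by exists C.
have [C HC] := choice Hj.
pose D := 1 + \sum_j `|C j|; have D1 : 1 <= D by rewrite lerDl sumr_ge0.
exists D => // x y Kx Ky; apply: norm_mx_le => [|k l]; first by rewrite mulr_ge0//; lra.
have [s /andP[s0 s1] ->] := entry_mean_value k l Kx Ky.
set z := x + _; have Kz : K z by exact: convK.
rewrite diff_row_sum; last exact: KW.
apply: le_trans (ler_entry_norm _ _ _) _; apply: le_trans (ler_norm_sum _ _ _) _.
apply: (@le_trans _ _ (\sum_j `|C j| * `|y - x|)).
  apply: ler_sum => j _; rewrite mx_normZ mulrC ler_pM ?ler_entry_norm//.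
  by apply: le_trans (HC j z Kz) _; exact: ler_norm.
by rewrite -mulr_suml ler_wpM2r// lerDr.
Qed.

Lemma chart_linearization (eta : R) : 0 < eta -> exists2 d : R, 0 < d &
  forall x y, K x -> K y -> `|y - x| < d ->
    `|psi y - psi x - 'd psi x (y - x)| <= eta * `|y - x|.
Proof.
move=> eta0; pose e := eta / m.+1%:R; have e0 : 0 < e by rewrite divr_gt0 ?ltr0Sn.
have Hj (j : 'I_m) : exists d : R, 0 < d /\ forall x y, K x -> K y -> `|x - y| < d ->
    `|'d psi x (delta_mx 0 j) - 'd psi y (delta_mx 0 j)| < e.
  have [|d d0 Hd] := @compact_unif_continuous R _ _ K (fun x => 'd psi x (delta_mx 0 j)) e cK e0.
    by move=> x Kx; have [_] := psiC1 (KW Kx); apply.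
  by exists d.
have [d Hd] := choice Hj.
pose D := \big[Num.min/1]_j d j.
have D0 : 0 < D.
  rewrite /D; elim/big_ind : _ => // [p q p0 q0|j _]; first by rewrite lt_min p0.
  by have [] := Hd j.
exists D => // x y Kx Ky xyD; apply: norm_mx_le => [|k l]; first by rewrite mulr_ge0// ltW.
have [z [Kz xz E]] : exists z, [/\ K z, `|z - x| < D &
    (psi y - psi x) k l = ('d psi z (y - x)) k l].
  have [s /andP[s0 s1] E] := entry_mean_value k l Kx Ky.
  exists (x + s *: (y - x)); split=> //; first exact: convK.
  rewrite addrAC subrr add0r mx_normZ ger0_norm//; apply: le_lt_trans xyD.
  by rewrite ler_piMl.
have -> : (psi y - psi x - 'd psi x (y - x)) k l = ('d psi z (y - x) - 'd psi x (y - x)) k l.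
  by rewrite [LHS]mxE E [RHS]mxE.
have -> : 'd psi z (y - x) - 'd psi x (y - x) =
    \sum_j (y - x) 0 j *: ('d psi z (delta_mx 0 j) - 'd psi x (delta_mx 0 j)).
  have dz := diff_row_sum (y - x) (KW Kz); have dx := diff_row_sum (y - x) (KW Kx).
  apply: (etrans (congr2 (fun p q => p - q) dz dx)).
  by rewrite -sumrB; apply: eq_bigr => j _; rewrite scalerBr.
apply: le_trans (ler_entry_norm _ _ _) _; apply: le_trans (ler_norm_sum _ _ _) _.
apply: (@le_trans _ _ (\sum_(j < m) e * `|y - x|)).
  apply: ler_sum => j _; rewrite mx_normZ mulrC ler_pM ?ler_entry_norm//.
  have [_ Hdj] := Hd j; apply: ltW; apply: Hdj => //.
  apply: lt_le_trans xz _; exact: bigmin_le.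
rewrite sumr_const card_ord -mulrnAl ler_wpM2r// /e -mulr_natr -mulrA ler_piMr ?(ltW eta0)//.
by rewrite mulrC ler_pdivrMr ?ltr0Sn// mul1r ler_nat.
Qed.

End ChartEstimates.

Section ChartSubmersion.
Variables (R : realType) (m n : nat) (nil : 'M[R]_n -> Prop).
Hypothesis nilZ : forall k X, nil X -> nil (k *: X).
Hypothesis nilD : forall X Y, nil X -> nil Y -> nil (X + Y).
Variables (U : set 'M[R]_n) (phi : 'M[R]_n -> 'rV[R]_m).
Hypothesis chart : C1_chart [set A | nil (A - 1%:M)] U phi.

(** As [nil] is stable under sums and multiples, the line psi y + hX stays in the manifold, where
    psi inverts phi; hence xi = dphi(X) is sent to X by dpsi. Compactness bounds dphi uniformly. *)
Lemma chart_inverse : exists psi : 'rV[R]_m -> 'M[R]_n,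
  [/\ C1_on (phi @` U) psi,
      forall y, (phi @` U) y -> U (psi y) /\ phi (psi y) = y,
      forall y, (phi @` U) y -> nil (psi y - 1%:M) &
      forall K, compact K -> K `<=` phi @` U -> exists2 C : R, 1 <= C &
        forall y X, K y -> nil X -> exists2 xi, `|xi| <= C * `|X| & 'd psi y xi = X].
Proof.
have [[V [oV UV Cphi]] oW [psi [psiK Cpsi]]] := chart.
have inv y : (phi @` U) y -> U (psi y) /\ phi (psi y) = y by move=> [p Up <-]; rewrite psiK.
exists psi; split=> // [y Wy|K cK KW].
  by have [Upsi _] := inv y Wy; move: Upsi; rewrite UV => -[].
have psicont y : K y -> {for y, continuous psi}.
  by move=> Ky; have [dy _] := Cpsi y (KW y Ky); exact: differentiable_continuous.
have Hkl (k l : 'I_n) : exists C : R, forall y, K y -> `|'d phi (psi y) (delta_mx k l)| <= C.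
  have [|C _ HC] := @compact_norm_bound R _ _ K (fun y => 'd phi (psi y) (delta_mx k l)) cK.
    move=> y Ky; have [Uy _] := inv y (KW y Ky).
    have Vy : V (psi y) by move: Uy; rewrite UV => -[].
    have [_ Hc] := Cphi _ Vy.
    apply: (@continuous_comp _ _ _ psi (fun p => 'd phi p (delta_mx k l))); first exact: psicont.
    exact: Hc.
  by exists C.
have [C HC] := choice (fun p : 'I_n * 'I_n => Hkl p.1 p.2).
pose D := 1 + \sum_p `|C p|; have D1 : 1 <= D by rewrite lerDl sumr_ge0.
exists D => // y X Ky nX; exists ('d phi (psi y) X).
  rewrite {1}[X]matrix_sum_delta pair_big /= linear_sum; apply: le_trans (ler_norm_sum _ _ _) _.
  apply: (@le_trans _ _ (\sum_p `|C p| * `|X|)).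
    apply: ler_sum => p _; rewrite linearZ mx_normZ mulrC ler_pM ?ler_entry_norm//.
    by apply: le_trans (HC p y Ky) _; exact: ler_norm.
  by rewrite -mulr_suml ler_wpM2r// lerDr.
have [Uy phiy] := inv y (KW y Ky).
have [Ny Vy] : nil (psi y - 1%:M) /\ V (psi y) by move: Uy; rewrite UV => -[].
have [dphi _] := Cphi _ Vy.
have [dpsi _] := Cpsi y (KW y Ky).
have dpsi' : differentiable psi (phi (psi y)) by rewrite phiy.
have -> : 'd psi y ('d phi (psi y) X) = 'd (psi \o phi) (psi y) X.
  have := congr1 (fun f => f X) (diff_comp dphi dpsi') => /= ->.
  by rewrite phiy.
rewrite -deriveE; last exact: differentiable_comp.
(* The difference quotient is constant for small h, as long as the line stays in the open set V. *)
rewrite /derive; apply/cvg_lim => //; apply: cvg_near_cst.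
have nV : \forall h \near (0 : R), V (h *: X + psi y).
  have cs : {for (0 : R), continuous (fun h : R => h *: X + psi y)}.
    apply: cvgD; last exact: cvg_cst.
    by apply: cvgZr_tmp; exact: cvg_id.
  apply: (cs V); rewrite scale0r add0r; exact: open_nbhs_nbhs.
have nV' : \forall h \near (0 : R)^', V (h *: X + psi y).
  by rewrite near_withinE; apply: filterS nV => h Vh _.
near=> h; have h0 : h != 0 by near: h; exact: nbhs_dnbhs_neq.
have Vh : V (h *: X + psi y) by near: h; exact: nV'.
rewrite /shift /= !psiK//; last first.
  by rewrite UV; split=> //=; rewrite -addrA; apply: nilD => //; exact: nilZ.
by rewrite addrK scalerA mulVf// scale1r.
Unshelve. all: by end_near. Qed.

End ChartSubmersion.

(** * Dangerous vectors and their dual obstructions *)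

(* Wrapped in a definition to keep this large power out of the sight of [lra] and [nra]. *)
Definition dominates (R : realType) (C a : R) : Prop := C ^+ 60 <= a.

Lemma le_of_eq (R : realType) (x y : R) : x = y -> x <= y. Proof. by move=> ->. Qed.
Lemma le_trans_eq (R : realType) (x y z : R) : y = z -> x <= y -> x <= z. Proof. by move=> ->. Qed.
Lemma le_trans_eq2 (R : realType) (x y z t : R) : x = z -> y = t -> x <= y -> z <= t.
Proof. by move=> -> ->. Qed.

Lemma leq_mul5 (J k : nat) : (20 <= J)%N -> (k <= 20)%N -> (k <= 5 * J)%N. Proof. by lia. Qed.
Lemma generation_le_arith (N t : nat) : (3 + N <= 1 + t)%N -> (N <= t)%N. Proof. by lia. Qed.
Lemma generation_gap_arith (N t J : nat) : (20 <= J)%N -> (N <= t)%N -> ~ (t + 10 * J < 2 * N + 10)%N ->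
  (N + 5 <= t + 5 * J)%N /\ (N + 5 - 5 * J <= t + 5 * J - (N + 5))%N.
Proof. by lia. Qed.
Lemma small_delay_arith (i j t J : nat) : (20 <= J)%N -> (i + j <= t)%N -> (j < 2 * J)%N ->
  (t + 10 * J < 2 * (i + j) + 10)%N -> (2 * (4 + j) <= t)%N /\ (4 + j <= 5 * J)%N.
Proof. by lia. Qed.
Lemma checkpoint_exponent (i j : nat) : (3 + (i + j).+1 = 4 + j + i)%N. Proof. by lia. Qed.

(* [delay n J k] checkpoints before its own generation, Alice starts to fight an obstruction
   whose generation precedes the dangerous time by [k]. *)
Definition lag (n : nat) : nat := 2 * (n.+1 * (10 * n * n + 6 * n + 11)).

(** The bracket is the power of Q that [minors_eq0] has to beat, and the factor n + 1 comes from Q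
    <= a^(n+1). Since 4j <= k, the available exponent k - 2j is at least k/2, whence the factor 2 in
    [lag]. *)
Lemma large_delay_arith (n J j k : nat) : (1 <= J)%N -> (4 * j <= k)%N -> (lag n * J <= k)%N ->
  (2 * j <= k)%N /\ (n.+1 * (9 + (5 * J * n + 1) * (2 * n) + (4 * n + 1)).+1 <= k - 2 * j)%N.
Proof.
rewrite /lag => J1 jk hk; split; first by lia.
have h : ((9 + (5 * J * n + 1) * (2 * n) + (4 * n + 1)).+1 <= (10 * n * n + 6 * n + 11) * J)%N.
  have -> : ((9 + (5 * J * n + 1) * (2 * n) + (4 * n + 1)).+1 = 10 * n * n * J + (6 * n + 11))%N by lia.
  by rewrite -addnA mulnDl leq_add2l leq_pmulr.
have h2 : (n.+1 * (9 + (5 * J * n + 1) * (2 * n) + (4 * n + 1)).+1 <= n.+1 * ((10 * n * n + 6 * n + 11) * J))%N.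
  by rewrite leq_mul2l h orbT.
apply: leq_trans h2 _; rewrite mulnA.
by move: hk; rewrite -mulnA; set x := muln _ J; lia.
Qed.

Definition delay (n J k : nat) : nat := J + k %/ lag n.

(** With t = N + k the hypothesis says k + 10J < i + J + k/lag + 10, where the quotient is at most
    k/22. So k is bounded linearly in i, and each stage deals with finitely many k; no pair belongs
    to a stage before J; the last clause separates the ranges of [covering_small] and
    [covering_large]. *)
Lemma delay_arith (n J i k : nat) : (20 <= J)%N ->
  (i + delay n J k + k + 10 * J < 2 * (i + delay n J k) + 10)%N ->
  [/\ (k <= 2 * (i + J))%N, (J <= i)%N & if (k < lag n * J)%N then (delay n J k < 2 * J)%N
    else (4 * delay n J k <= k)%N].
Proof.
rewrite /delay => J20; have lag22 : (22 <= lag n)%N by rewrite /lag; clear; nia.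
have l0 : (0 < lag n)%N by apply: leq_trans lag22.
have q22 : (22 * (k %/ lag n) <= k)%N.
  by apply: leq_trans (leq_trunc_div k (lag n)); rewrite mulnC leq_mul2l lag22 orbT.
move=> h; split; [by clear -J20 q22 h; lia|by clear -J20 q22 h; lia|].
case: ifPn => [kJ|]; first by rewrite mul2n -addnn ltn_add2l ltn_divLR// mulnC.
rewrite -leqNgt => kJ; have Jq : (J <= k %/ lag n)%N by rewrite leq_divRL// mulnC.
by clear -J20 q22 Jq; lia.
Qed.

(** Each power of q occurs l times once the sum is extended to M full periods. *)
Lemma geometric_steps (R : realType) (q : R) (l M : nat) : 0 <= q -> q < 1 -> (0 < l)%N ->
  \sum_(0 <= k < M) q ^+ (k %/ l) <= l%:R / (1 - q).
Proof.
move=> q0 q1 l0; have q1' : 0 < 1 - q by rewrite subr_gt0.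
have S p : \sum_(0 <= k < p * l) q ^+ (k %/ l) * (1 - q) = l%:R * (1 - q ^+ p).
  elim: p => [|p IH]; first by rewrite mul0n big_geq// expr0 subrr mulr0.
  rewrite (@big_cat_nat _ _ _ (p * l)) ?leq_mul2r ?leqnSn ?orbT//= IH.
  rewrite (eq_big_nat _ _ (F2 := fun=> q ^+ p * (1 - q))); last first.
    move=> k /andP[k1 k2]; congr (_ ^+ _ * _).
    by apply/eqP; rewrite eqn_leq leq_divRL// k1 -ltnS ltn_divLR// k2.
  by rewrite sumr_const_nat mulSn addnK -mulr_natl exprS; ring.
rewrite ler_pdivlMr// mulr_suml.
apply: (@le_trans _ _ (\sum_(0 <= k < M * l) q ^+ (k %/ l) * (1 - q))).
  rewrite [leRHS](@big_cat_nat _ _ _ M) ?leq_pmulr//= lerDl sumr_ge0// => k _.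
  by rewrite mulr_ge0 ?exprn_ge0 ?(ltW q1').
by rewrite S ler_piMr// gerBl exprn_ge0.
Qed.

Lemma type_arith (n J N t : nat) : (20 <= J)%N -> (N <= t)%N -> (t + 10 * J < 2 * N + 10)%N ->
  [/\ N - delay n J (t - N) + delay n J (t - N) = N, N + (t - N) = t &
    N + (t - N) + 10 * J < 2 * N + 10]%N.
Proof.
move=> J20 Nt h; rewrite subnKC//; split=> //; rewrite subnK// /delay.
by have := leq_div (t - N) (lag n); clear -J20 Nt h; lia.
Qed.

Lemma norm_mul11 (R : realType) q (x : 'M[R]_1) (y : 'M[R]_(1, q)) : `|x *m y| = `|x| * `|y|.
Proof.
rewrite {1}[x]mx11_scalar mul_scalar_mx mx_normZ; congr (_ * _).
apply/eqP; rewrite eq_le ler_entry_norm /=; apply: norm_mx_le => // i j.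
by rewrite !ord1.
Qed.

Section Arithmetic.
Variables (R : realType) (n : nat) (T U : nat -> 'M[R]_n).
Variables (e2 e3 : 'cV[R]_n) (f2 f3 : 'rV[R]_n) (l2 l3 a b c K : R).
Hypothesis spl : splitting T U e2 e3 f2 f3 l2 l3 a b c K.
Local Notation E := (spl_E e2 e3 f2 f3).
Local Notation unip := (unip e2 e3 f2 f3).
Local Notation V3 := (1%:M - e3 *m f3).
Variables (g0 : 'M[R]_n) (C : R) (J : nat).
Hypotheses (T0 : T 0%N = 1%:M) (det_g0 : \det g0 = 1) (det_T : forall k, \det (T k) = 1).
Hypotheses (C2 : 2 <= C) (Cn : n%:R <= C) (CK : K <= C) (Ca : dominates C a).
Hypotheses (Ce2 : `|e2| <= C) (Ce3 : `|e3| <= C) (Cf2 : `|f2| <= C) (Cf3 : `|f3| <= C).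
Hypotheses (CE : `|E| <= C) (CV : `|V3| <= C) (Cg0 : `|g0| <= C) (Cg0V : `|invmx g0| <= C).
Hypothesis short_dual : forall (g : 'M[R]_n) (k : R), \det g = 1 -> 0 < k -> k <= 1 ->
  (exists2 u : 'cV[int]_n, u != 0 & `|g *m map_mx intr u| < k ^+ n / C) ->
  exists2 w : 'rV[int]_n, w != 0 & `|map_mx intr w *m invmx g| < k.
Hypothesis minors0 : forall (g : 'M[R]_n) (e : R), \det g = 1 -> 0 < e -> e <= 1 ->
  (forall u : 'cV[int]_n, u != 0 -> e <= `|g *m map_mx intr u|) ->
  forall w1 w2 : 'rV[int]_n,
  `|minors (map_mx intr w1 *m invmx g) (map_mx intr w2 *m invmx g)| < e ^+ (2 * n) / C ->
  minors w1 w2 = 0.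
Hypothesis J20 : (20 <= J)%N.

(** The rate of the block from e3 to E, the largest on the horospherical subgroup. *)
Definition expansion : R := a * c.
Local Notation Q := expansion.
(** The exponent 5J makes Q^(4+j) times this bound at most 1 for all delays j < 2J, and yields t +
    10J < 2N + 10 for every generation N, which leaves room to register obstructions in advance. *)
Definition dual_bound : R := (Q ^+ (5 * J))^-1.
Local Notation kap := dual_bound.
(** This is [dual_bound] to the power n, divided by Q: a dangerous vector then satisfies the
    hypothesis of [short_dual], the factor Q absorbing powers of C. *)
Definition danger_bound : R := (Q ^+ (5 * J * n + 1))^-1.
Local Notation eps := danger_bound.

(** Smallness is tested on three coordinates instead of the norm, because each of them evolves at
    its own rate: one step earlier only the coordinate along f3 can have been larger. *)
Definition danger (t : nat) (h : 'M[R]_n) : Prop :=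
  exists2 u : 'cV[int]_n, u != 0 & let x := T t *m h *m g0 *m map_mx intr u in
    [/\ `|E *m x| < eps, `|f2 *m x| < eps & `|f3 *m x| < eps].

(* A dual integer vector [w], short at the dangerous time [t], certifies that [h] is close to
   the hypersurface [wbar w *m invmx h *m e3 = 0], of which [wsize w] measures the gradient. *)
Definition wbar (w : 'rV[int]_n) : 'rV[R]_n := map_mx intr w *m invmx g0.
Definition wsize (w : 'rV[int]_n) : R := `|wbar w *m V3|.

Definition admissible (h : 'M[R]_n) : Prop :=
  [/\ unip h, \det h = 1, `|h| <= C & `|invmx h| <= C].

(** What a first dangerous time t reveals about the dangerous vector u and the short dual vector w,
    pulled back from time t to time 0. The lower bound on the f3 coordinate of z records that u was
    harmless at time t - 1. *)
Definition witness (t : nat) (h : 'M[R]_n) (u : 'cV[int]_n) (w : 'rV[int]_n) : Prop :=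
  let z := h *m g0 *m map_mx intr u in
  [/\ [/\ `|E *m z| <= C ^+ 2 * eps / a ^+ t, `|f2 *m z| <= eps / b ^+ t,
       `|f3 *m z| <= eps * c ^+ t & eps * c ^+ t <= c * `|f3 *m z|],
     [/\ w != 0, `|wbar w *m E| <= C ^+ 2 * kap * a ^+ t,
       `|wbar w *m invmx h *m e2| <= C ^+ 2 * kap * b ^+ t &
       `|wbar w *m invmx h *m e3| <= C ^+ 2 * kap / c ^+ t] & u != 0 /\ (0 < t)%N].

Let C1 : 1 <= C. Proof. by apply: le_trans C2; rewrite ler1n. Qed.
Let C0 : 0 < C. Proof. exact: lt_le_trans ltr01 C1. Qed.
Let a0 : 0 < a. Proof. exact: spl_a0 spl. Qed.
Let b0 : 0 < b. Proof. exact: spl_b0 spl. Qed.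
Let c0 : 0 < c. Proof. exact: spl_c0 spl. Qed.
Let Q0 : 0 < Q. Proof. exact: mulr_gt0. Qed.
Let Ck0 k : 0 <= C ^+ k. Proof. by rewrite exprn_ge0// ltW. Qed.
Let Qk0 k : 0 <= Q ^+ k. Proof. by rewrite exprn_ge0// ltW. Qed.
Let c1 : 1 <= c. Proof. exact: ltW (spl_c1 spl). Qed.
Let a1 : 1 <= a. Proof. exact: ltW (spl_a1 spl). Qed.
Let aQ : a <= Q. Proof. by rewrite ler_peMr// ltW. Qed.
Let Q1 : 1 <= Q. Proof. exact: le_trans a1 aQ. Qed.
Let kap0 : 0 < kap. Proof. by rewrite invr_gt0 exprn_gt0. Qed.
Let eps0 : 0 < eps. Proof. by rewrite invr_gt0 exprn_gt0. Qed.
Let kap1 : kap <= 1. Proof. by rewrite invf_le1 ?exprn_gt0// exprn_ege1. Qed.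
Let eps1 : eps <= 1. Proof. by rewrite invf_le1 ?exprn_gt0// exprn_ege1. Qed.

Lemma Cpow_a k : (k <= 60)%N -> C ^+ k <= a.
Proof. by move=> k60; apply: (le_trans _ Ca); rewrite ler_weXn2l. Qed.

Lemma Cpow_Q k : (k <= 60)%N -> C ^+ k <= Q.
Proof. by move=> k60; apply: le_trans (Cpow_a k60) aQ. Qed.

Lemma mulmx_bound (p r : nat) (X : 'M[R]_(p, n)) (Y : 'M[R]_(n, r)) x y :
  `|X| <= x -> `|Y| <= y -> `|X *m Y| <= C * (x * y).
Proof.
move=> Xx Yy; apply: le_trans (norm_mulmx _ _) _; apply: ler_pM => //.
by apply: ler_pM.
Qed.

Lemma outer_bound (p r : nat) (X : 'M[R]_(p, 1)) (Y : 'M[R]_(1, r)) x y :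
  `|X| <= x -> `|Y| <= y -> `|X *m Y| <= x * y.
Proof.
move=> Xx Yy; apply: le_trans (norm_mulmx _ _) _; rewrite mul1r.
by apply: ler_pM.
Qed.

Lemma norm_decomp (p : nat) (x : 'M[R]_(n, p)) :
  `|x| <= `|E *m x| + C * `|f2 *m x| + C * `|f3 *m x|.
Proof.
rewrite {1}(spl_left e2 e3 f2 f3 x).
apply: le_trans (ler_normD _ _) _; apply: lerD; last exact: outer_bound.
by apply: le_trans (ler_normD _ _) _; apply: lerD => //; exact: outer_bound.
Qed.

Lemma small_norm (x : 'cV[R]_n) r : `|E *m x| < r -> `|f2 *m x| < r -> `|f3 *m x| < r ->
  `|x| <= C ^+ 3 * r.
Proof.
move=> h1 h2 h3; apply: le_trans (norm_decomp x) _.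
have r0 : 0 <= r by apply: le_trans (normr_ge0 _) (ltW h1).
apply: (@le_trans _ _ (r + C * r + C * r)).
  by apply: lerD; [apply: lerD|]; rewrite ?ler_wpM2l// ltW.
have : 1 + C + C <= C ^+ 3.
    have CC : 2 * C <= C * C by rewrite ler_wpM2r// ltW.
    have : 2 * (C * C) <= C * (C * C) by rewrite ler_wpM2r// mulr_ge0// ltW.
    by have := C2; rewrite !exprS expr0 mulr1; lra.
by move=> /(ler_wpM2r r0); lra.
Qed.

Lemma UEC0 i : U i *m E = E *m U i.
Proof.
rewrite -[RHS]mulmx1 -(spl_TU spl i) mulmxA -(mulmxA E) (spl_UT spl) mulmx1.
by rewrite -[in LHS](mulmx1 E) -(spl_TU spl i) (mulmxA E) -(spl_TEC spl) !mulmxA (spl_UT spl) mul1mx.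
Qed.

Lemma admissible_unit h : admissible h -> h \in unitmx.
Proof. by case=> _ dh _ _; rewrite unitmxE dh unitr1. Qed.

Lemma unit_g0 : g0 \in unitmx. Proof. by rewrite unitmxE det_g0 unitr1. Qed.

Lemma invmx_translate t h : admissible h ->
  invmx (T t *m h *m g0) = invmx g0 *m invmx h *m U t.
Proof.
move=> ah; have [_ dh _ _] := ah; have uh := admissible_unit ah; set g := T t *m h *m g0.
have ug : g \in unitmx by rewrite unitmxE !det_mulmx det_T dh det_g0 !mulr1 unitr1.
rewrite -[RHS](mulKmx ug) /g -!mulmxA (mulmxA g0) (mulmxV unit_g0) mul1mx.
by rewrite (mulmxA h) (mulmxV uh) mul1mx (spl_TU spl) mulmx1.
Qed.

Lemma not_danger0 h : admissible h -> ~ danger 0 h.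
Proof.
move=> ah; have uh := admissible_unit ah; have [_ _ Ch ChV] := ah.
move=> [u u0 [h1 h2 h3]].
have := small_norm h1 h2 h3; rewrite T0 mul1mx -mulmxA => xb.
have uE : map_mx intr u = invmx g0 *m (invmx h *m (h *m (g0 *m map_mx intr u))) :> 'cV[R]_n.
  by rewrite mulKmx// mulKmx// unit_g0.
have := norm_int_mx_ge1 R u0; rewrite uE => /le_trans/(_ (mulmx_bound Cg0V (mulmx_bound ChV xb))).
apply/negP; rewrite -ltNge.
have -> : C * (C * (C * (C * (C ^+ 3 * eps)))) = C ^+ 7 * eps by rewrite !exprS expr0; ring.
rewrite /danger_bound ltr_pdivrMr ?exprn_gt0// mul1r.
apply: (@lt_le_trans _ _ (C ^+ 8)); first by rewrite ltr_eXn2l//; have := C2; lra.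
by apply: (le_trans (Cpow_Q _)) => //; rewrite -[leLHS]expr1 ler_weXn2l// addn1.
Qed.

Lemma danger_first_gt0 t h : admissible h -> danger t h -> (0 < t)%N.
Proof. by move=> ah; case: t => // /(not_danger0 ah). Qed.

Lemma unip_inv h : admissible h -> unip (invmx h).
Proof. by move=> ah; have [uh _ _ _] := ah; exact: (unipV spl (admissible_unit ah) uh). Qed.

(** At time t - 1 the coordinates along E and f2 were still small, since a >= C^4 and b >= 1; as t
    is the first dangerous time, the one along f3 was not. The dual vector comes from transference
    and is transported back by [T t]. *)
Lemma danger_witness t h : admissible h -> danger t h ->
  (forall t', (t' < t)%N -> ~ danger t' h) -> exists u w, witness t h u w.
Proof.
move=> ah dh first; have t0 := danger_first_gt0 ah dh.
have uh := admissible_unit ah; have [uph dth Ch ChV] := ah.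
have [u u0] := dh; set z := h *m g0 *m map_mx intr u.
have xz s : T s *m h *m g0 *m map_mx intr u = T s *m z by rewrite /z !mulmxA.
rewrite xz; set x := T t *m z => -[x1 x2 x3].
have zx : z = U t *m x by rewrite /x mulmxA (spl_UT spl) mul1mx.
have at0 : 0 < a ^+ t by rewrite exprn_gt0.
have bt0 : 0 < b ^+ t by rewrite exprn_gt0.
have ct0 : 0 < c ^+ t by rewrite exprn_gt0.
have UEC s : `|U s *m E| <= C / a ^+ s.
  by apply: le_trans (spl_UE spl s) _; rewrite ler_wpM2r// invr_ge0 exprn_ge0// ltW.
have TEC s : `|T s *m E| <= C * a ^+ s.
  by apply: le_trans (spl_TE spl s) _; rewrite ler_wpM2r// exprn_ge0// ltW.
have Ez : E *m z = (U t *m E) *m (E *m x).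
  by rewrite zx -mulmxA (mulmxA E E) (spl_EE spl) mulmxA -UEC0 -mulmxA.
have f2z s : f2 *m (T s *m z) = l2 ^+ s *: (f2 *m z) by rewrite mulmxA (spl_f2T spl) scalemxAl.
have f3z s : f3 *m (T s *m z) = l3 ^+ s *: (f3 *m z) by rewrite mulmxA (spl_f3T spl) scalemxAl.
have z1 : `|E *m z| <= C ^+ 2 * eps / a ^+ t.
  rewrite Ez; apply: le_trans (mulmx_bound (UEC t) (ltW x1)) _.
  by apply: le_of_eq; ring.
have z2 : `|f2 *m z| <= eps / b ^+ t.
  rewrite ler_pdivlMr// mulrC -(spl_norm_l2 spl) -mx_normZ -f2z; exact: ltW.
have z3 : `|f3 *m z| <= eps * c ^+ t.
  rewrite -ler_pdivrMr// mulrC -(spl_norm_l3 spl) -mx_normZ -f3z; exact: ltW.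
have z4 : eps * c ^+ t <= c * `|f3 *m z|.
  rewrite leNgt; apply/negP => h3; apply: (first t.-1); first by rewrite prednK.
  exists u => //; rewrite xz; split.
  - have -> : E *m (T t.-1 *m z) = (T t.-1 *m E) *m ((U t *m E) *m (E *m x)).
      by rewrite -Ez -(mulmxA _ E) (mulmxA E E) (spl_EE spl) !mulmxA (spl_TEC spl).
    apply: le_lt_trans (mulmx_bound (TEC _) (mulmx_bound (UEC t) (lexx _))) _.
    apply: le_lt_trans x1.
    have -> : C * (C * a ^+ t.-1 * (C * (C / a ^+ t * `|E *m x|))) = C ^+ 4 / a * `|E *m x|.
      rewrite -{2}(prednK t0) !exprS expr0; field.
      by rewrite (lt0r_neq0 a0) expf_neq0// lt0r_neq0.
    by rewrite ler_piMl// ler_pdivrMr// mul1r Cpow_a.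
  - rewrite f2z mx_normZ (spl_norm_l2 spl); apply: le_lt_trans x2.
    by rewrite /x f2z mx_normZ (spl_norm_l2 spl) ler_wpM2r// ler_weXn2l// ?leq_pred// (spl_b spl).
  - rewrite f3z mx_normZ (spl_norm_l3 spl) mulrC ltr_pdivrMr ?exprn_gt0//.
    by move: h3; rewrite -{1}(prednK t0) exprS mulrCA ltr_pM2l.
pose g := T t *m h *m g0.
have dg : \det g = 1 by rewrite !det_mulmx det_T dth det_g0 !mulr1.
have gV : invmx g = invmx g0 *m invmx h *m U t := invmx_translate t ah.
have [|w w0 wk] := short_dual dg kap0 kap1.
  exists u => //; rewrite /g xz; apply: le_lt_trans (small_norm x1 x2 x3) _.
  have epsE : eps = kap ^+ n / Q.
    by rewrite /danger_bound /dual_bound exprVn -exprM addn1 exprSr invfM.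
  rewrite ltr_pdivlMr// mulrAC -exprSr epsE mulrA ltr_pdivrMr// mulrC ltr_pM2l ?exprn_gt0//.
  apply: (@lt_le_trans _ _ (C ^+ 5)); last exact: Cpow_Q.
  by rewrite ltr_eXn2l//; have := C2; lra.
set w' := _ *m invmx g in wk.
have wE : wbar w *m invmx h = w' *m T t.
  by rewrite /w' gV /wbar !mulmxA -[RHS]mulmxA (spl_UT spl) mulmx1.
have hVE : invmx h *m E = E by apply: unipE; exact: unip_inv.
exists u, w; split; [by split| |by split].
have kC : C * (kap * C) <= C ^+ 2 * kap by rewrite !exprS expr0 mulr1; apply: le_of_eq; ring.
split=> //.
- rewrite -{1}hVE mulmxA wE -mulmxA; apply: le_trans (mulmx_bound (ltW wk) (TEC t)) _.
  by apply: le_of_eq; ring.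
- rewrite wE -mulmxA (spl_Te2 spl) -scalemxAr mx_normZ (spl_norm_l2 spl) mulrC.
  rewrite ler_wpM2r ?(ltW bt0)//; apply: (le_trans _ kC); apply: mulmx_bound => //; exact: ltW.
- rewrite wE -mulmxA (spl_Te3 spl) -scalemxAr mx_normZ (spl_norm_l3 spl) mulrC.
  rewrite ler_wpM2r ?invr_ge0 ?(ltW ct0)//; apply: (le_trans _ kC); apply: mulmx_bound => //; exact: ltW.
Qed.

Lemma kap_C k : (k <= 60)%N -> C ^+ k * kap <= 1.
Proof.
move=> k60; rewrite ler_pdivrMr ?exprn_gt0// mul1r; apply: le_trans (Cpow_Q k60) _.
by rewrite -[leLHS]expr1 ler_weXn2l// leq_mul5.
Qed.

Lemma nilp_mul_e2 (x : 'rV[R]_n) D d : nilp e2 e3 f2 f3 D -> `|D| <= d ->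
  `|x *m D *m e2| <= C ^+ 3 * (`|x *m E| * d).
Proof.
move=> nD Dd; rewrite -mulmxA (nilp_e2 nD) -!mulmxA (mulmxA x).
apply: le_trans (mulmx_bound (lexx _) (mulmx_bound Dd Ce2)) _.
by apply: le_of_eq; rewrite !exprS expr0; ring.
Qed.

(** As f3 kills D, only the component of x along [V3] is seen; this is why [wsize] measures the
    gradient. *)
Lemma nilp_mul_e3 (x : 'rV[R]_n) D d : nilp e2 e3 f2 f3 D -> `|D| <= d ->
  `|x *m D *m e3| <= C ^+ 3 * (`|x *m V3| * d).
Proof.
move=> nD Dd; have -> : x *m D *m e3 = (x *m V3) *m (D *m e3).
  by rewrite mulmxBr mulmx1 mulmxBl -!mulmxA (mulmxA f3) (nilp_f3 nD) mul0mx !mulmx0 subr0.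
apply: le_trans (mulmx_bound (lexx _) (mulmx_bound Dd Ce3)) _.
by apply: le_of_eq; rewrite !exprS expr0; ring.
Qed.

Lemma norm_inv_sub1 h : admissible h -> `|invmx h - 1%:M| <= C ^+ 2.
Proof.
case=> _ _ _ hV; apply: le_trans (ler_normB _ _) _.
have n1 : `|1%:M : 'M[R]_n| <= 1.
  by apply: norm_mx_le => // i j; rewrite mxE; case: (i == j); rewrite ?normr1 ?normr0.
have := C2; have CC : 2 * C <= C * C by rewrite ler_wpM2r// ltW.
by rewrite expr2; lra.
Qed.

Lemma V3E : V3 = E + e2 *m f2.
Proof. by rewrite (spl_1 e2 e3 f2 f3) addrK. Qed.

Lemma double_C k : 2 * C ^+ k <= C ^+ k.+1.
Proof. by rewrite exprS ler_wpM2r// exprn_ge0// ltW. Qed.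

Lemma wsize_upper t h u w : admissible h -> witness t h u w ->
  wsize w <= C ^+ 10 * (kap * a ^+ t).
Proof.
move=> ah [_ [w0 h1 h2 h3] _]; rewrite /wsize.
have at0 : 0 < a ^+ t by rewrite exprn_gt0.
have bt0 : 0 < b ^+ t by rewrite exprn_gt0.
have ba : b ^+ t <= a ^+ t by rewrite lerXn2r ?nnegrE ?ltW// (spl_ba spl).
set y := kap * a ^+ t; have y0 : 0 < y by rewrite mulr_gt0.
have {}h1 : `|wbar w *m E| <= C ^+ 2 * y by rewrite mulrA.
have {}h2 : `|wbar w *m invmx h *m e2| <= C ^+ 2 * y.
  by apply: le_trans h2 _; rewrite /y mulrA ler_wpM2l// mulr_ge0 ?exprn_ge0// ltW.
have we2 : `|wbar w *m e2| <= C ^+ 8 * y.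
  have -> : wbar w *m e2 = wbar w *m invmx h *m e2 - wbar w *m (invmx h - 1%:M) *m e2.
    by rewrite mulmxBr mulmx1 mulmxBl opprB addrCA subrr addr0.
  apply: le_trans (ler_normB _ _) _.
  have k := nilp_mul_e2 (wbar w) (unip_inv ah) (norm_inv_sub1 ah).
  have k2 : C ^+ 3 * (`|wbar w *m E| * C ^+ 2) <= C ^+ 7 * y.
    have -> : C ^+ 7 * y = C ^+ 3 * (C ^+ 2 * y * C ^+ 2) by rewrite !exprS expr0; ring.
    by rewrite ler_wpM2l ?Ck0// ler_wpM2r ?Ck0.
  have k3 : C ^+ 2 * y <= C ^+ 7 * y by rewrite ler_wpM2r ?(ltW y0)// ler_weXn2l.
  have k4 : 2 * (C ^+ 7 * y) <= C ^+ 8 * y by rewrite mulrA ler_wpM2r ?(ltW y0)// double_C.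
  by have := le_trans k k2; lra.
rewrite V3E mulmxDr; apply: le_trans (ler_normD _ _) _.
have k : `|wbar w *m (e2 *m f2)| <= C ^+ 9 * y.
  rewrite mulmxA; apply: le_trans (outer_bound we2 Cf2) _.
  by apply: le_of_eq; rewrite [C ^+ 9]exprSr; ring.
have k3 : C ^+ 2 * y <= C ^+ 9 * y by rewrite ler_wpM2r ?(ltW y0)// ler_weXn2l.
have k4 : 2 * (C ^+ 9 * y) <= C ^+ 10 * y by rewrite mulrA ler_wpM2r ?(ltW y0)// double_C.
by lra.
Qed.

Lemma wsize_ge0 w : 0 <= wsize w. Proof. exact: normr_ge0. Qed.

(** A nonzero integer vector has norm at least 1, so [wbar w] is not small. Its value at e3 is
    controlled by [wsize w], because its value at h^-1 e3 is tiny and h^-1 - 1 sees only the part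
    along [V3]. *)
Lemma wsize_lower t h u w : admissible h -> witness t h u w -> 1 <= C ^+ 10 * wsize w.
Proof.
move=> ah [_ [w0 h1 h2 h3] _].
have ct0 : 0 < c ^+ t by rewrite exprn_gt0.
have w1 := norm_int_mx_ge1 R w0.
have wE : map_mx intr w = wbar w *m g0 by rewrite /wbar mulmxKV// unit_g0.
rewrite wE in w1; have {}w1 := le_trans w1 (mulmx_bound (lexx _) Cg0).
have wb : `|wbar w| <= wsize w + C * `|wbar w *m e3|.
  have {1}-> : wbar w = wbar w *m V3 + wbar w *m e3 *m f3.
    by rewrite mulmxBr mulmx1 mulmxA subrK.
  apply: le_trans (ler_normD _ _) _; rewrite lerD2l mulrC; exact: outer_bound.
have we3 : `|wbar w *m e3| <= C ^+ 2 * kap + C ^+ 5 * wsize w.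
  have -> : wbar w *m e3 = wbar w *m invmx h *m e3 - wbar w *m (invmx h - 1%:M) *m e3.
    by rewrite mulmxBr mulmx1 mulmxBl opprB addrCA subrr addr0.
  apply: le_trans (ler_normB _ _) _; apply: lerD.
    apply: le_trans h3 _; rewrite ler_pdivrMr// ler_peMr ?exprn_ege1// mulr_ge0 ?exprn_ge0// ltW//.
  apply: le_trans (nilp_mul_e3 (wbar w) (unip_inv ah) (norm_inv_sub1 ah)) _.
  by apply: le_of_eq; rewrite /wsize !exprS expr0; ring.
have k1 : C * (`|wbar w| * C) <= C ^+ 2 * wsize w + C ^+ 5 * kap + C ^+ 8 * wsize w.
  have -> : C * (`|wbar w| * C) = C ^+ 2 * `|wbar w| by rewrite expr2; ring.
  have -> : C ^+ 2 * wsize w + C ^+ 5 * kap + C ^+ 8 * wsize w =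
    C ^+ 2 * (wsize w + C * (C ^+ 2 * kap + C ^+ 5 * wsize w)) by rewrite !exprS expr0; ring.
  rewrite ler_wpM2l ?Ck0//; apply: le_trans wb _.
  by rewrite lerD2l ler_wpM2l// ltW.
have k2 : 2 * (C ^+ 5 * kap) <= 1.
  by apply: le_trans (@kap_C 6 isT); rewrite mulrA ler_wpM2r ?(ltW kap0)// double_C.
have s0 := wsize_ge0 w.
have k3 : C ^+ 2 * wsize w <= C ^+ 8 * wsize w by rewrite ler_wpM2r// ler_weXn2l.
have k4 : 2 * (C ^+ 8 * wsize w) <= C ^+ 9 * wsize w by rewrite mulrA ler_wpM2r// double_C.
have k5 : 2 * (C ^+ 9 * wsize w) <= C ^+ 10 * wsize w by rewrite mulrA ler_wpM2r// double_C.
by have := le_trans w1 k1; lra.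
Qed.

Lemma exists_log (q y : R) : 2 <= q -> 1 <= y -> exists N, q ^+ N <= y /\ y < q ^+ N.+1.
Proof.
move=> q2 y1.
have [N yN] : exists N, y < q ^+ N.
  exists (Num.bound y); have y0 : 0 <= y by lra.
  apply: (lt_le_trans (archi_boundP y0)); apply: (@le_trans _ _ (2 ^+ Num.bound y)).
    by rewrite -natrX ler_nat ltnW// ltn_expl.
  by rewrite lerXn2r// nnegrE; lra.
pose P M := y < q ^+ M; have exP : exists M, P M by exists N.
have [M PM minM] := ex_minnP exP.
case: M PM minM => [|M] PM minM; first by move: PM; rewrite /P expr0; lra.
exists M; split=> //; rewrite leNgt; apply/negP => h.
by have := minM M h; rewrite ltnn.
Qed.

(* [Q^-N] is the scale at which the hypersurface of [w] endangers [h] at time [t]. *)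
Definition generation (N t : nat) (w : 'rV[int]_n) : Prop :=
  Q ^+ 3 * kap * Q ^+ N <= wsize w * c ^+ t /\ wsize w * c ^+ t < Q ^+ 3 * kap * Q ^+ N.+1.

(** The upper bound on [wsize w] gives N <= t. The lower bound gives c^t Q^(5J) < Q^(N+5), and then
    t + 10J < 2N + 10 because a <= c. *)
Lemma exists_generation t h u w : admissible h -> witness t h u w ->
  exists N, [/\ generation N t w, (N <= t)%N & (t + 10 * J < 2 * N + 10)%N].
Proof.
move=> ah wit; have up := wsize_upper ah wit; have lo := wsize_lower ah wit.
have s0 := wsize_ge0 w.
have ct1 : 1 <= c ^+ t by rewrite exprn_ege1.
have Q3 : 0 < Q ^+ 3 * kap by rewrite mulr_gt0// exprn_gt0.
have Q2 : 2 <= Q by apply: le_trans C2 (@Cpow_Q 1 isT).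
have Q1' : 1 < Q by lra.
have C10 : C ^+ 10 <= Q by exact: Cpow_Q.
have y1 : 1 <= wsize w * c ^+ t / (Q ^+ 3 * kap).
  rewrite ler_pdivlMr// mul1r.
  have k1 : C ^+ 10 * (Q ^+ 3 * kap) <= 1.
    rewrite mulrA ler_pdivrMr ?exprn_gt0// mul1r.
    apply: (@le_trans _ _ (Q ^+ 4)); first by rewrite [leRHS]exprS ler_wpM2r// exprn_ge0// ltW.
    by rewrite ler_weXn2l// leq_mul5.
  have k2 : 1 <= C ^+ 10 * (wsize w * c ^+ t).
    by rewrite mulrA; apply: (le_trans lo); rewrite ler_peMr//; lra.
  by rewrite -(ler_pM2l (exprn_gt0 10 C0)); exact: le_trans k1 k2.
have [N [N1 N2]] := exists_log Q2 y1.
rewrite ler_pdivlMr// mulrC in N1; rewrite ltr_pdivrMr// [X in _ < X]mulrC in N2.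
have Nt : (N <= t)%N.
  have : Q ^+ (3 + N) <= Q ^+ (1 + t).
    rewrite -(ler_pM2l kap0) !exprD mulrA (mulrC kap); apply: le_trans N1 _.
    rewrite expr1; apply: (@le_trans _ _ (C ^+ 10 * (kap * a ^+ t) * c ^+ t)).
      by rewrite ler_wpM2r//; lra.
    have -> : C ^+ 10 * (kap * a ^+ t) * c ^+ t = C ^+ 10 * (kap * Q ^+ t) by rewrite exprMn; ring.
    by rewrite mulrCA ler_wpM2l ?(ltW kap0)// ler_wpM2r// exprn_ge0// ltW.
  by rewrite ler_eXn2l// => /generation_le_arith.
exists N; split=> //.
have key : c ^+ t * Q ^+ (5 * J) < Q ^+ (N + 5).
  have kE : kap * Q ^+ (5 * J) = 1 by rewrite mulVf// expf_neq0// lt0r_neq0.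
  have h1 : c ^+ t <= C ^+ 10 * (wsize w * c ^+ t).
    by rewrite mulrA ler_peMl//; lra.
  have h2 : C ^+ 10 * (wsize w * c ^+ t) < Q * (Q ^+ 3 * kap * Q ^+ N.+1).
    apply: (@le_lt_trans _ _ (Q * (wsize w * c ^+ t))).
      by rewrite ler_wpM2r// mulr_ge0//; lra.
    by rewrite ltr_pM2l.
  have -> : Q ^+ (N + 5) = Q * (Q ^+ 3 * kap * Q ^+ N.+1) * Q ^+ (5 * J).
    have -> : Q * (Q ^+ 3 * kap * Q ^+ N.+1) * Q ^+ (5 * J) =
      Q * (Q ^+ 3 * Q ^+ N.+1) * (kap * Q ^+ (5 * J)) by ring.
    by rewrite kE mulr1 -exprD -exprS addnS -addSn addnC.
  by rewrite ltr_pM2r ?exprn_gt0//; exact: le_lt_trans h1 h2.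
apply: contrapT => /(generation_gap_arith J20 Nt) [h1 h2].
move: key; apply/negP; rewrite -leNgt.
have -> : c ^+ t * Q ^+ (5 * J) = a ^+ (5 * J) * c ^+ (t + 5 * J - (N + 5)) * c ^+ (N + 5).
  by rewrite exprMn mulrCA -mulrA -!exprD subnK.
rewrite [leLHS]exprMn ler_wpM2r ?exprn_ge0 ?(ltW c0)//.
apply: (@le_trans _ _ (a ^+ (5 * J + (t + 5 * J - (N + 5))))).
  by rewrite ler_weXn2l// -leq_subLR.
by rewrite exprD ler_wpM2l ?exprn_ge0 ?(ltW a0)// lerXn2r ?nnegrE ?(ltW a0) ?(ltW c0) ?(spl_ac spl).
Qed.

Lemma witness_E_le w : `|wbar w *m E| <= C ^+ 2 * wsize w.
Proof.
have -> : wbar w *m E = (wbar w *m V3) *m E.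
  by rewrite -[RHS]mulmxA V3E mulmxDl (spl_EE spl) -(mulmxA e2) (spl_f2E spl) mulmx0 addr0.
by apply: le_trans (mulmx_bound (lexx _) CE) _; apply: le_of_eq; rewrite /wsize expr2; ring.
Qed.

Lemma inv_sub_nilp h h' : admissible h -> admissible h' ->
  nilp e2 e3 f2 f3 (invmx h' - invmx h).
Proof.
move=> ah ah'; have -> : invmx h' - invmx h = (invmx h' - 1%:M) - (invmx h - 1%:M).
  by rewrite opprB addrA subrK.
by apply: nilpB; exact: unip_inv.
Qed.

Lemma cross_e2 t h h' u w r : admissible h -> admissible h' -> witness t h u w ->
  `|invmx h' - invmx h| <= C ^+ 6 * r ->
  `|wbar w *m invmx h' *m e2| <= C ^+ 2 * kap * b ^+ t + C ^+ 9 * (`|wbar w *m E| * r).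
Proof.
move=> ah ah' [_ [_ _ h2 _] _] hr.
have -> : wbar w *m invmx h' *m e2 = wbar w *m invmx h *m e2 + wbar w *m (invmx h' - invmx h) *m e2.
  by rewrite -mulmxDl mulmxBr addrC subrK.
apply: le_trans (ler_normD _ _) _; apply: lerD => //.
apply: le_trans (nilp_mul_e2 (wbar w) (inv_sub_nilp ah ah') hr) _.
by apply: le_of_eq; rewrite !exprS expr0; ring.
Qed.

Lemma cross_e3 t h h' u w r : admissible h -> admissible h' -> witness t h u w ->
  `|invmx h' - invmx h| <= C ^+ 6 * r ->
  `|wbar w *m invmx h' *m e3| <= C ^+ 2 * kap / c ^+ t + C ^+ 9 * (wsize w * r).
Proof.
move=> ah ah' [_ [_ _ _ h3] _] hr.
have -> : wbar w *m invmx h' *m e3 = wbar w *m invmx h *m e3 + wbar w *m (invmx h' - invmx h) *m e3.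
  by rewrite -mulmxDl mulmxBr addrC subrK.
apply: le_trans (ler_normD _ _) _; apply: lerD => //.
apply: le_trans (nilp_mul_e3 (wbar w) (inv_sub_nilp ah ah') hr) _.
by apply: le_of_eq; rewrite /wsize !exprS expr0; ring.
Qed.

(** Since [wsize] is the size of the gradient, this describes a neighbourhood of the hypersurface of
    [z.1] of width about Q^-(N+1), where N = [z.2]. *)
Definition surface (z : 'rV[int]_n * nat) (h : 'M[R]_n) : Prop :=
  Q * Q ^+ z.2 * `|wbar z.1 *m invmx h *m e3| <= wsize z.1.

Lemma Qc2 : Q <= c ^+ 2.
Proof. by rewrite /expansion expr2 ler_wpM2r ?(spl_ac spl)// ltW. Qed.

(* The integer [w1 u2] has absolute value less than 1, hence vanishes; dividing by the
   dominant coordinate [f3 u2] bounds [wbar w1 *m invmx h2 *m e3]. *)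
Lemma covering_small i j t h1 h2 u1 w1 u2 w2 : admissible h1 -> admissible h2 ->
  `|invmx h2 - invmx h1| <= C ^+ 6 / Q ^+ i -> witness t h1 u1 w1 -> witness t h2 u2 w2 ->
  generation (i + j) t w1 -> (j < 2 * J)%N -> (i + j <= t)%N ->
  (t + 10 * J < 2 * (i + j) + 10)%N -> surface (w1, (i + j)%N) h2.
Proof.
move=> ah1 ah2 h12 wit1 wit2 [gen1 gen2] jJ Nt tJ; rewrite /surface /=.
have [t4j j5J] := small_delay_arith J20 Nt jJ tJ.
set s := wsize w1 in gen1 gen2 *; have s0 : 0 <= s := wsize_ge0 w1.
set r := (Q ^+ i)^-1 in h12; have r0 : 0 < r by rewrite invr_gt0 exprn_gt0.
pose A := s * r; have A0 : 0 <= A by rewrite mulr_ge0// ltW.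
have ct1 : 1 <= c ^+ t by rewrite exprn_ege1.
have ct0 : 0 < c ^+ t by rewrite exprn_gt0.
have at0 : 0 < a ^+ t by rewrite exprn_gt0.
have bt1 : 1 <= b ^+ t by rewrite exprn_ege1// (spl_b spl).
have bt0 : 0 < b ^+ t by rewrite exprn_gt0.
have Act : A * c ^+ t <= Q ^+ (4 + j) * kap.
  have -> : A * c ^+ t = s * c ^+ t * r by rewrite /A; ring.
  have -> : Q ^+ (4 + j) * kap = Q ^+ 3 * kap * Q ^+ (i + j).+1 * r.
    have -> : Q ^+ 3 * kap * Q ^+ (i + j).+1 * r = Q ^+ (4 + j) * kap * (Q ^+ i * r).
      have e : Q ^+ 3 * Q ^+ (i + j).+1 = Q ^+ (4 + j) * Q ^+ i by rewrite -!exprD checkpoint_exponent.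
      by rewrite (mulrAC (Q ^+ 3)) e; ring.
    by rewrite mulfV ?mulr1// expf_neq0// lt0r_neq0.
  by rewrite ler_wpM2r ?(ltW r0)// ltW.
have Act1 : A * c ^+ t <= 1.
  by apply: le_trans Act _; rewrite ler_pdivrMr ?exprn_gt0// mul1r ler_weXn2l.
(* As Q <= c^2 and 2(4 + j) <= t, the factor Q^(4+j) in [Act] is at most c^t. *)
have Ak : A <= kap.
  have : Q ^+ (4 + j) <= c ^+ t.
    apply: (@le_trans _ _ ((c ^+ 2) ^+ (4 + j))).
      by rewrite lerXn2r ?nnegrE ?exprn_ge0 ?(ltW Q0) ?(ltW c0) ?Qc2.
    by rewrite -exprM ler_weXn2l.
  move=> /(ler_wpM2r (ltW kap0)) h; rewrite -(ler_pM2r ct0) [leRHS]mulrC.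
  exact: le_trans Act h.
have A1 : A <= 1 by exact: le_trans Ak kap1.
pose z := h2 *m g0 *m map_mx intr u2 : 'cV[R]_n.
have [[z1 z2 z3 z4] _ _] := wit2; rewrite -/z in z1 z2 z3 z4.
have [_ [_ w1E w12 w13] _] := wit1.
pose rr := wbar w1 *m invmx h2.
have hVE : invmx h2 *m E = E by apply: unipE; exact: unip_inv.
have rE : rr *m E = wbar w1 *m E by rewrite /rr -mulmxA hVE.
have rz : map_mx intr (w1 *m u2) = rr *m z :> 'M[R]_1.
  rewrite map_mxM /rr /z /wbar !mulmxA -(mulmxA _ (invmx h2)) mulVmx ?mulmx1 ?admissible_unit//.
  by rewrite -(mulmxA _ (invmx g0)) mulVmx ?mulmx1// unit_g0.
have rzE : rr *m z = (rr *m E) *m (E *m z) + (rr *m e2) *m (f2 *m z) + (rr *m e3) *m (f3 *m z).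
  rewrite {1}(spl_left e2 e3 f2 f3 z) 2!mulmxDr !mulmxA; congr (_ + _ + _).
  by rewrite -(mulmxA rr E E) (spl_EE spl).
have b1 : `|(rr *m E) *m (E *m z)| <= C ^+ 5 * kap * eps.
  rewrite rE; apply: le_trans (mulmx_bound w1E z1) _.
  by apply: le_of_eq; rewrite !exprS expr0; field; exact: lt0r_neq0.
have b2 : `|(rr *m e2) *m (f2 *m z)| <= (C ^+ 2 * kap + C ^+ 11 * A) * eps.
  rewrite norm_mul11.
  have h := cross_e2 ah1 ah2 wit1 h12; rewrite -/rr in h.
  have h' : `|rr *m e2| <= C ^+ 2 * kap * b ^+ t + C ^+ 11 * A.
    apply: le_trans h _; rewrite lerD2l.
    have -> : C ^+ 11 * A = C ^+ 9 * (C ^+ 2 * s * r) by rewrite /A !exprS expr0; ring.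
    by rewrite ler_wpM2l ?Ck0// ler_wpM2r ?(ltW r0)// witness_E_le.
  apply: (@le_trans _ _ ((C ^+ 2 * kap * b ^+ t + C ^+ 11 * A) * (eps / b ^+ t))).
    by apply: ler_pM.
  have -> : (C ^+ 2 * kap * b ^+ t + C ^+ 11 * A) * (eps / b ^+ t) =
    (C ^+ 2 * kap + C ^+ 11 * A / b ^+ t) * eps by field; exact: lt0r_neq0.
  rewrite ler_wpM2r ?(ltW eps0)// lerD2l ler_pdivrMr// ler_peMr// mulr_ge0// exprn_ge0// ltW//.
have b3 : `|(rr *m e3) *m (f3 *m z)| <= (C ^+ 2 * kap + C ^+ 9 * (A * c ^+ t)) * eps.
  rewrite norm_mul11; have h := cross_e3 ah1 ah2 wit1 h12; rewrite -/rr in h.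
  apply: (@le_trans _ _ ((C ^+ 2 * kap / c ^+ t + C ^+ 9 * A) * (eps * c ^+ t))).
    by apply: ler_pM.
  by apply: le_of_eq; field; exact: lt0r_neq0.
have C11 k x : (k <= 11)%N -> 0 <= x -> C ^+ k * x <= C ^+ 11 * x.
  by move=> k11 x0; rewrite ler_wpM2r// ler_weXn2l.
have w1u2 : w1 *m u2 = 0.
  have : `|rr *m z| < 1.
    rewrite rzE; apply: (@le_lt_trans _ _ (C ^+ 14 * eps)).
      apply: le_trans (ler_normD _ _) _.
      apply: (@le_trans _ _ (C ^+ 5 * kap * eps + (C ^+ 2 * kap + C ^+ 11 * A) * eps +
         (C ^+ 2 * kap + C ^+ 9 * (A * c ^+ t)) * eps)).
        by apply: lerD => //; apply: le_trans (ler_normD _ _) _; exact: lerD.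
      rewrite -!mulrDl ler_wpM2r ?(ltW eps0)//.
      have k1 : C ^+ 5 * kap <= C ^+ 11.
        by apply: le_trans (C11 _ _ _ (ltW kap0)) _ => //; rewrite ler_piMr// exprn_ge0// ltW.
      have k2 : C ^+ 2 * kap <= C ^+ 11.
        by apply: le_trans (C11 _ _ _ (ltW kap0)) _ => //; rewrite ler_piMr// exprn_ge0// ltW.
      have k3 : C ^+ 11 * A <= C ^+ 11 by rewrite ler_piMr// exprn_ge0// ltW.
      have k4 : C ^+ 9 * (A * c ^+ t) <= C ^+ 11.
        have p0 : 0 <= A * c ^+ t by rewrite mulr_ge0// ltW.
        by apply: le_trans (C11 _ _ _ p0) _ => //; rewrite ler_piMr// exprn_ge0// ltW.
      have := double_C 11; have := double_C 12; have := double_C 13.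
      have : 0 <= C ^+ 11 by rewrite exprn_ge0// ltW.
      by lra.
    rewrite /danger_bound ltr_pdivrMr ?exprn_gt0// mul1r.
    apply: (@lt_le_trans _ _ (C ^+ 15)); first by rewrite ltr_eXn2l//; have := C2; lra.
    by apply: (le_trans (Cpow_Q _)) => //; rewrite -[leLHS]expr1 ler_weXn2l// addn1.
  rewrite -rz => lt1; apply/matrixP => p q; rewrite !ord1 [RHS]mxE; apply: (@intr_eq0_lt1 R).
  by apply: le_lt_trans lt1; have := ler_entry_norm (map_mx intr (w1 *m u2) : 'M[R]_1) 0 0; rewrite mxE.
have rz0 : rr *m z = 0 by rewrite -rz w1u2; apply/matrixP => p q; rewrite !mxE.
(* The pairing vanishes, so its e3 term is the opposite of the other two, which are small. *)
have b4 : `|rr *m e3| * `|f3 *m z| <= C ^+ 13 * kap * eps.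
  rewrite -norm_mul11; have -> : (rr *m e3) *m (f3 *m z) = - ((rr *m E) *m (E *m z) + (rr *m e2) *m (f2 *m z)).
    by apply/eqP; rewrite -addr_eq0 addrC -rzE rz0.
  rewrite normrN; apply: le_trans (ler_normD _ _) _; apply: le_trans (lerD b1 b2) _.
  rewrite -mulrDl ler_wpM2r ?(ltW eps0)//.
  have k1 : C ^+ 5 * kap <= C ^+ 11 * kap by apply: C11 => //; exact: ltW.
  have k2 : C ^+ 2 * kap <= C ^+ 11 * kap by apply: C11 => //; exact: ltW.
  have k3 : C ^+ 11 * A <= C ^+ 11 * kap by rewrite ler_wpM2l// exprn_ge0// ltW.
  have k4 : 2 * (C ^+ 11 * kap) <= C ^+ 12 * kap by rewrite mulrA ler_wpM2r ?(ltW kap0)// double_C.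
  have k5 : 2 * (C ^+ 12 * kap) <= C ^+ 13 * kap by rewrite mulrA ler_wpM2r ?(ltW kap0)// double_C.
  have k6 : 0 <= C ^+ 11 * kap by rewrite mulr_ge0 ?Ck0 ?(ltW kap0).
  by lra.
set y := `|rr *m e3| in b4 *; have y0 : 0 <= y := normr_ge0 _.
(* The lower bound [z4], which stems from the minimality of the dangerous time, allows dividing by
   the f3 coordinate. *)
have b5 : y * c ^+ t <= c * (C ^+ 13 * kap).
  rewrite -(ler_pM2l eps0).
  have hz : eps * (y * c ^+ t) <= y * (c * `|f3 *m z|).
    by have := ler_wpM2l y0 z4; rewrite mulrCA; apply: le_trans; apply: le_of_eq; ring.
  apply: le_trans hz _; rewrite mulrCA; have := ler_wpM2l (ltW c0) b4.
  by apply: le_trans_eq; ring.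
have b6 : y * c ^+ t * (Q ^+ 3 * Q ^+ (i + j)) <= Q * (s * c ^+ t).
  apply: (@le_trans _ _ (c * C ^+ 13 * (Q ^+ 3 * kap * Q ^+ (i + j)))).
    have := ler_wpM2r (mulr_ge0 (exprn_ge0 3 (ltW Q0)) (exprn_ge0 (i + j) (ltW Q0))) b5.
    by apply: le_trans_eq; ring.
  apply: ler_pM => //.
  - by rewrite mulr_ge0 ?exprn_ge0// ltW.
  - by rewrite !mulr_ge0 ?exprn_ge0// ltW.
  - by rewrite /expansion mulrC ler_wpM2r ?(ltW c0)// Cpow_a.
have b7 : y * (Q ^+ 2 * Q ^+ (i + j)) <= s.
  rewrite -(ler_pM2l (mulr_gt0 Q0 ct0)).
  have := b6; rewrite exprS; apply: le_trans_eq2; ring.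
apply: le_trans b7; rewrite mulrC ler_wpM2l// ler_wpM2r ?Qk0//.
by rewrite expr2 ler_peMl// ltW.
Qed.

Lemma minorsD (x1 y1 x2 y2 : 'rV[R]_n) : y1^T *m y2 = y2^T *m y1 ->
  minors (x1 + y1) (x2 + y2) =
  x1^T *m x2 - x2^T *m x1 + (x1^T *m y2 - x2^T *m y1) + (y1^T *m x2 - y2^T *m x1).
Proof.
move=> yy; rewrite /minors !linearD /= !(mulmxDl, mulmxDr) yy.
by apply/matrixP => p q; rewrite !mxE; ring.
Qed.

(** Each vector splits into r, along E and e3, of size x, and s, a multiple of f2, of size y. The
    two s-parts are proportional, so no y * y term survives; a second intermediate direction would
    create one. *)
Lemma minors_bound (W1 W2 : 'rV[R]_n) x y :
  `|W1 *m E| <= x -> `|W2 *m E| <= x -> `|W1 *m e3| <= x -> `|W2 *m e3| <= x ->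
  `|W1 *m e2| <= y -> `|W2 *m e2| <= y -> `|minors W1 W2| <= C ^+ 6 * (x * (x + y)).
Proof.
move=> E1 E2 D1 D2 B1 B2.
pose r (W : 'rV[R]_n) := W *m E + W *m e3 *m f3; pose s (W : 'rV[R]_n) := W *m e2 *m f2.
have x0 : 0 <= x := le_trans (normr_ge0 _) E1.
have y0 : 0 <= y := le_trans (normr_ge0 _) B1.
have rP W : `|W *m E| <= x -> `|W *m e3| <= x -> `|r W| <= C ^+ 2 * x.
  move=> h1 h2; apply: le_trans (ler_normD _ _) _.
  have h3 := outer_bound h2 Cf3; apply: (@le_trans _ _ (x + x * C)); first exact: lerD.
  have : (1 + C) * x <= C ^+ 2 * x; last by lra.
  rewrite ler_wpM2r//; have := C2; have := double_C 1; rewrite expr1; lra.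
have sP W : `|W *m e2| <= y -> `|s W| <= C * y.
  by move=> h; have := outer_bound h Cf2; apply: le_trans_eq2 => //; ring.
have dec W : W = r W + s W.
  by rewrite {1}(spl_right e2 e3 f2 f3 W) /r /s addrAC.
have ss : (s W1)^T *m s W2 = (s W2)^T *m s W1.
  rewrite /s !(trmx_mul _ f2) [W1 *m e2]mx11_scalar [W2 *m e2]mx11_scalar !tr_scalar_mx.
  by rewrite !mul_mx_scalar !mul_scalar_mx -!scalemxAl -!scalemxAr !scalerA mulrC.
have -> : minors W1 W2 = (r W1)^T *m r W2 - (r W2)^T *m r W1 + ((r W1)^T *m s W2 - (r W2)^T *m s W1)
   + ((s W1)^T *m r W2 - (s W2)^T *m r W1).
  by rewrite [in LHS](dec W1) [in LHS](dec W2) minorsD.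
have ob (X Y : 'rV[R]_n) x' y' : `|X| <= x' -> `|Y| <= y' -> `|X^T *m Y| <= x' * y'.
  by move=> hx hy; apply: outer_bound => //; rewrite norm_trmx.
have R1 := rP _ E1 D1; have R2 := rP _ E2 D2; have S1 := sP _ B1; have S2 := sP _ B2.
have hs (X Y : 'M[R]_n) z : `|X| <= z -> `|Y| <= z -> `|X - Y| <= z + z.
  by move=> h1 h2; apply: le_trans (ler_normB _ _) _; exact: lerD.
apply: le_trans (ler_normD _ _) _.
have h3 := hs _ _ _ (ob _ _ _ _ R1 R2) (ob _ _ _ _ R2 R1).
have h4 := hs _ _ _ (ob _ _ _ _ R1 S2) (ob _ _ _ _ R2 S1).
have h5 : `|(s W1)^T *m r W2 - (s W2)^T *m r W1| <= C ^+ 2 * x * (C * y) + C ^+ 2 * x * (C * y).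
  by apply: hs; rewrite mulrC; apply: ob.
apply: le_trans (lerD (le_trans (ler_normD _ _) (lerD h3 h4)) h5) _.
have k1 : 2 * (C ^+ 4 * (x * x)) <= C ^+ 6 * (x * x).
  rewrite mulrA ler_wpM2r ?mulr_ge0//; apply: le_trans (double_C 4) _; rewrite ler_weXn2l//.
have k2 : 4 * (C ^+ 3 * (x * y)) <= C ^+ 6 * (x * y).
  rewrite mulrA ler_wpM2r ?mulr_ge0//.
  have := double_C 3; have := double_C 4; have : C ^+ 5 <= C ^+ 6 by rewrite ler_weXn2l//.
  by lra.
have e4 : C ^+ 4 = C ^+ 2 * C ^+ 2 by rewrite -exprD.
have e3' : C ^+ 3 = C ^+ 2 * C by rewrite -exprSr.
move: k1 k2; rewrite e4 e3' mulrDr mulrDr; lra.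
Qed.

(** By the upper bound on the generation, [wsize w] is at most a^i kap m, and [U i] divides the E
    coordinate by a^i. Only the e2 coordinate carries the additional b^(j+k). *)
Lemma transported_bounds i j k h h1 u w : admissible h -> admissible h1 ->
  `|invmx h1 - invmx h| <= C ^+ 6 / Q ^+ i -> witness (i + j + k) h u w ->
  generation (i + j) (i + j + k) w ->
  let m := Q ^+ 4 * a ^+ j / c ^+ k in let W := wbar w *m invmx h1 *m U i in
  [/\ `|W *m E| <= C ^+ 10 * (kap * m), `|W *m e3| <= C ^+ 10 * (kap * m) &
   `|W *m e2| <= C ^+ 12 * (kap * (m + b ^+ (j + k)))].
Proof.
move=> ah ah1 hh wit [gen1 gen2] m W.
have at0 s : 0 < a ^+ s by rewrite exprn_gt0.
have bt0 s : 0 < b ^+ s by rewrite exprn_gt0.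
have bt1 s : 1 <= b ^+ s by rewrite exprn_ege1// (spl_b spl).
have ct0 s : 0 < c ^+ s by rewrite exprn_gt0.
have ct1 s : 1 <= c ^+ s by rewrite exprn_ege1.
have Qt0 s : 0 < Q ^+ s by rewrite exprn_gt0.
set t := (i + j + k)%N in wit gen1 gen2.
have om0 := wsize_ge0 w.
have m0 : 0 < m by rewrite divr_gt0// mulr_gt0.
have kmi : 0 <= kap * m by rewrite mulr_ge0 // ltW.
have nz s x : 0 < x -> x ^+ s != 0 :> R by move=> x0; rewrite expf_neq0// lt0r_neq0.
have omE : wsize w / a ^+ i <= kap * m.
  rewrite ler_pdivrMr//; rewrite -(ler_pM2r (ct0 t)); apply: le_trans (ltW gen2) _.
  apply: le_of_eq; rewrite /m /t (exprS Q (i + j)) !exprD /expansion !exprMn !(exprS _ 3).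
  by field; rewrite nz.
have omQ : wsize w / Q ^+ i * c ^+ i <= kap * m.
  apply: le_trans omE; rewrite /expansion exprMn; apply: le_of_eq; field.
  by rewrite !nz.
have W1 : `|W *m E| <= C ^+ 4 * (kap * m).
  have -> : W *m E = (wbar w *m E) *m (U i *m E).
    have UE : U i *m E = E *m (U i *m E) by rewrite UEC0 mulmxA (spl_EE spl).
    by rewrite /W -(mulmxA _ (U i)) [in LHS]UE mulmxA -(mulmxA (wbar w)) (unipE (unip_inv ah1)).
  have UEC : `|U i *m E| <= C / a ^+ i.
    by apply: le_trans (spl_UE spl i) _; rewrite ler_wpM2r// invr_ge0 ltW.
  apply: le_trans (mulmx_bound (witness_E_le w) UEC) _.
  have -> : C * (C ^+ 2 * wsize w * (C / a ^+ i)) = C ^+ 4 * (wsize w / a ^+ i).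
    by rewrite !exprS expr0; ring.
  by rewrite ler_wpM2l// exprn_ge0// ltW.
have Ck s s' x : (s <= s')%N -> 0 <= x -> C ^+ s * x <= C ^+ s' * x.
  by move=> ss x0; rewrite ler_wpM2r// ler_weXn2l.
split.
- by apply: le_trans W1 _; apply: Ck.
- rewrite /W -mulmxA (spl_Ue3 spl).
  rewrite -scalemxAr mx_normZ normfV (spl_norm_l3 spl) invrK mulrC.
  have h3 := cross_e3 ah ah1 wit hh.
  apply: le_trans (ler_wpM2r (ltW (ct0 i)) h3) _; rewrite mulrDl.
  have k1 : C ^+ 2 * kap / c ^+ t * c ^+ i <= C ^+ 9 * (kap * m).
    have -> : C ^+ 2 * kap / c ^+ t * c ^+ i = C ^+ 2 * (kap * (c ^+ (j + k))^-1).
      by rewrite /t -addnA !exprD; field; rewrite !nz.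
    apply: le_trans (Ck 2 9 _ isT _); last exact: kmi.
    rewrite ler_wpM2l ?Ck0// ler_wpM2l ?(ltW kap0)//.
    rewrite exprD invfM /m ler_wpM2r ?invr_ge0 ?(ltW (ct0 _))//.
    apply: (@le_trans _ _ 1); first by rewrite invf_le1.
    by rewrite mulr_ege1// exprn_ege1.
  have k2 : C ^+ 9 * (wsize w * (Q ^+ i)^-1) * c ^+ i <= C ^+ 9 * (kap * m).
    by rewrite -mulrA ler_wpM2l// exprn_ge0// ltW.
  by have := double_C 9; move=> /(ler_wpM2r kmi); lra.
- rewrite /W -mulmxA (spl_Ue2 spl).
  rewrite -scalemxAr mx_normZ normfV (spl_norm_l2 spl) mulrC.
  have h2 := cross_e2 ah ah1 wit hh.
  apply: (@le_trans _ _ ((C ^+ 2 * kap * b ^+ t + C ^+ 9 * (C ^+ 2 * wsize w * (Q ^+ i)^-1)) / b ^+ i)).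
    rewrite ler_wpM2r ?invr_ge0 ?(ltW (bt0 _))//; apply: le_trans h2 _; rewrite lerD2l.
    by rewrite ler_wpM2l ?Ck0// ler_wpM2r ?invr_ge0 ?(ltW (Qt0 _)) ?witness_E_le.
  rewrite mulrDl.
  have k1 : C ^+ 2 * kap * b ^+ t / b ^+ i <= C ^+ 12 * (kap * b ^+ (j + k)).
    have -> : C ^+ 2 * kap * b ^+ t / b ^+ i = C ^+ 2 * (kap * b ^+ (j + k)).
      by rewrite /t -addnA exprD; field; rewrite nz.
    by apply: Ck => //; rewrite mulr_ge0// ltW.
  have k2 : C ^+ 9 * (C ^+ 2 * wsize w / Q ^+ i) / b ^+ i <= C ^+ 12 * (kap * m).
    apply: (@le_trans _ _ (C ^+ 9 * (C ^+ 2 * wsize w / Q ^+ i))).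
      by rewrite ler_pdivrMr// ler_peMr// !mulr_ge0 ?exprn_ge0 ?invr_ge0 ?(ltW C0) ?(ltW (Qt0 _)).
    have -> : C ^+ 9 * (C ^+ 2 * wsize w / Q ^+ i) = C ^+ 11 * (wsize w / Q ^+ i).
      by rewrite !exprS expr0; ring.
    apply: (le_trans _ (Ck 11 12 _ isT kmi)); rewrite ler_wpM2l ?Ck0//.
    by apply: (le_trans _ omQ); rewrite ler_peMr// divr_ge0// ltW.
  by rewrite (mulrDr kap) mulrDr addrC lerD.
Qed.

Lemma not_danger_min i h : admissible h -> ~ danger i h ->
  forall u : 'cV[int]_n, u != 0 -> eps / C ^+ 2 <= `|T i *m h *m g0 *m map_mx intr u|.
Proof.
move=> ah nd u u0; rewrite leNgt; apply/negP => h1; apply: nd; exists u => //.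
rewrite ltr_pdivlMr ?exprn_gt0// mulrC in h1.
have k (X : 'rV[R]_n) : `|X| <= C -> `|X *m (T i *m h *m g0 *m map_mx intr u)| < eps.
  move=> hX; apply: le_lt_trans h1; apply: le_trans (mulmx_bound hX (lexx _)) _.
  by apply: le_of_eq; ring.
split; [|exact: k|exact: k].
apply: le_lt_trans h1; apply: le_trans (mulmx_bound CE (lexx _)) _.
by apply: le_of_eq; ring.
Qed.

(** The dangerous product is m b^(j+k) = Q^4 (ab)^j (b/c)^k, at most Q^4 / a^(k-2j) because b < a
    and ab <= c. The lag makes k - 2j so large that this beats the threshold of [minors0], which
    depends on J. *)
Lemma minors_eq0 j k (W1 W2 : 'rV[R]_n) : (4 * j <= k)%N -> (lag n * J <= k)%N ->
  let m := Q ^+ 4 * a ^+ j / c ^+ k in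
  `|minors W1 W2| <= C ^+ 6 * (C ^+ 10 * (kap * m) *
    (C ^+ 10 * (kap * m) + C ^+ 12 * (kap * (m + b ^+ (j + k))))) ->
  `|minors W1 W2| < (eps / C ^+ 2) ^+ (2 * n) / C.
Proof.
move=> jk lk m h; have [jk2 kp] := large_delay_arith (leq_trans (isT : (1 <= 20)%N) J20) jk lk.
set p := (k - 2 * j)%N in kp.
have at0 s : 0 < a ^+ s by rewrite exprn_gt0.
have bt0 s : 0 < b ^+ s by rewrite exprn_gt0.
have ct0 s : 0 < c ^+ s by rewrite exprn_gt0.
have m0 : 0 < m by rewrite divr_gt0// mulr_gt0// exprn_gt0.
have kE : k = (2 * j + p)%N by rewrite subnKC.
set bb := b ^+ (j + k) in h; have bb0 : 0 < bb by exact: bt0.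
have mb : m * bb <= Q ^+ 4 / a ^+ p.
  have -> : m * bb = Q ^+ 4 * (a ^+ j * b ^+ j) * (b ^+ k / c ^+ k).
    by rewrite /m /bb exprD; ring.
  have -> : Q ^+ 4 / a ^+ p = Q ^+ 4 * (a ^+ j * a ^+ j) * (a ^+ k)^-1.
    have -> : a ^+ k = a ^+ j * a ^+ j * a ^+ p by rewrite [in LHS]kE mul2n -addnn !exprD.
    by field; rewrite !expf_neq0 ?(lt0r_neq0 a0).
  apply: ler_pM.
  - by rewrite !mulr_ge0// ?Qk0// ltW.
  - by rewrite divr_ge0// ltW.
  - rewrite ler_wpM2l ?Qk0// ler_wpM2l ?(ltW (at0 _))//.
    by rewrite lerXn2r ?nnegrE ?(ltW b0) ?(ltW a0) ?(ltW (spl_ba spl)).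
  - rewrite ler_pdivrMr// mulrC ler_pdivlMr// -exprMn.
    by rewrite lerXn2r ?nnegrE ?mulr_ge0 ?(ltW b0) ?(ltW a0) ?(ltW c0)// mulrC (spl_abc spl).
have m1 : m <= Q ^+ 4 / a ^+ p.
  apply: le_trans mb; rewrite ler_peMr ?(ltW m0)// exprn_ege1// (spl_b spl)//.
have m4 : m <= Q ^+ 4.
  by apply: le_trans m1 _; rewrite ler_piMr ?Qk0// invf_le1// exprn_ege1.
have mm : m * (m + bb) <= 2 * (Q ^+ 8 / a ^+ p).
  have k1 : m * m <= Q ^+ 8 / a ^+ p.
    have := ler_pM (ltW m0) (ltW m0) m4 m1; apply: le_trans_eq.
    by rewrite mulrA -exprD.
  have k2 : Q ^+ 4 / a ^+ p <= Q ^+ 8 / a ^+ p by rewrite ler_wpM2r ?invr_ge0 ?(ltW (at0 _))// ler_weXn2l.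
  by rewrite mulrDr; lra.
have small : `|minors W1 W2| <= Q ^+ 9 / a ^+ p.
  apply: le_trans h _.
  have km : kap * m <= m by rewrite ler_piMl// ltW.
  have kmb : kap * (m + bb) <= m + bb by rewrite ler_piMl// ltW// addr_gt0.
  have k1 : C ^+ 10 * (kap * m) <= C ^+ 10 * m by rewrite ler_wpM2l// exprn_ge0// ltW.
  have k2 : C ^+ 12 * (kap * (m + bb)) <= C ^+ 12 * (m + bb) by rewrite ler_wpM2l// exprn_ge0// ltW.
  have k3 : C ^+ 10 * m <= C ^+ 12 * (m + bb).
    apply: ler_pM; rewrite ?Ck0 ?(ltW m0)//; first by rewrite ler_weXn2l.
    by rewrite lerDl ltW.
  have k4 := double_C 12; have mbb : 0 <= m + bb by rewrite ltW// addr_gt0.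
  have k5 : C ^+ 10 * (kap * m) + C ^+ 12 * (kap * (m + bb)) <= C ^+ 13 * (m + bb).
    by have := ler_wpM2r mbb k4; lra.
  have k6 := double_C 29.
  apply: (@le_trans _ _ (C ^+ 6 * (C ^+ 10 * m * (C ^+ 13 * (m + bb))))).
    rewrite ler_wpM2l ?Ck0//; apply: ler_pM => //.
      by apply: mulr_ge0; [rewrite exprn_ge0// ltW|apply: mulr_ge0; exact: ltW].
    apply: addr_ge0; (apply: mulr_ge0; first by rewrite exprn_ge0// ltW).
      by apply: mulr_ge0; exact: ltW.
    by apply: mulr_ge0 => //; exact: ltW.

  have -> : C ^+ 6 * (C ^+ 10 * m * (C ^+ 13 * (m + bb))) = C ^+ 29 * (m * (m + bb)).
    by rewrite (exprD C 6 23) (exprD C 10 13); ring.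
  have q8 : 0 <= Q ^+ 8 / a ^+ p by rewrite divr_ge0 ?exprn_ge0 ?(ltW Q0) ?(ltW a0).
  have k7 : C ^+ 29 * (m * (m + bb)) <= C ^+ 29 * (2 * (Q ^+ 8 / a ^+ p)).
    by rewrite ler_wpM2l// exprn_ge0// ltW.
  have k8 : C ^+ 30 <= Q by exact: Cpow_Q.
  have k9 := ler_wpM2r q8 (le_trans k6 k8).
  by rewrite (exprS Q 8) -mulrA; lra.
apply: le_lt_trans small _.
have -> : (eps / C ^+ 2) ^+ (2 * n) / C =
    (Q ^+ ((5 * J * n + 1) * (2 * n)) * (C ^+ (2 * (2 * n)) * C))^-1.
  by rewrite expr_div_n /danger_bound exprVn -!exprM !invfM mulrA.
rewrite ltr_pdivrMr// mulrC ltr_pdivlMr ?mulr_gt0 ?exprn_gt0//.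
apply: (@le_lt_trans _ _ (Q ^+ (9 + (5 * J * n + 1) * (2 * n) + (4 * n + 1)))).
  rewrite (exprD Q (9 + _)) (exprD Q 9) -mulrA ler_wpM2l ?Qk0//.
  rewrite ler_wpM2l ?Qk0//.
  have -> : C ^+ (2 * (2 * n)) * C = C ^+ (4 * n + 1) by rewrite mulnA exprD expr1.
  by rewrite lerXn2r ?nnegrE ?(ltW Q0) ?(ltW C0)// (@Cpow_Q 1).
have Q1' : 1 < Q by apply: lt_le_trans (spl_a1 spl) aQ.
apply: (@lt_le_trans _ _ (Q ^+ (9 + (5 * J * n + 1) * (2 * n) + (4 * n + 1)).+1)).
  by rewrite ltr_eXn2l.
have Qan : Q <= a ^+ n.+1 by rewrite exprS ler_wpM2l ?(ltW a0)// (spl_ca spl).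
apply: (@le_trans _ _ (a ^+ (n.+1 * (9 + (5 * J * n + 1) * (2 * n) + (4 * n + 1)).+1))).
  by rewrite exprM lerXn2r ?nnegrE ?exprn_ge0 ?(ltW Q0) ?(ltW a0).
by rewrite ler_weXn2l.
Qed.

(* The vectors of two obstructions of the same type are proportional, since their
   minors are small with respect to a lattice without short vectors. *)
Lemma covering_large i j k h1 h2 u1 w1 u2 w2 : admissible h1 -> admissible h2 ->
  `|invmx h2 - invmx h1| <= C ^+ 6 / Q ^+ i -> ~ danger i h1 ->
  witness (i + j + k) h1 u1 w1 -> witness (i + j + k) h2 u2 w2 ->
  generation (i + j) (i + j + k) w1 -> generation (i + j) (i + j + k) w2 ->
  (4 * j <= k)%N -> (lag n * J <= k)%N -> surface (w1, (i + j)%N) h2.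
Proof.
move=> ah1 ah2 h12 nd wit1 wit2 gen1 gen2 jk lk; rewrite /surface /=.
have h11 : `|invmx h1 - invmx h1| <= C ^+ 6 / Q ^+ i.
  by rewrite subrr normr0 divr_ge0// exprn_ge0// ltW.
have h21 : `|invmx h1 - invmx h2| <= C ^+ 6 / Q ^+ i by rewrite distrC.
have [E1 D1 B1] := transported_bounds ah1 ah1 h11 wit1 gen1.
have [E2 D2 B2] := transported_bounds ah2 ah1 h21 wit2 gen2.
have := minors_eq0 jk lk (minors_bound E1 E2 D1 D2 B1 B2).
pose g := T i *m h1 *m g0.
have [_ dh1 _ _] := ah1.
have dg : \det g = 1 by rewrite !det_mulmx det_T dh1 det_g0 !mulr1.
have gV : invmx g = invmx g0 *m invmx h1 *m U i := invmx_translate i ah1.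
have WE w : wbar w *m invmx h1 *m U i = map_mx intr w *m invmx g by rewrite gV /wbar !mulmxA.
rewrite !WE => small.
have eC0 : 0 < eps / C ^+ 2 by rewrite divr_gt0// exprn_gt0.
have eC1 : eps / C ^+ 2 <= 1.
  by rewrite ler_pdivrMr ?exprn_gt0// mul1r; apply: (le_trans eps1); rewrite exprn_ege1.
have w12 := minors0 dg eC0 eC1 (not_danger_min ah1 nd) small.
have wb12 : (wbar w1)^T *m wbar w2 = (wbar w2)^T *m wbar w1.
  apply/eqP; rewrite -subr_eq0; apply/eqP; rewrite -/(minors _ _) /wbar minors_mulmx.
  have -> : minors (map_mx intr w1) (map_mx intr w2) = map_mx intr (minors w1 w2) :> 'M[R]_n.
    by rewrite /minors map_mxB !map_mxM !map_trmx.
  by rewrite w12 map_mx0 mulmx0 mul0mx.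
pose x := invmx h2 *m e3.
(* By proportionality the value at x divided by [wsize] is the same for [w1] and [w2]; for [w2] it
   is small by [wit2]. *)
have key : `|wbar w1 *m x| * wsize w2 = `|wbar w2 *m x| * wsize w1.
  have e w w' : `|wbar w *m x| * wsize w' = `|x^T *m ((wbar w)^T *m wbar w') *m V3|.
    rewrite (mulmxA x^T) -trmx_mul -(mulmxA _ (wbar w')) norm_mul11; congr (_ * _).
    by rewrite -[in LHS](norm_trmx (wbar w *m x)).
  by rewrite !e wb12.
have ct0 : 0 < c ^+ (i + j + k) by rewrite exprn_gt0.
have [_ [_ _ _ w23] _] := wit2; rewrite -mulmxA -/x in w23.
have [g2 _] := gen2; have s1 := wsize_ge0 w1; have s2 := wsize_ge0 w2.
rewrite -mulmxA -/x; set y := `|wbar w1 *m x| in key *; have y0 : 0 <= y by exact: normr_ge0.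
have b1 : y * (Q ^+ 3 * kap * Q ^+ (i + j)) <= C ^+ 2 * kap * wsize w1.
  apply: le_trans (ler_wpM2l y0 g2) _; rewrite mulrA key mulrAC ler_wpM2r//.
  by rewrite -ler_pdivlMr.
have b2 : y * (Q ^+ 3 * Q ^+ (i + j)) <= C ^+ 2 * wsize w1.
  by rewrite -(ler_pM2l kap0); have := b1; apply: le_trans_eq2; ring.
have b3 : C ^+ 2 * wsize w1 <= Q ^+ 2 * wsize w1.
  by rewrite ler_wpM2r// lerXn2r ?nnegrE ?(ltW Q0) ?(ltW C0)// (@Cpow_Q 1).
rewrite -(ler_pM2l (exprn_gt0 2 Q0)); apply: (le_trans _ b3); apply: le_trans b2.
by apply: le_of_eq; rewrite (exprS Q 2); ring.
Qed.

Lemma covering i k h1 h2 u1 w1 u2 w2 : let N := (i + delay n J k)%N in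
  admissible h1 -> admissible h2 ->
  `|invmx h2 - invmx h1| <= C ^+ 6 / Q ^+ i -> ~ danger i h1 ->
  witness (N + k) h1 u1 w1 -> witness (N + k) h2 u2 w2 ->
  generation N (N + k) w1 -> generation N (N + k) w2 ->
  (N + k + 10 * J < 2 * N + 10)%N -> surface (w1, N) h2.
Proof.
move=> N ah1 ah2 h12 nd wit1 wit2 gen1 gen2 h.
have [_ _] := delay_arith J20 h; case: ifPn => [_ jJ|].
  exact: (covering_small ah1 ah2 h12 wit1 wit2 gen1 jJ (leq_addr _ _) h).
by rewrite -leqNgt => kJ jk; exact: (covering_large ah1 ah2 h12 nd wit1 wit2 gen1 gen2 jk kJ).
Qed.

Lemma danger_type t h : admissible h -> danger t h -> exists i k u w,
  let N := (i + delay n J k)%N in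
  [/\ (N <= t)%N, witness (N + k) h u w, generation N (N + k) w & (N + k + 10 * J < 2 * N + 10)%N].
Proof.
move=> ah dh.
have ex : exists t', `[< danger t' h >] by exists t; apply/asboolP.
have [t' /asboolP dt' first] := ex_minnP ex.
have [|u [w wit]] := danger_witness ah dt'.
  by move=> s st ds; have := first s (asboolT ds); rewrite leqNgt st.
have [N [gen Nt h1]] := exists_generation ah wit.
have [d1 d2 d3] := type_arith n J20 Nt h1.
exists (N - delay n J (t' - N))%N, (t' - N)%N, u, w => /=.
rewrite d1 d2; split=> //; apply: leq_trans Nt _; exact: first t (asboolT dh).
Qed.

Lemma delay_ge k : (J <= delay n J k)%N. Proof. exact: leq_addr. Qed.
(** * The winning strategy *)

Section Strategy.
Variables (m : nat) (psi : 'rV[R]_m -> 'M[R]_n).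
Variables (dpsi : 'rV[R]_m -> {linear 'rV[R]_m -> 'M[R]_n}) (beta : R) (B0 : eball R m).
Hypotheses (m0 : (0 < m)%N) (Cm : m.+2%:R <= C) (beta0 : 0 < beta) (Cbeta : 1 <= C * beta).
Hypothesis adm : forall x, ball_set B0 x -> admissible (psi x).
Hypothesis lip : forall x y, ball_set B0 x -> ball_set B0 y -> `|psi y - psi x| <= C * `|y - x|.
Hypothesis onto : forall y X, ball_set B0 y -> nilp e2 e3 f2 f3 X ->
  exists2 xi, `|xi| <= C * `|X| & dpsi y xi = X.
Hypothesis lin : forall x y, ball_set B0 x -> ball_set B0 y -> `|y - x| <= (Q ^+ J)^-1 ->
  `|psi y - psi x - dpsi x (y - x)| <= Q^-1 * `|y - x|.
Hypothesis BJ : beta / Q ^+ J <= Defs.radius B0.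

(** With q = 1/(m+2) this is 1 - q/2: a move of Alice multiplies the weight by 1 - q, and half of
    this gain pays for the new obstructions. *)
Definition decay : R := 1 - (2 * m.+2%:R)^-1.
Hypothesis decayJ : decay ^+ J * ((lag n)%:R / (1 - decay)) <= (4 * m.+2%:R)^-1.

Local Notation obstruction := ('rV[int]_n * nat)%type.

(** The tolerance Q^-i is the radius at which stage i is played: an obstruction meeting a ball of
    that radius hits its centre, so the potential at one point controls the whole ball. *)
Definition hit (i : nat) (z : obstruction) (y : 'rV[R]_m) : bool :=
  `[< exists x, [/\ ball_set B0 x, enorm (x - y) <= (Q ^+ i)^-1 & surface z (psi x)] >].

(* Alice keeps the potential below [decay ^+ i / 2] near the current ball: an obstruction of
   generation at most [i] would contribute more than that by itself. *)
Definition potential (i : nat) (ls : seq obstruction) (y : 'rV[R]_m) : R :=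
  \sum_(z <- ls | hit i z y) decay ^+ z.2.

(** Here i' is the stage at which an obstruction is registered; those with i' >= i still have a
    generation above i and are left for later. *)
Definition covers (i : nat) (ls : seq obstruction) (B : eball R m) : Prop :=
  forall x i' k u w, let N := (i' + delay n J k)%N in ball_set B x -> (i' < i)%N ->
  witness (N + k) (psi x) u w -> generation N (N + k) w -> (N + k + 10 * J < 2 * N + 10)%N ->
  exists2 z, z \in ls & z.2 = N /\ surface z (psi x).

Definition position (i : nat) (B : eball R m) : Prop :=
  [/\ ball_set B `<=` ball_set B0, beta / Q ^+ i <= Defs.radius B, (J <= i)%N &
   exists ls, [/\ forall z, z \in ls -> 0 < wsize z.1,
     forall y, ball_set B y -> potential i ls y <= decay ^+ i / 2 & covers i ls B]].

Let kp0 : 0 < m.+2%:R^-1 :> R. Proof. by rewrite invr_gt0 ltr0n. Qed.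
Let kp1 : m.+2%:R^-1 <= 1 :> R. Proof. by rewrite invf_le1 ?ltr0n// ler1n. Qed.
Let decayE : decay = 1 - m.+2%:R^-1 / 2. Proof. by rewrite /decay invfM mulrC. Qed.

Lemma decay_gt0 : 0 < decay. Proof. by move: kp0 kp1; rewrite decayE; move: (_^-1) => k; lra. Qed.
Lemma decay_lt1 : decay < 1. Proof. by move: kp0 kp1; rewrite decayE; move: (_^-1) => k; lra. Qed.

Lemma weight_gt0 k : 0 < decay ^+ k. Proof. by rewrite exprn_gt0// decay_gt0. Qed.

Lemma heavy i N : decay ^+ N <= decay ^+ i / 2 -> (i < N)%N.
Proof.
move=> h; rewrite ltnNge; apply/negP => Ni.
have := ler_wiXn2l (ltW decay_gt0) (ltW decay_lt1) Ni.
by have := weight_gt0 i; lra.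
Qed.

Lemma potential_ge i ls y z : z \in ls -> hit i z y -> decay ^+ z.2 <= potential i ls y.
Proof.
move=> zls hz; rewrite /potential (big_rem z)//= hz lerDl sumr_ge0// => z' _.
exact: ltW (weight_gt0 _).
Qed.

Lemma hit_self i z x : ball_set B0 x -> surface z (psi x) -> hit i z x.
Proof.
move=> Bx sz; apply/asboolP; exists x; split=> //.
rewrite subrr (_ : enorm 0 = 0) ?invr_ge0 ?Qk0//.
by rewrite -(scale0r (0 : 'rV[R]_m)) enormZ normr0 mul0r.
Qed.

Lemma position_not_danger i t B x : position i B -> ball_set B x -> (t <= i)%N ->
  ~ danger t (psi x).
Proof.
move=> [BB0 _ Ji [ls [_ pls cov]]] Bx ti dx.
have [i' [k [u [w]]]] := danger_type (adm (BB0 _ Bx)) dx => /= -[Nt wit gen h].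
have ii : (i' < i)%N.
  apply: leq_trans ti; apply: leq_trans Nt; rewrite -addn1 leq_add2l.
  by apply: leq_trans (delay_ge k); apply: leq_trans J20.
have [z zls [zN sz]] := cov _ _ _ _ _ Bx ii wit gen h.
have := le_trans (potential_ge zls (hit_self i (BB0 _ Bx) sz)) (pls x Bx).
by move=> /heavy; rewrite zN ltnNge (leq_trans Nt ti).
Qed.

(** By [delay_arith] nothing is registered before stage J, so the empty list covers. *)
Lemma position_start : position J B0.
Proof.
split=> //; exists [::]; split=> // [y _|x i' k u w N _ iJ _ _ h].
  by rewrite /potential big_nil divr_ge0// ltW// weight_gt0.
by have [_] := delay_arith J20 h; rewrite leqNgt iJ.
Qed.

Lemma position_shrink i B B' : position i B -> ball_set B' `<=` ball_set B ->
  beta / Q ^+ i <= Defs.radius B' -> position i B'.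
Proof.
move=> [BB0 rB Ji [ls [lsw pls cov]]] B'B rB'; split=> //.
  exact: subset_trans B'B BB0.
exists ls; split=> // [y /B'B|x i' k u w N /B'B]; [exact: pls|exact: cov].
Qed.

Lemma inverse_lipschitz x y : ball_set B0 x -> ball_set B0 y ->
  `|invmx (psi y) - invmx (psi x)| <= C ^+ 5 * `|y - x|.
Proof.
move=> Bx By; have ax := adm Bx; have ay := adm By.
have [_ _ _ xV] := ax; have [_ _ _ yV] := ay.
have -> : invmx (psi y) - invmx (psi x) = - (invmx (psi y) *m ((psi y - psi x) *m invmx (psi x))).
  by rewrite mulmxBl mulmxV ?admissible_unit// mulmxBr mulmx1 mulKmx ?admissible_unit// opprB.
rewrite normrN; apply: le_trans (mulmx_bound yV (mulmx_bound (lip Bx By) xV)) _.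
by apply: le_of_eq; rewrite !exprS expr0; ring.
Qed.

(** The sign and the two inverses come from the derivative of the inverse of h. The factor [V3] may
    be inserted because f3 kills differences of inverses; it makes the estimates proportional to
    [wsize w]. *)
Definition gradient (w : 'rV[int]_n) (x xi : 'rV[R]_m) : R :=
  - (wbar w *m V3 *m (invmx (psi x) *m dpsi x xi *m invmx (psi x)) *m e3) 0 0.

Lemma gradient_linear w x k xi xi' :
  gradient w x (k *: xi + xi') = k * gradient w x xi + gradient w x xi'.
Proof.
rewrite /gradient; set v := wbar w *m V3; set hx := invmx _; rewrite linearP.
rewrite (mulmxDr hx) (mulmxDl (hx *m _)) (mulmxDr v) (mulmxDl (v *m _)).
have e (A B : 'M[R]_1) : - (k *: A + B) 0 0 = k * - A 0 0 - B 0 0 by rewrite !mxE; ring.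
by rewrite -!(scalemxAr, scalemxAl) e.
Qed.

Lemma entry11 (X : 'M[R]_1) : `|X 0 0| = `|X|.
Proof.
apply/eqP; rewrite eq_le ler_entry_norm/=; apply: norm_mx_le => // i j.
by rewrite !ord1.
Qed.

Lemma mul_nilp_e3 w D : f3 *m D = 0 -> wbar w *m D *m e3 = wbar w *m V3 *m D *m e3.
Proof.
by move=> fD; rewrite mulmxBr mulmx1 !mulmxBl -!mulmxA (mulmxA f3) fD mul0mx !mulmx0 subr0.
Qed.

Lemma gradient_approx w x y i : ball_set B0 x -> ball_set B0 y -> (J <= i)%N ->
  `|y - x| <= (Q ^+ i)^-1 ->
  `|(wbar w *m (invmx (psi y) - invmx (psi x)) *m e3) 0 0 - gradient w x (y - x)|
    <= C ^+ 13 * wsize w / Q ^+ i.+1.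
Proof.
move=> Bx By Ji yx; have ax := adm Bx; have ay := adm By.
have [_ _ _ xV] := ax; have [_ _ _ yV] := ay.
set D := _ - invmx (psi x); pose d := psi y - psi x; pose hx := invmx (psi x).
have Qi : (Q ^+ i)^-1 <= Q^-1.
  rewrite lef_pV2 ?posrE ?exprn_gt0// -[leLHS]expr1 ler_weXn2l//.
  by apply: leq_trans Ji; apply: leq_trans J20.
have Qi0 : 0 <= (Q ^+ i)^-1 by rewrite invr_ge0 exprn_ge0// ltW.
have fD : f3 *m D = 0 by exact: nilp_f3 (inv_sub_nilp ax ay).
rewrite (mul_nilp_e3 _ fD) /gradient opprK.
set z := y - x in yx *; set v := wbar w *m V3.
have -> : (v *m D *m e3) 0 0 + (v *m (hx *m dpsi x z *m hx) *m e3) 0 0 =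
   (v *m ((D + hx *m dpsi x z *m hx) *m e3)) 0 0.
  have e (A B : 'M[R]_1) : A 0 0 + B 0 0 = (A + B) 0 0 by rewrite mxE.
  by rewrite e (mulmxA v (D + _)) (mulmxDr v D) (mulmxDl (v *m D)).
(* The error is the linearization error of psi, conjugated by inverses, plus a term of second order
   in y - x. *)
have -> : D + hx *m dpsi x z *m hx = - (hx *m ((d - dpsi x z) *m hx) + D *m (d *m hx)).
  have DE : D = - (invmx (psi y) *m (d *m hx)).
    by rewrite /d /hx mulmxBl mulmxV ?admissible_unit// mulmxBr mulmx1 mulKmx ?admissible_unit// opprB.
  rewrite [in RHS]/D [in RHS](mulmxBl _ _ (d *m hx)) -/hx (mulmxBl d) mulmxBr [in LHS]DE -!mulmxA.
  by apply/matrixP => p q; rewrite !mxE; ring.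
have zJ : `|z| <= (Q ^+ J)^-1.
  by apply: le_trans yx _; rewrite lef_pV2 ?posrE ?exprn_gt0// ler_weXn2l.
have R1 : `|hx *m ((d - dpsi x z) *m hx)| <= C ^+ 4 / Q ^+ i.+1.
  apply: le_trans (mulmx_bound xV (mulmx_bound (lin Bx By zJ) xV)) _.
  have -> : C * (C * (C * (Q^-1 * `|y - x| * C))) = C ^+ 4 * Q^-1 * `|y - x|.
    by rewrite !exprS expr0; ring.
  rewrite (exprS Q i) (invfM Q) mulrA ler_wpM2l// mulr_ge0 ?exprn_ge0 ?invr_ge0 ?(ltW C0) ?(ltW Q0)//.
have R2 : `|D *m (d *m hx)| <= C ^+ 9 / Q ^+ i.+1.
  apply: le_trans (mulmx_bound (inverse_lipschitz Bx By) (mulmx_bound (lip Bx By) xV)) _.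
  have -> : C * (C ^+ 5 * `|y - x| * (C * (C * `|y - x| * C))) = C ^+ 9 * (`|y - x| * `|y - x|).
    by rewrite !exprS expr0; ring.
  rewrite ler_wpM2l ?Ck0// (exprS Q i) (invfM Q).
  by apply: ler_pM => //; exact: le_trans yx Qi.
have R12 : `|- (hx *m ((d - dpsi x z) *m hx) + D *m (d *m hx))| <= C ^+ 10 / Q ^+ i.+1.
  rewrite normrN; apply: le_trans (ler_normD _ _) _; apply: le_trans (lerD R1 R2) _.
  rewrite -mulrDl ler_wpM2r ?invr_ge0 ?Qk0//.
  have k1 : C ^+ 4 <= C ^+ 9 by rewrite ler_weXn2l.
  by have := double_C 9; lra.
rewrite entry11; apply: le_trans (mulmx_bound (lexx _) (mulmx_bound R12 Ce3)) _.
by apply: le_of_eq; rewrite /wsize !exprS expr0; ring.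
Qed.

Lemma surface_near i z x y : ball_set B0 x -> ball_set B0 y -> (i < z.2)%N ->
  `|x - y| <= (Q ^+ i.+1)^-1 -> surface z (psi x) ->
  `|wbar z.1 *m invmx (psi y) *m e3| <= C ^+ 9 * wsize z.1 / Q ^+ i.+1.
Proof.
move=> Bx By iz xy sz; have ax := adm Bx; have ay := adm By; have w0 := wsize_ge0 z.1.
have Qi0 : 0 <= (Q ^+ i.+1)^-1 by rewrite invr_ge0 exprn_ge0// ltW.
have h1 : `|wbar z.1 *m invmx (psi x) *m e3| <= wsize z.1 / Q ^+ i.+1.
  rewrite ler_pdivlMr ?exprn_gt0// mulrC; apply: le_trans sz; rewrite ler_wpM2r//.
  rewrite -[leLHS]mul1r; apply: ler_pM => //.
  by rewrite ler_weXn2l.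
have h2 : `|wbar z.1 *m (invmx (psi y) - invmx (psi x)) *m e3| <= C ^+ 8 * wsize z.1 / Q ^+ i.+1.
  have h3 : `|invmx (psi y) - invmx (psi x)| <= C ^+ 5 / Q ^+ i.+1.
    apply: le_trans (inverse_lipschitz Bx By) _; rewrite distrC.
    by rewrite ler_wpM2l// exprn_ge0// ltW.
  apply: le_trans (nilp_mul_e3 _ (inv_sub_nilp ax ay) h3) _.
  by apply: le_of_eq; rewrite -/(wsize _) (exprD C 3 5); ring.
have -> : wbar z.1 *m invmx (psi y) *m e3 = wbar z.1 *m invmx (psi x) *m e3 +
    wbar z.1 *m (invmx (psi y) - invmx (psi x)) *m e3.
  by rewrite -mulmxDl mulmxBr addrC subrK.
apply: le_trans (ler_normD _ _) _; apply: le_trans (lerD h1 h2) _.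
rewrite -!mulrA; set v := wsize z.1 / _; have v0 : 0 <= v by rewrite mulr_ge0.
have k1 : 1 <= C ^+ 8 by rewrite exprn_ege1.
have := ler_wpM2r v0 k1; have := ler_wpM2r v0 (double_C 8); lra.
Qed.

(** The direction psi x V3 y f3 is tangent, and the derivative along it is - wbar w V3 y because f3
    h^-1 e3 = 1. The vector y selects an entry of largest modulus, with the opposite sign. *)
Lemma gradient_lower w x : ball_set B0 x ->
  exists2 xi, `|xi| <= C ^+ 6 & gradient w x xi = wsize w.
Proof.
move=> Bx; have ax := adm Bx; have [ux _ Cx _] := ax.
set v := wbar w *m V3.
have [y y1 vy] : exists2 y : 'cV[R]_n, `|y| <= 1 & (v *m y) 0 0 = - wsize w.
  have [v0|v0] := eqVneq (wsize w) 0.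
    by exists 0; rewrite ?normr0// mulmx0 mxE v0 oppr0.
  have [j vj] : exists j, `|v 0 j| = wsize w.
    apply: contrapT => h; have : `|v| < wsize w; last by rewrite ltxx.
    apply: norm_mx_lt => [|p q]; first by rewrite lt_def v0 wsize_ge0.
    rewrite lt_neqAle ler_entry_norm andbT ord1.
    by apply/eqP => e; apply: h; exists q.
  exists (- Num.sg (v 0 j) *: delta_mx j 0).
    apply: norm_mx_le => // p q; rewrite !mxE normrM normrN normr_sg.
    by case: (_ != 0); case: (_ && _); rewrite ?normr1 ?normr0 ?mulr0 ?mul0r ?mulr1.
  rewrite -scalemxAr mxE mulNr -vj normrEsg; congr (- (_ * _)).
  by rewrite -colE mxE.
have n1 : `|V3 *m (y *m f3)| <= C ^+ 3.
  have -> : C ^+ 3 = C * (C * (1 * C)) by rewrite !exprS expr0; ring.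
  by apply: mulmx_bound => //; exact: outer_bound.
pose Y := V3 *m (y *m f3).
have nY : nilp e2 e3 f2 f3 Y.
  have f3V : f3 *m V3 = 0 by rewrite mulmxBr mulmx1 mulmxA (spl_f3e3 spl) mul1mx subrr.
  split.
  - by rewrite /Y -!mulmxA (spl_f3E spl) !mulmx0.
  - by rewrite /Y mulmxA f3V mul0mx.
  - by rewrite /Y -!mulmxA (spl_f3e2 spl) !mulmx0.
have nX : nilp e2 e3 f2 f3 (psi x *m Y).
  have -> : psi x *m Y = (psi x - 1%:M) *m Y + Y by rewrite mulmxBl mul1mx subrK.
  by apply: nilpD => //; exact: nilpM ux nY.
have [xi xiX dX] := onto Bx nX.
exists xi.
  apply: le_trans xiX _; apply: le_trans (ler_wpM2l (ltW C0) (mulmx_bound Cx n1)) _.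
  by apply: le_of_eq; rewrite !exprS expr0; ring.
rewrite /gradient -/v dX mulKmx ?admissible_unit//.
have fe : f3 *m invmx (psi x) *m e3 = 1%:M by rewrite (unip_f3 (unip_inv ax)) (spl_f3e3 spl).
have VV : V3 *m V3 = V3.
  by rewrite mulmxBr mulmx1 mulmxBl mul1mx -mulmxA (mulmxA f3) (spl_f3e3 spl) mul1mx subrr subr0.
have vV : v *m V3 = v by rewrite /v -mulmxA VV.
clearbody v.
have -> : v *m (Y *m invmx (psi x)) *m e3 = v *m y.
  by rewrite /Y -!mulmxA (mulmxA f3) fe mulmx1 (mulmxA v) vV.
by rewrite vy opprK.
Qed.

Lemma enorm_center (B : eball R m) : 0 <= Defs.radius B -> ball_set B (Defs.center B).
Proof.
move=> r0; rewrite /ball_set /= subrr (_ : enorm 0 = 0)//.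
by rewrite -(scale0r (0 : 'rV[R]_m)) enormZ normr0 mul0r.
Qed.

(** One dangerous point per k is enough: its obstruction covers every other such point of the ball
    by [covering], since their distance is at most 2 Q^-i and the position excludes danger at time
    i. *)
Lemma register i B k : position i B -> Defs.radius B <= (Q ^+ i)^-1 ->
  exists s : seq obstruction, let N := (i + delay n J k)%N in
  [/\ (size s <= 1)%N, forall z, z \in s -> z.2 = N /\ 0 < wsize z.1 &
   forall x u w, ball_set B x -> witness (N + k) (psi x) u w -> generation N (N + k) w ->
   (N + k + 10 * J < 2 * N + 10)%N -> exists2 z, z \in s & z.2 = N /\ surface z (psi x)].
Proof.
move=> pB rB; set N := (i + delay n J k)%N; have [BB0 _ _ _] := pB.
pose P (x : 'rV[R]_m) u w := [/\ ball_set B x, witness (N + k) (psi x) u w,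
  generation N (N + k) w & (N + k + 10 * J < 2 * N + 10)%N].
have [[x1 [u1 [w1 [Bx1 wit1 gen1 h1]]]]|nP] := pselect (exists x u w, P x u w); last first.
  exists [::]; split=> // x u w Bx wit gen h.
  by exfalso; apply: nP; exists x, u, w.
exists [:: (w1, N)]; split=> // [z|x u w Bx wit gen h].
  rewrite inE => /eqP -> /=; split=> //.
  have := lt_le_trans ltr01 (wsize_lower (adm (BB0 _ Bx1)) wit1).
  by rewrite pmulr_rgt0// exprn_gt0.
exists (w1, N); rewrite ?mem_head//=; split=> //.
apply: (covering (adm (BB0 _ Bx1)) (adm (BB0 _ Bx)) _ (position_not_danger pB Bx1 (leqnn i)) wit1 wit gen1 gen h).
apply: le_trans (inverse_lipschitz (BB0 _ Bx1) (BB0 _ Bx)) _.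
have d : `|x - x1| <= 2 * (Q ^+ i)^-1.
  apply: le_trans (norm_le_enorm _) _.
  rewrite -(subrKA (Defs.center B)) -[Defs.center B - x1]opprB.
  apply: le_trans (enormD _ _) _; rewrite enormN.
  by have := le_trans Bx rB; have := le_trans Bx1 rB; lra.
apply: le_trans (ler_wpM2l (exprn_ge0 5 (ltW C0)) d) _.
rewrite mulrA ler_wpM2r ?invr_ge0 ?Qk0//.
by rewrite mulrC; exact: double_C.
Qed.

Definition gradient_row (w : 'rV[int]_n) (x : 'rV[R]_m) : 'rV[R]_m :=
  \row_j (gradient w x (delta_mx 0 j) / wsize w).

Lemma dotp_gradient_row w x xi : dotp (gradient_row w x) xi = gradient w x xi / wsize w.
Proof.
have gD u v : gradient w x (u + v) = gradient w x u + gradient w x v.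
  by have := gradient_linear w x 1 u v; rewrite scale1r mul1r.
have g0' : gradient w x 0 = 0.
  by have := gD 0 0; rewrite addr0 => h; apply: (addrI (gradient w x 0)); rewrite -h addr0.
rewrite {2}[xi]row_sum_delta (big_morph _ gD g0') mulr_suml; apply: eq_bigr => j _.
have gZ k u : gradient w x (k *: u) = k * gradient w x u.
  by rewrite -[k *: u]addr0 gradient_linear g0' addr0.
by rewrite mxE gZ; ring.
Qed.

Lemma gradient_row_lower w x : ball_set B0 x -> 0 < wsize w ->
  (C ^+ 7)^-1 <= enorm (gradient_row w x).
Proof.
move=> Bx w0; have [xi xiC gxi] := gradient_lower w Bx.
have := dotp_le (gradient_row w x) xi.
rewrite dotp_gradient_row gxi divff ?lt0r_neq0// => h.
have h2 : enorm xi <= C ^+ 7.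
  apply: le_trans (enorm_le_norm _) _; rewrite (exprS C 6); apply: ler_pM => //.
  by apply: (le_trans _ Cm); rewrite ler_nat -addn2 leq_addr.
rewrite -[leLHS]mul1r ler_pdivrMr ?exprn_gt0//; apply: le_trans h _.
by rewrite ler_wpM2l// enorm_ge0.
Qed.

(* The constants are such that the width of the removed strip is a small multiple of
   the radius of [B], because [C ^+ 60 <= Q]. *)
Lemma blocking_move i B (ls : seq obstruction) : ball_set B `<=` ball_set B0 -> (J <= i)%N ->
  0 < Defs.radius B -> Defs.radius B <= (Q ^+ i)^-1 -> beta / Q ^+ i <= Defs.radius B ->
  (forall z, z \in ls -> 0 < wsize z.1 /\ (i < z.2)%N) ->
  exists A, alice_legal beta B A /\ forall y, ball_set B y -> ~ nbhd_set A.1 A.2 y ->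
    potential i.+1 ls y <= (1 - m.+2%:R^-1) * \sum_(z <- ls) decay ^+ z.2.
Proof.
move=> BB0 Ji r0 rB Br lsP; set y0 := Defs.center B.
have By0 : ball_set B0 y0 by apply: BB0; apply: enorm_center; exact: ltW.
(* With this constant, [dotp (gradient_row z.1 y0) y + k z] is the first order approximation at the
   centre of the equation of the hypersurface, divided by [wsize]. *)
pose k (z : obstruction) := (wbar z.1 *m invmx (psi y0) *m e3) 0 0 / wsize z.1 -
  dotp (gradient_row z.1 y0) y0.
pose delta := C ^+ 14 / Q ^+ i.+1.
have delta0 : 0 <= delta by rewrite divr_ge0 ?Ck0 ?(ltW Q0).
have c70 : 0 < (C ^+ 7)^-1 by rewrite invr_gt0 exprn_gt0.
have hY z y : z \in ls -> ball_set B y -> hit i.+1 z y ->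
    `|dotp (gradient_row z.1 y0) y + k z| <= delta.
  move=> zls By /asboolP[x [Bx xy sz]]; have [wz iz] := lsP z zls.
  have h1 := surface_near Bx (BB0 _ By) iz (le_trans (norm_le_enorm _) xy) sz.
  have h2 := gradient_approx z.1 By0 (BB0 _ By) Ji (le_trans (norm_le_enorm _) (le_trans By rB)).
  have -> : dotp (gradient_row z.1 y0) y + k z =
    ((wbar z.1 *m invmx (psi y) *m e3) 0 0 - ((wbar z.1 *m (invmx (psi y) - invmx (psi y0)) *m e3) 0 0
      - gradient z.1 y0 (y - y0))) / wsize z.1.
    have -> : (wbar z.1 *m (invmx (psi y) - invmx (psi y0)) *m e3) 0 0 =
      (wbar z.1 *m invmx (psi y) *m e3) 0 0 - (wbar z.1 *m invmx (psi y0) *m e3) 0 0.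
      have e (X Y : 'M[R]_1) : (X - Y) 0 0 = X 0 0 - Y 0 0 by rewrite !mxE.
      by rewrite (mulmxBr (wbar z.1)) (mulmxBl (wbar z.1 *m _)) e.
    have e : dotp (gradient_row z.1 y0) y - dotp (gradient_row z.1 y0) y0 =
        gradient z.1 y0 (y - y0) / wsize z.1.
      by rewrite -dotp_gradient_row -[in RHS]scaleN1r dotpDr dotpZr mulN1r.
    have -> : dotp (gradient_row z.1 y0) y = dotp (gradient_row z.1 y0) y0 +
      gradient z.1 y0 (y - y0) / wsize z.1 by rewrite -e; ring.
    by rewrite /k; ring.
  rewrite normrM normfV (gtr0_norm wz) ler_pdivrMr//.
  apply: le_trans (ler_normB _ _) _; rewrite entry11; apply: le_trans (lerD h1 h2) _.
  have -> : delta * wsize z.1 = C ^+ 14 * (wsize z.1 / Q ^+ i.+1) by rewrite /delta; ring.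
  rewrite -!mulrA; set v := wsize z.1 / _; have v0 : 0 <= v.
    by rewrite divr_ge0 ?Qk0 ?(ltW wz).
  have k1 : C ^+ 9 <= C ^+ 13 by rewrite ler_weXn2l.
  have := ler_wpM2r v0 k1; have := ler_wpM2r v0 (double_C 13); lra.
have YD y : ball_set B y -> `|y| <= `|y0| + Defs.radius B.
  move=> By; rewrite -(subrK y0 y) addrC; apply: le_trans (ler_normD _ _) _.
  by rewrite lerD2l; exact: le_trans (norm_le_enorm _) By.
have [L hL Lbad] := @blocking_hyperplane R m _ ls (fun z => decay ^+ z.2)
  (fun z => gradient_row z.1 y0) k (hit i.+1) (ball_set B) _ _ delta m0
  (fun z => ltW (weight_gt0 z.2)) c70 delta0 YD
  (fun z zls => gradient_row_lower By0 (lsP z zls).1) hY.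
exists (L, beta * Defs.radius B); split; first by split=> //; rewrite /= mulr_gt0.
move=> y By nL; rewrite leNgt; apply/negP => /(Lbad y By) h; apply: nL.
rewrite /nbhd_set /=; apply: le_lt_trans h _.
have bC : C^-1 <= beta by rewrite -[leLHS]mul1r ler_pdivrMr// mulrC.
apply: (@lt_le_trans _ _ (C^-1 * (C^-1 / Q ^+ i))); last first.
  apply: ler_pM => //; rewrite ?invr_ge0 ?mulr_ge0 ?invr_ge0 ?exprn_ge0 ?(ltW C0) ?(ltW Q0)//.
  by apply: (le_trans _ Br); rewrite ler_wpM2r ?invr_ge0 ?Qk0.
have m1C : m.+1%:R <= C by apply: (le_trans _ Cm); rewrite ler_nat.
apply: (@le_lt_trans _ _ (C ^+ 23 / Q ^+ i.+1)).
  have -> : 2 * m.+1%:R * delta / (C ^+ 7)^-1 = m.+1%:R * (2 * C ^+ 21) / Q ^+ i.+1.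
    by rewrite /delta (exprD C 14 7) invrK; ring.
  rewrite ler_wpM2r ?invr_ge0 ?Qk0// (exprS C 22).
  apply: ler_pM => //; last exact: double_C.
  by rewrite mulr_ge0// exprn_ge0// ltW.
rewrite (exprS Q i) (invfM Q) !mulrA ltr_pM2r ?invr_gt0 ?exprn_gt0//.
rewrite ltr_pdivrMr// -invfM mulrC ltr_pdivlMr ?mulr_gt0// -expr2 -exprD.
apply: (@lt_le_trans _ _ (C ^+ 26)); last exact: Cpow_Q.
by rewrite ltr_eXn2l//; have := C2; lra.
Qed.

(** Obstructions that do not hit the centre cannot meet B and are dropped. With q = 1/(m+2), the
    others weigh at most theta^i / 2 and the new ones at most theta^i q/4; the move brings the total
    below theta^(i+1) / 2, since (1 - q)(1/2 + q/4) <= (1 - q/2)/2. *)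
Lemma position_step i B : position i B -> 0 < Defs.radius B -> Defs.radius B <= (Q ^+ i)^-1 ->
  exists A, alice_legal beta B A /\ forall B', bob_legal beta B A B' -> position i.+1 B'.
Proof.
move=> pB r0 rB; have [BB0 Br Ji [ls [lsw pls cov]]] := pB.
set y0 := Defs.center B; have By0 : ball_set B y0 by apply: enorm_center; exact: ltW.
have [s Hs] := choice (fun k => register k pB rB).
(* By [delay_arith] no k above 2(i + J) occurs at this stage. *)
pose old := [seq z <- ls | hit i z y0]; pose M := (2 * (i + J)).+1.
pose new := flatten [seq s k | k <- iota 0 M].
have newP z : z \in new -> exists2 k, (k < M)%N & z \in s k.
  by move=> /flattenP[s' /mapP[k kM ->] zs]; exists k => //; move: kM; rewrite mem_iota add0n.
have lsP z : z \in old ++ new -> 0 < wsize z.1 /\ (i < z.2)%N.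
  rewrite mem_cat => /orP[|/newP[k _ zs]]; last first.
    have [_ /(_ z zs)[-> w0] _] := Hs k; split=> //.
    by rewrite -addn1 leq_add2l; apply: leq_trans (delay_ge k); apply: leq_trans J20.
  rewrite mem_filter => /andP[hz zls]; split; first exact: lsw.
  by apply: heavy; apply: le_trans (pls y0 By0); exact: potential_ge.
have [A [Alegal HA]] := blocking_move BB0 Ji r0 rB Br lsP.
exists A; split=> // B' [B'B rB']; split; [| |exact: leq_trans Ji (leqnSn i)|].
- by move=> x B'x; have [Bx _] := B'B x B'x; exact: BB0.
- apply: le_trans rB'; rewrite (ler_pM2l beta0); apply: (le_trans _ Br).
  rewrite (exprS Q i) (invfM Q) ler_wpM2r ?invr_ge0 ?Qk0//.
  have bC : C^-1 <= beta by rewrite -[leLHS]mul1r ler_pdivrMr// mulrC.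
  by apply: (le_trans _ bC); rewrite lef_pV2 ?posrE// (@Cpow_Q 1).
exists (old ++ new); split.
- by move=> z /lsP[].
- move=> y B'y; have [By nL] := B'B y B'y; apply: le_trans (HA y By nL) _.
  have oldw : \sum_(z <- old) decay ^+ z.2 <= decay ^+ i / 2.
    by rewrite big_filter; exact: pls.
  have neww : \sum_(z <- new) decay ^+ z.2 <= decay ^+ i * (4 * m.+2%:R)^-1.
    have l0 : (0 < lag n)%N by rewrite /lag !muln_gt0/= addn_gt0 orbT.
    have d1 : 0 < 1 - decay by rewrite subr_gt0 decay_lt1.
    rewrite big_flatten big_map.
    apply: (@le_trans _ _ (\sum_(0 <= k < M) decay ^+ i * (decay ^+ J * decay ^+ (k %/ lag n)))).
      rewrite /index_iota subn0; apply: ler_sum => k _.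
      have [sz sP _] := Hs k; case: (s k) sz sP => [|z [|//]] _ sP.
        by rewrite big_nil !mulr_ge0// ltW// weight_gt0.
      have [zN _] := sP z (mem_head _ _).
      by rewrite big_seq1 zN -!exprD /delay.
    rewrite -!mulr_sumr ler_pM2l ?weight_gt0//; apply: (le_trans _ decayJ).
    by rewrite ler_wpM2l ?(ltW (weight_gt0 _))// geometric_steps ?(ltW decay_gt0) ?decay_lt1.
  rewrite big_cat/= exprS.
  have k0 := kp0; have k1 := kp1; have p0 := weight_gt0 i.
  have -> : decay * decay ^+ i / 2 = decay ^+ i * ((1 - m.+2%:R^-1 / 2) / 2).
    by rewrite {1}decayE; ring.
  apply: (@le_trans _ _ ((1 - m.+2%:R^-1) * (decay ^+ i * (1 / 2 + (4 * m.+2%:R)^-1)))).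
    apply: ler_wpM2l; first by rewrite subr_ge0.
    by apply: le_trans (lerD oldw neww) _; rewrite (mulrDr (decay ^+ i)) mul1r.
  rewrite mulrCA ler_wpM2l ?(ltW p0)// invfM; move: (_^-1) k0 k1 => q q0 q1; nra.
- move=> x i' k u w N B'x; have [Bx _] := B'B x B'x; rewrite ltnS leq_eqVlt => /orP[/eqP ii wit gen h|ii wit gen h].
    rewrite /N ii in wit gen h *; have [_ _ /(_ x u w Bx wit gen h)[z zs zP]] := Hs k.
    exists z => //; rewrite mem_cat; apply/orP; right; apply/flattenP; exists (s k) => //.
    apply/mapP; exists k => //; rewrite mem_iota add0n ltnS.
    by have [] := delay_arith J20 h.
  have [z zls [zN sz]] := cov x i' k u w Bx ii wit gen h.
  exists z => //; rewrite mem_cat mem_filter zls andbT; apply/orP; left.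
  apply/asboolP; exists x; split=> //; [exact: BB0|exact: le_trans Bx rB].
Qed.

Lemma strategy : exists inv : nat -> eball R m -> Prop, [/\ inv J B0,
  forall i B, inv i B -> 0 < Defs.radius B -> Defs.radius B <= (Q ^+ i)^-1 ->
    exists A, alice_legal beta B A /\ forall B', bob_legal beta B A B' -> inv i.+1 B',
  forall i B B', inv i B -> (Q ^+ i)^-1 < Defs.radius B -> ball_set B' `<=` ball_set B ->
    beta * Defs.radius B <= Defs.radius B' -> inv i B' &
  forall x, (forall i, (J <= i)%N -> exists2 B, inv i B & ball_set B x) ->
    exists2 e, 0 < e & forall t (u : 'cV[int]_n), u != 0 ->
      e <= `|T t *m psi x *m g0 *m map_mx intr u|].
Proof.
exists position; split; [exact: position_start|exact: position_step| |].
  move=> i B B' pB rB B'B rB'; apply: position_shrink pB B'B _.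
  by apply: le_trans rB'; rewrite ler_pM2l// ltW.
move=> x xP; exists (eps / C ^+ 2) => [|t u u0]; first by rewrite divr_gt0// exprn_gt0.
have [B pB Bx] := xP _ (leq_maxr t J); have [BB0 _ _ _] := pB.
apply: not_danger_min => //; first by apply: adm; exact: BB0.
exact: position_not_danger pB Bx (leq_maxl t J).
Qed.

End Strategy.

End Arithmetic.

(** * The game in a chart *)

(** Passing to a power of the flow makes a as large as desired while the vectors, the projection and
    K stay the same; C can therefore be fixed beforehand. *)
Lemma splitting_scale (R : realType) n (T U : nat -> 'M[R]_n) e2 e3 f2 f3 l2 l3 a b c K L :
  splitting T U e2 e3 f2 f3 l2 l3 a b c K -> (0 < L)%N ->
  splitting (fun k => T (L * k)%N) (fun k => U (L * k)%N) e2 e3 f2 f3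
    (l2 ^+ L) (l3 ^+ L) (a ^+ L) (b ^+ L) (c ^+ L) K.
Proof.
move=> spl L0; have b0 := spl_b0 spl; have a0 := spl_a0 spl; have c0 := spl_c0 spl.
case: (spl) => TU f3e3 f3e2 f2e3 e2f2e2 f2e2f2 Te3 f3T Te2 f2T l3E l2E b1 ba abc ca K1 TE UE.
split=> //.
- by move=> k; rewrite Te3 exprM.
- by move=> k; rewrite f3T exprM.
- by move=> k; rewrite Te2 exprM.
- by move=> k; rewrite f2T exprM.
- by rewrite normrX l3E exprVn.
- by rewrite normrX l2E.
- exact: exprn_ege1.
- by rewrite ltrXn2r ?nnegrE ?(ltW a0) ?(ltW b0)// -lt0n.
- by rewrite -exprMn lerXn2r ?nnegrE ?mulr_ge0 ?(ltW a0) ?(ltW b0) ?(ltW c0).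
- by rewrite exprAC lerXn2r ?nnegrE ?exprn_ge0 ?(ltW a0) ?(ltW c0).
- by move=> k; rewrite -exprM.
- by move=> k; rewrite -exprM.
Qed.

Lemma small_power (R : realType) (q e : R) : 0 <= q -> q < 1 -> 0 < e ->
  exists N, forall k, (N <= k)%N -> q ^+ k <= e.
Proof.
move=> q0 q1 e0; have := @cvg_expr R q; rewrite ger0_norm// => /(_ q1).
move=> /cvgrPdist_le/(_ e e0)[N _ NP]; exists N => k Nk.
by have := NP k Nk; rewrite sub0r normrN ger0_norm// exprn_ge0.
Qed.

Lemma norm_invmx_le (R : realType) n (A : 'M[R]_n) D : \det A = 1 -> `|A| <= D ->
  `|invmx A| <= (#|'S_n.-1|)%:R * D ^+ n.-1.
Proof.
move=> dA AD; have D0 : 0 <= D by apply: le_trans AD.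
have -> : invmx A = \adj A by rewrite /invmx unitmxE dA unitr1 invr1 scale1r.
apply: norm_mx_le => [|i j]; first by rewrite mulr_ge0// exprn_ge0.
rewrite mxE /cofactor normrM normrX normrN1 expr1n mul1r.
apply: norm_det_le => p q; rewrite !mxE; exact: le_trans (ler_entry_norm _ _ _) AD.
Qed.

Lemma le_2_sum (R : realType) (s : seq R) x : x \in s -> x <= 2 + \sum_(y <- s) `|y|.
Proof.
move=> xs; rewrite (big_rem x)//=; have := ler_norm x.
have : 0 <= \sum_(y <- rem x s) `|y| by apply: sumr_ge0.
lra.
Qed.

Section ChartGame.
Variables (R : realType) (n : nat) (g : R -> SL R n).
Hypothesis gP : one_parameter_subgroup g.
Hypothesis n2 : (2 <= n)%N.
Let T := fun k : nat => SLmx (g k%:R).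
Let U := fun k : nat => SLmx (g (- k%:R)).
Variables (e2 e3 : 'cV[R]_n) (f2 f3 : 'rV[R]_n) (l2 l3 a b c K : R).
Hypothesis spl : splitting T U e2 e3 f2 f3 l2 l3 a b c K.
Variable g0 : 'M[R]_n.
Hypothesis det_g0 : \det g0 = 1.

(** Excludes charts of dimension 0, in which there is no hyperplane to play. *)
Lemma exists_nilp : exists2 X, nilp e2 e3 f2 f3 X & X != 0.
Proof.
pose V := 1%:M - e3 *m f3.
have f3V : f3 *m V = 0 by rewrite mulmxBr mulmx1 mulmxA (spl_f3e3 spl) mul1mx subrr.
have VN : V != 0.
  apply/eqP => /eqP; rewrite subr_eq0 => /eqP V0.
  have := mxrankM_maxl e3 f3; rewrite -V0 mxrank1 => /leq_trans/(_ (rank_leq_col _)).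
  by rewrite leqNgt n2.
have [j Vj] : exists j, col j V != 0.
  apply/existsP; apply: contraT; rewrite negb_exists => /forallP h; case/eqP: VN.
  apply/matrixP => p q; have := h q; rewrite negbK => /eqP/matrixP/(_ p 0).
  by rewrite !mxE.
exists (V *m (delta_mx j 0 *m f3)); first split.
- by rewrite -!mulmxA (spl_f3E spl) !mulmx0.
- by rewrite mulmxA f3V mul0mx.
- by rewrite -!mulmxA (spl_f3e2 spl) !mulmx0.
apply: contra Vj => /eqP h; rewrite colE -[V *m _]mulmx1 -(spl_f3e3 spl) !mulmxA.
by rewrite -(mulmxA V) h mul0mx.
Qed.

(** Every s >= 0 is within L of a multiple of L, and g is bounded on [-L, L]. *)
Lemma discrete_to_continuous L (A : 'M[R]_n) e : (0 < L)%N -> 0 < e ->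
  (forall t (u : 'cV[int]_n), u != 0 -> e <= `|T (L * t)%N *m A *m g0 *m map_mx intr u|) ->
  exists2 e', 0 < e' & forall s : R, 0 <= s -> forall u : 'cV[int]_n, u != 0 ->
    e' <= `|SLmx (g s) *m A *m g0 *m map_mx intr u|.
Proof.
move=> L0 e0 H; have [M M1 HM] := ops_bounded gP L%:R.
have M0 : 0 < M by lra.
have nM : 0 < n%:R * M by rewrite mulr_gt0// ltr0n; lia.
exists (e / (n%:R * M)) => [|s s0 u u0]; first by rewrite divr_gt0.
pose t := Num.truncn (s / L%:R).
have L0' : 0 < L%:R :> R by rewrite ltr0n.
have sL : 0 <= s / L%:R by rewrite divr_ge0// ltW.
have /andP[t1 t2] := truncn_itv sL; rewrite -/t in t1 t2.
rewrite ler_pdivlMr// mulrC in t1; rewrite ltr_pdivrMr// in t2.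
pose r := (L * t)%:R - s.
have rL : `|r| <= L%:R.
  have h : (L * t)%:R = L%:R * t%:R :> R by rewrite natrM.
  rewrite ler_norml /r h; apply/andP; split; last by lra.
  by move: t2; rewrite -natr1 mulrDl; lra.
have TE : T (L * t)%N = SLmx (g r) *m SLmx (g s).
  by have [_ gD] := gP; rewrite -SLmxM -gD /T /r subrK.
have := H t u u0; rewrite TE -!mulmxA => h; rewrite ler_pdivrMr//; apply: le_trans h _.
apply: le_trans (norm_mulmx _ _) _; rewrite [leRHS]mulrC -mulrA ler_wpM2l//.
by rewrite ler_wpM2r// HM.
Qed.

Lemma ball_set_convex m (B : eball R m) x y s : ball_set B x -> ball_set B y ->
  0 <= s -> s <= 1 -> ball_set B (x + s *: (y - x)).
Proof.
rewrite /ball_set /= => Bx By s0 s1; set k := Defs.center B in Bx By *.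
have -> : x + s *: (y - x) - k = (1 - s) *: (x - k) + s *: (y - k).
  by apply/matrixP => p q; rewrite !mxE; ring.
apply: le_trans (enormD _ _) _; rewrite !enormZ !ger0_norm ?subr_ge0//.
have s1' : 0 <= 1 - s by rewrite subr_ge0.
have := ler_wpM2l s1' Bx; have := ler_wpM2l s0 By; lra.
Qed.

Lemma chart_HAW m (V : set 'M[R]_n) (phi : 'M[R]_n -> 'rV[R]_m) (S : set 'M[R]_n) beta :
  C1_chart [set A | nilp e2 e3 f2 f3 (A - 1%:M)] V phi -> 0 < beta ->
  (forall A e, V A -> 0 < e -> (forall s : R, 0 <= s -> forall u : 'cV[int]_n, u != 0 ->
     e <= `|SLmx (g s) *m A *m g0 *m map_mx intr u|) -> S A) ->
  beta_HAW beta (phi @` V) (phi @` (S `&` V)).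
Proof.
move=> chart beta0 SP; set W := phi @` V.
have [psi [psiC1 psiV psin onto]] := chart_inverse (@nilpZ _ _ _ _ _ _) (@nilpD _ _ _ _ _ _) chart.
have SW : phi @` (S `&` V) `<=` W by move=> _ [A [SA VA] <-]; exists A.
(* In an empty chart Bob has no opening ball, so any strategy will do. *)
have [[x0 Wx0]|W0] := pselect (exists x, W x); last first.
  split=> //; exists (fun=> (setT, 0)) => B [r0 BW]; exfalso; apply: W0.
  by exists (Defs.center (B 0%N)); apply: BW; apply: enorm_center; exact: ltW.
have m0 : (0 < m)%N.
  rewrite lt0n; apply/eqP => m0; have [X nX /eqP X0] := exists_nilp; apply: X0.
  have [||C _ /(_ x0 X erefl nX)[xi _ <-]] := onto [set x0]; [exact: compact_set1|by move=> _ ->|].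
  have -> : xi = 0 by apply/rowP => j; exfalso; have := ltn_ord j; move: (nat_of_ord j) => q; rewrite m0.
  by rewrite linear0.
apply: beta_HAW_of_stages => // B0 [r0 BW].
have cK : compact (ball_set B0) by exact: ball_set_compact.
have [C1 C11 psi_le] : exists2 C : R, 1 <= C & forall x, ball_set B0 x -> `|psi x| <= C.
  apply: compact_norm_bound => // x /BW Wx; have [dpsi _] := psiC1 x Wx.
  exact: differentiable_continuous.
have [C2 C21 psi_lip] := chart_lipschitz psiC1 BW cK (@ball_set_convex _ B0).
have [C3 C31 psi_onto] := onto _ cK BW.
have [C4 C41 short] := short_dual_vector R n.
have [C5 C51 mins] := small_minors R n.
(* None of these constants involves L or J, which are chosen afterwards in terms of C. *)
pose s := [:: n%:R; K; `|e2|; `|e3|; `|f2|; `|f3|; `|spl_E e2 e3 f2 f3|; `|1%:M - e3 *m f3|;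
  `|g0|; `|invmx g0|; C1; (#|'S_n.-1|)%:R * C1 ^+ n.-1; C2; C3; C4; C5; m.+2%:R; beta^-1].
pose C := 2 + \sum_(y <- s) `|y|.
have CP x : x \in s -> x <= C by exact: le_2_sum.
have [[[Cn CK Ce2 Ce3] [Cf2 Cf3 CE CV] [Cg0 Cg0V CC1 CC1']] [[CC2 CC3 CC4 CC5] [Cm Cbeta]]] :
  [/\ [/\ n%:R <= C, K <= C, `|e2| <= C & `|e3| <= C],
    [/\ `|f2| <= C, `|f3| <= C, `|spl_E e2 e3 f2 f3| <= C & `|1%:M - e3 *m f3| <= C] &
    [/\ `|g0| <= C, `|invmx g0| <= C, C1 <= C & (#|'S_n.-1|)%:R * C1 ^+ n.-1 <= C]] /\
  ([/\ C2 <= C, C3 <= C, C4 <= C & C5 <= C] /\ (m.+2%:R <= C /\ beta^-1 <= C)).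
  by do !split; apply: CP; rewrite !inE eqxx ?orbT.
have C_ge2 : 2 <= C by rewrite lerDl sumr_ge0.
have C0 : 0 < C by lra.
clearbody C; clear s CP.
have [L L0 CL] : exists2 L, (0 < L)%N & C ^+ 60 <= a ^+ L.
  have C600 : 0 < (C ^+ 60)^-1 by rewrite invr_gt0 exprn_gt0.
  have a0 := spl_a0 spl; have aV1 : a^-1 < 1 by rewrite invf_lt1// (spl_a1 spl).
  have [|N NP] := @small_power R a^-1 _ _ aV1 C600; first by rewrite invr_ge0 ltW.
  exists N.+1 => //; have := NP N.+1 (leqnSn N).
  by rewrite exprVn lef_pV2 ?posrE ?exprn_gt0.
have spl' := splitting_scale spl L0; set a' := a ^+ L in CL spl'; set c' := c ^+ L in spl'.
pose Q := expansion a' c'.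
have a1' := spl_a1 spl'; have c1' := spl_c1 spl'.
have Q1 : 1 < Q by rewrite /Q /expansion; have := c1'; have := a1'; nra.
have Q0 : 0 < Q by lra.
have QV1 : Q^-1 < 1 by rewrite invf_lt1.
have QV0 : 0 < Q^-1 by rewrite invr_gt0.
have [d d0 psi_lin] := chart_linearization psiC1 BW cK (@ball_set_convex _ B0) QV0.
have d20 : 0 < d / 2 by lra.
have [N1 N1P] := small_power (ltW QV0) QV1 d20.
have rb0 : 0 < Defs.radius B0 / beta by rewrite divr_gt0.
have [N2 N2P] := small_power (ltW QV0) QV1 rb0.
have D0 := decay_gt0 R m; have D1 := decay_lt1 R m.
have l0 : 0 < (lag n)%:R / (1 - decay R m).
  by rewrite divr_gt0 ?subr_gt0// ltr0n /lag !muln_gt0/= addn_gt0 orbT.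
have k0 : 0 < (4 * m.+2%:R)^-1 / ((lag n)%:R / (1 - decay R m)).
  by rewrite divr_gt0// invr_gt0 mulr_gt0.
have [N3 N3P] := small_power (ltW D0) D1 k0.
(* The summands serve the integer arithmetic, the radius of linearization, the size of the opening
   ball and the smallness of the new weights. *)
pose J := (20 + N1 + N2 + N3)%N.
have [J20 J1 J2 J3] : [/\ (20 <= J)%N, (N1 <= J)%N, (N2 <= J)%N & (N3 <= J)%N].
  by rewrite /J; clear; split; lia.
have T0' : T (L * 0)%N = 1%:M by rewrite muln0 /T (ops0 gP).
have weaken (p q x : R) : 0 <= p -> 0 < q -> q <= C -> x < p / C -> x < p / q.
  move=> p0 q0 qC h; apply: lt_le_trans h _; rewrite ler_wpM2l// lef_pV2 ?posrE//.
have adm x : ball_set B0 x -> admissible e2 e3 f2 f3 C (psi x).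
  move=> Bx; have nx := psin x (BW x Bx); have dx : \det (psi x) = 1.
    by rewrite -[psi x](subrK 1%:M) addrC (nilp_det spl nx).
  split=> //; first exact: le_trans (psi_le x Bx) CC1.
  exact: le_trans (norm_invmx_le dx (psi_le x Bx)) CC1'.
have [inv [inv0 inv1 inv2 inv3]] : exists inv : nat -> eball R m -> Prop, [/\ inv J B0,
  forall i B, inv i B -> 0 < Defs.radius B -> Defs.radius B <= (Q ^+ i)^-1 ->
    exists A, alice_legal beta B A /\ forall B', bob_legal beta B A B' -> inv i.+1 B',
  forall i B B', inv i B -> (Q ^+ i)^-1 < Defs.radius B -> ball_set B' `<=` ball_set B ->
    beta * Defs.radius B <= Defs.radius B' -> inv i B' &
  forall x, (forall i, (J <= i)%N -> exists2 B, inv i B & ball_set B x) ->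
    exists2 e, 0 < e & forall t (u : 'cV[int]_n), u != 0 ->
      e <= `|T (L * t)%N *m psi x *m g0 *m map_mx intr u|].
  apply: (@strategy R n (fun k => T (L * k)%N) (fun k => U (L * k)%N) e2 e3 f2 f3 (l2 ^+ L) (l3 ^+ L)
    a' (b ^+ L) c' K spl' g0 C J _ _ _ _ _ _ _ _ _ _ _ _ _ _ _ _ _ _ m psi (fun x => 'd psi x) beta B0) => //.
  - by move=> k; exact: SL_det.
  - move=> h k dh k1 k2 [u u0 hu]; apply: short => //; exists u => //.
    by apply: weaken hu => //; [rewrite exprn_ge0// ltW|lra].
  - move=> h e dh h1 h2 h3 w1 w2 hw; apply: (mins h e) => //.
    by apply: weaken hw => //; [rewrite exprn_ge0// ltW|lra].
  - by rewrite -ler_pdivrMr// mul1r.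
  - move=> x y Bx By; apply: le_trans (psi_lip x y Bx By) _; exact: ler_wpM2r.
  - move=> y X By nX; have [xi h hX] := psi_onto y X By nX; exists xi => //.
    by apply: le_trans h _; rewrite ler_wpM2r.
  - move=> x y Bx By h; apply: psi_lin => //; apply: le_lt_trans h _.
    by have := N1P J J1; rewrite exprVn; move: (_^-1) => p; lra.
  - by have := N2P J J2; rewrite exprVn ler_pdivlMr// mulrC.
  - by have := N3P J J3; rewrite ler_pdivlMr.
exists inv, J, (fun i => (Q ^+ i)^-1); split=> // [i|x Wx xP]; first by rewrite invr_gt0 exprn_gt0.
have [e e0 eP] := inv3 x xP; have [Vx phix] := psiV x Wx.
have [e' e0' eP'] := discrete_to_continuous L0 e0 eP.
by exists (psi x) => //; split=> //; exact: SP e0' eP'.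
Qed.

End ChartGame.

Lemma lattice_min_ge_pi (R : realType) n (h : SL R n) (e : R) :
  (forall u : 'cV[int]_n, u != 0 -> e <= `|SLmx h *m map_mx intr u|) ->
  lattice_min_ge e (\pi_(lattices R n) h)%qT.
Proof.
move=> he k /eqmodP/asboolP[Z [dZ hZ]] u u0.
have -> : SLmx k = SLmx h *m map_mx intr Z by rewrite -hZ -SLmxM mulgA mulgV mul1g.
rewrite -mulmxA -map_mxM; apply: he; apply: contra u0 => /eqP Zu.
have uZ : Z \in unitmx by rewrite unitmxE dZ unitr1.
by rewrite -(mulKmx uZ u) Zu mulmx0.
Qed.

Theorem theorem1p3 (R : realType) (n : nat) (g : R -> SL R n)
    (lambda : 'I_n -> R[i]) :
  (2 <= n)%N ->
  one_parameter_subgroup g ->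
  diagonalizable_subgroup g ->
  eigenvalue_list (g 1) lambda ->
  #|[set i : 'I_n | Normc.normc (lambda i) < 1]%SET| = 1%N ->
  (n - 2 <= #|[set i : 'I_n | Normc.normc (lambda i) == max_modulus lambda]%SET|)%N ->
  forall Lambda : lattices R n,
    HAW_on_manifold
      [set SLmx h | h in horospherical g]
      [set SLmx h | h in horospherical g `&`
         [set h | bounded_orbit_points (forward_ray g) (translate h Lambda)]].
Proof.
move=> n2 gP [P uP diagP] eigP card_lt1 card_max Lambda m V phi chart beta beta0 _.
have [gc gD] := gP.
have /similar_diagPex[d /(similarP uP) PT1] := diagP 1.
have [e2 [e3 [f2 [f3 [l2 [l3 [a [b [c [K spl]]]]]]]]]] :
    exists e2 e3 f2 f3 l2 l3 a b c K, splitting (fun k => SLmx (g k%:R))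
      (fun k => SLmx (g (- k%:R))) e2 e3 f2 f3 l2 l3 a b c K.
  apply: (@exists_splitting R n _ _ P d _ _ _ uP PT1 lambda n2 _ eigP card_lt1 card_max).
  - by rewrite (ops0 gP).
  - by move=> k; rewrite -SLmxM -gD natr1.
  - by move=> k; rewrite -SLmxM -gD subrr (ops0 gP).
  - exact: SL_det.
rewrite (horospherical_set gP spl) in chart.
pose g0 := SLmx (repr Lambda); have det_g0 : \det g0 = 1 := SL_det _.
apply: (chart_HAW gP n2 spl det_g0 chart beta0) => A e VA e0 Ae.
have := VA; have [[D [_ VD _]] _ _] := chart; rewrite VD => -[].
rewrite -(horospherical_set gP spl) => -[h hg hA] _; exists h => //; split=> //.
apply: (bounded_lattices_min_ge e0) => _ [_ [s /= s0 <-] <-].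
rewrite translate_pi; apply: lattice_min_ge_pi => u u0.
by rewrite !SLmxM hA mulmxA; exact: Ae.
Qed.
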